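(* Let $d\ge2$ be an integer, $\nu=\frac{d-2}{2}$, $r>0$, let $x\in\mathbf{R}^d$ with $x\ne0$ and $|x|\neq r$, let $v\in\mathbf{R}^d$ with $v\ne0$, and let $\alpha=\frac{\langle v,x\rangle}{|v|\,|x|}$. Let $B$ be a standard $d$-dimensional Brownian motion with $B_0=x$ and let $\sigma$ be its first hitting time of the sphere $S^{d-1}_r=\{y\in\mathbf{R}^d:|y|=r\}$. Let $\lambda>0$ and, for $\mu\ge0$, put $$Z_\mu^{(0),\lambda}(|x|,r)=\frac{K_\mu(|x|\sqrt{2\lambda})}{K_\mu(r\sqrt{2\lambda})}\ \text{ if }|x|>r,\qquad Z_\mu^{(0),\lambda}(|x|,r)=\frac{I_\mu(|x|\sqrt{2\lambda})}{I_\mu(r\sqrt{2\lambda})}\ \text{ if }|x|<r.$$ When $d=2$, one has $$E[e^{\langle v,B_\sigma\rangle-\lambda\sigma}]=I_0(|v|r)\,Z_0^{(0),\lambda}(|x|,r)+\sum_{n=1}^\infty n\,C_n^0(\alpha)\,I_n(|v|r)\,Z_n^{(0),\lambda}(|x|,r).$$ When $d\ge3$, one has $$E[e^{\langle v,B_\sigma\rangle-\lambda\sigma}]=2^\nu\,\Gamma(\nu)\sum_{n=0}^\infty(\nu+n)\,C_n^\nu(\alpha)\,\frac{I_{\nu+n}(|v|r)}{(|v|\,|x|)^\nu}\,Z_{\nu+n}^{(0),\lambda}(|x|,r).$$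
   Context: $\langle\cdot,\cdot\rangle$ and $|\cdot|$ are the Euclidean inner product and norm on $\mathbf{R}^d$. The integrand $e^{\langle v,B_\sigma\rangle-\lambda\sigma}$ is understood to be $0$ on $\{\sigma=\infty\}$. $I_\mu$ and $K_\mu$ are the modified Bessel functions of the first and second kind. $C_n^\nu$ is the Gegenbauer polynomial. For $\nu>0$ it is characterized by $(1-2t\xi+t^2)^{-\nu}=\sum_{n=0}^\infty C_n^\nu(\xi)t^n$. For $\nu=0$, $C_0^0(\xi)=1$ and, for $n\ge1$, $C_n^0(\xi)=\sum_{m=0}^{[n/2]}(-1)^m\frac{\Gamma(n-m)}{\Gamma(m+1)\Gamma(n-2m+1)}(2\xi)^{n-2m}$, equivalently $C_n^0(\cos\theta)=\frac2n\cos(n\theta)$. *)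

(* Defs.v *)
From mathcomp Require Import all_boot all_order all_algebra.
From mathcomp Require Import all_classical all_reals all_analysis.
Import Order.TTheory GRing.Theory Num.Theory.
Import numFieldNormedType.Exports.

Set Implicit Arguments.
Unset Strict Implicit.
Unset Printing Implicit Defensive.

Local Open Scope classical_set_scope.
Local Open Scope ring_scope.

(* The library norm `|x| on 'rV[R]_d is the sup norm, hence these. *)
Definition dotv (R : realType) (d : nat) (u w : 'rV[R]_d) : R :=
  \sum_(i < d) u 0 i * w 0 i.

Definition enorm (R : realType) (d : nat) (u : 'rV[R]_d) : R :=
  Num.sqrt (dotv u u).

Section SpecialFunctions.
Variable R : realType.
Implicit Types (s mu nu z xi : R) (n : nat).

Definition euler_integral s : R :=
  (\int[lebesgue_measure]_(t in `]0%R, +oo[) (t `^ (s - 1) * expR (- t)))%R.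

(* Euler's integral for 0 < s, extended to s <= 0 by Gamma (s + 1) = s * Gamma s.
   At a pole s = 0, -1, -2, ... the product vanishes, so that Gamma s = 0 and
   (Gamma s)^-1 = 0, which is the value there of the entire function 1/Gamma. *)
Definition Gamma s : R :=
  if 0 < s then euler_integral s
  else let m := (Num.truncn (- s)).+1 in
       euler_integral (s + m%:R) / \prod_(i < m) (s + i%:R).

(* Only meaningful for 0 < z; the order mu is an arbitrary real number. *)
Definition besselI mu z : R :=
  limn (series (fun k : nat =>
    (z / 2) `^ (mu + 2 * k%:R) / (k`!%:R * Gamma (mu + k%:R + 1)))).

Definition besselK_quotient mu z : R :=
  pi / 2 * ((besselI (- mu) z - besselI mu z) / sin (mu * pi)).

(* sin (mu * pi) = 0 exactly when mu is an integer. *)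
Definition besselK mu z : R :=
  if sin (mu * pi) == 0 then lim (besselK_quotient rho z @[rho --> mu^'])
  else besselK_quotient mu z.

(* The coefficients of the expansion of (1 - 2 t xi + t^2)^(-nu) in powers of t
   around t = 0; they are unique as soon as they exist. *)
Definition gegenbauer_pos nu xi : nat -> R :=
  get [set c : nat -> R | \forall t \near (0 : R),
    series (fun n => c n * t ^+ n) @ \oo -->
      (1 - 2 * t * xi + t ^+ 2) `^ (- nu)].

Definition gegenbauer_zero n xi : R :=
  if n == 0%N then 1
  else \sum_(0 <= m < (n./2).+1)
         (-1) ^+ m * (Gamma (n%:R - m%:R)
            / (Gamma (m%:R + 1) * Gamma (n%:R - 2 * m%:R + 1)))
         * (2 * xi) ^+ (n - 2 * m).

Definition gegenbauer nu n xi : R :=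
  if nu == 0 then gegenbauer_zero n xi else gegenbauer_pos nu xi n.

Definition Zratio mu (lambda a r : R) : R :=
  if r < a
  then besselK mu (a * Num.sqrt (2 * lambda))
         / besselK mu (r * Num.sqrt (2 * lambda))
  else besselI mu (a * Num.sqrt (2 * lambda))
         / besselI mu (r * Num.sqrt (2 * lambda)).

End SpecialFunctions.

Definition borel (R : realType) (d : nat) : set (set 'rV[R]_d) :=
  <<s [set A : set 'rV[R]_d | open A] >>.

Section BrownianMotion.
Context (disp : measure_display) (T : measurableType disp) (R : realType).
Variables (P : probability T R) (d : nat).
Implicit Types (x v : 'rV[R]_d) (B : R -> T -> 'rV[R]_d) (w : T).

Definition increment B (s t : R) (w : T) : 'rV[R]_d := B t w - B s w.

(* Only the values B t for 0 <= t are relevant.  The law N(0, (t - s) I_d) is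
   given on boxes, as a product of one-dimensional centered normal laws;
   the second parameter of normal_prob is the standard deviation. *)
Record brownian_motion x B : Prop := BrownianMotion {
  brownian_measurable : forall t : R, 0 <= t ->
    forall A, borel A -> measurable (B t @^-1` A);
  brownian_start : {ae P, forall w, B 0 w = x};
  brownian_continuous :
    {ae P, forall w, {within `[0, +oo[, continuous (B ^~ w)}};
  brownian_normal : forall s t : R, 0 <= s -> s < t ->
    forall A : 'I_d -> set R, (forall i, measurable (A i)) ->
    P [set w | forall i, A i (increment B s t w 0 i)] =
      (\prod_(i < d) normal_prob 0 (Num.sqrt (t - s)) (A i))%E;
  brownian_independent : forall (n : nat) (t : nat -> R), 0 <= t 0%N ->
    (forall k, (k < n)%N -> t k < t k.+1) ->
    forall A : 'I_n -> set 'rV[R]_d, (forall k, borel (A k)) ->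
    P [set w | forall k : 'I_n, A k (increment B (t k) (t k.+1) w)] =
      (\prod_(k < n) P (increment B (t k) (t k.+1) @^-1` A k))%E
}.

(* +oo when the path never meets the sphere, as ereal_inf set0 = +oo. *)
Definition hitting_time (r : R) B w : \bar R :=
  ereal_inf [set t%:E | t in [set t : R | 0 <= t /\ enorm (B t w) = r]].

Definition stopped_exponential v (lambda r : R) B w : R :=
  if hitting_time r B w is t%:E then expR (dotv v (B t w) - lambda * t) else 0.

End BrownianMotion.

(* Main.v *)
(** Let b = |v| r / 2 and let xi be the cosine of the angle between v and a point
    of the sphere of radius r. Write I_mu(z) = (z/2)^mu F_mu(z^2/4) and
    a_n = (1 + n/nu) C_n^nu (a_n = n C_n^0 if nu = 0). The partial sums S of the
    plane-wave expansion Gamma(nu+1) sum_n a_n(xi) b^n F_(nu+n)(b^2) = e^(2 b xi)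
    satisfy dS/db = 2 xi S up to a remainder that telescopes to two small terms,
    hence converge uniformly in xi. As <v, B_sigma> = 2 b xi, it remains to compute
    E[e^(-lambda sigma) a_n(xi)].

    H(y) = |y|^n a_n(<v,y>/(|v||y|)) is a harmonic polynomial, homogeneous of degree
    n, so u(y) = H(y) phi(|y|^2) solves (1/2) Lap u = lambda u as soon as phi solves a
    Bessel-type ordinary differential equation: phi(q) = F_(nu+n)(lambda q/2) inside
    the sphere, and the analogue built on K_(nu+n) outside. Both choices are bounded
    with their derivatives on the side of the sphere where the path stays before
    sigma, and u(x) = E[e^(-lambda sigma) u(B_sigma)] follows without stochastic
    calculus: on the event that the sphere is not hit before time k h, which is
    independent of the next increment, a third-order Taylor expansion shows that
    e^(-lambda t) u(B_t) changes by O(h^(3/2)) in expectation between k h and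
    (k+1) h; sum over k and let h tend to 0.

    The outer solution is an integral over the line of exp(s t - e^t - w e^(-t)). It is
    identified with K_mu as defined by a difference quotient of I_(-mu) and I_mu: for
    0 < mu < 1 by a Wronskian argument at 0, then by differentiation for non-integer
    mu, then by continuity in mu. *)
From HB Require Import structures.
Require Import Defs.
From mathcomp Require Import all_boot all_order all_algebra.
From mathcomp Require Import ring lra zify.
From mathcomp Require Import all_classical all_reals all_analysis.
From mathcomp Require Import measurable_realfun.
Import Order.TTheory GRing.Theory Num.Theory.
Import numFieldNormedType.Exports.

Set Implicit Arguments.
Unset Strict Implicit.
Unset Printing Implicit Defensive.

Local Open Scope classical_set_scope.
Local Open Scope ring_scope.

(** * Independence of increments *)

(** Independence is given for finitely many increments only, and neither the hitting time nor the
    stopped exponential is assumed measurable. Both gaps are closed by time grids: not having hit is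
    a countable combination of conditions at dyadic times, and stopped quantities are pointwise
    limits of grid sums on a measurable set [G] of full measure, where paths are continuous and
    start at [x]. Off [G] it is enough that the integrand is nonnegative.

    A discrete step may jump across the sphere, while the inner solution is unbounded far away and
    the outer one is singular at the origin. The solution is therefore kept on a margin [J] beyond
    the sphere and set to 0 outside. The Taylor estimate is required only at base points on the
    correct side, but for every step: one long enough to leave the margin is paid for by its own
    cube.

    The normalization [ageg] absorbs the division by nu, so that d = 2 and larger d share one
    argument up to the last lines. The constant between K and its integral cancels in [Zratio]; what
    matters is that it is not zero. *)

Section Independence.
Context (disp : measure_display) (T : measurableType disp) (R : realType).
Variable P : probability T R.

Definition indep_event (E F : set T) := (P (E `&` F) = P E * P F)%E.

(** For fixed [E], both sides of the product formula are additive in the other event, hence the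
    closure properties. The same system later absorbs the monotone limits that define [no_hit]. *)
Lemma dynkin_indep_event (E : set T) : measurable E ->
  dynkin [set F | measurable F /\ indep_event E F].
Proof.
move=> mE; rewrite /indep_event; split=> /=.
- by split => //; rewrite setIT probability_setT mule1.
- move=> F [mF EF]; split; first exact: measurableC.
  have fF : P F \is a fin_num by exact: fin_num_measure.
  have fE : P E \is a fin_num by exact: fin_num_measure.
  rewrite probability_setC// muleBr// mule1 -EF.
  by rewrite -setDE measureD// ltey_eq fE.
- move=> F tF mF; split; first by apply: bigcup_measurable => k _; exact: (mF k).1.
  rewrite setI_bigcupr measure_bigcup//=; last 2 first.
  + by move=> k _; apply: measurableI => //; exact: (mF k).1.
  + by apply: trivIset_setIl.
  rewrite measure_bigcup//=; last by move=> k _; exact: (mF k).1.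
  rewrite -[P E in RHS]fineK; last exact: fin_num_measure.
  rewrite -nneseriesZl//.
  apply: eq_eseriesr => k _.
  by rewrite fineK ?(mF k).2//; exact: fin_num_measure.
Qed.

(** Dynkin's pi-lambda theorem: independence need only be checked on a generating class stable under
    intersection. *)
Lemma indep_event_sigma (E : set T) (G : set (set T)) : measurable E ->
  setI_closed G -> G `<=` measurable -> (forall F, G F -> indep_event E F) ->
  forall F, <<s G >> F -> measurable F /\ indep_event E F.
Proof.
move=> mE GI Gm Gi; rewrite -setI_closed_g_dynkin_g_sigma_algebra//.
apply: smallest_sub; first exact: dynkin_indep_event.
by move=> F GF; split; [exact: Gm|exact: Gi].
Qed.

Lemma integrable_bounded (X : T -> R) M : measurable_fun setT X ->
  (forall w, `|X w| <= M) -> P.-integrable setT (EFin \o X).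
Proof.
move=> mX XM; apply: measurable_bounded_integrable => //.
  by rewrite -ge0_fin_numE//; exact: fin_num_measure.
exists M; split; first exact: num_real.
by move=> N MN w _; apply: le_trans (XM w) _; exact: ltW.
Qed.

(** Independence is the product formula on rectangles, and a product measure is determined by
    rectangles. [Z] stands for the pair as a bundled measurable function. *)
Lemma indep_distribution d1 d2 (T1 : measurableType d1) (T2 : measurableType d2)
    (X : {mfun T >-> T1}) (Y : {mfun T >-> T2}) (Z : {mfun T >-> (T1 * T2)%type}) :
  (forall w, Z w = (X w, Y w)) ->
  (forall A B, measurable A -> measurable B ->
    indep_event (X @^-1` A) (Y @^-1` B)) ->
  forall A, measurable A ->
  (distribution P X \x distribution P Y)%E A = distribution P Z A.
Proof.
move=> ZE XY.
have H := @product_measure_unique _ _ T1 T2 R (distribution P X) (distribution P Y) (distribution P Z).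
move=> A mA; apply: H => // B C mB mC.
rewrite /distribution /pushforward/= -XY//; congr (P _).
by rewrite predeqE => w /=; rewrite ZE.
Qed.

(** Fubini for the joint law, which is a product law by [indep_distribution]; Tonelli on absolute
    values yields the integrability. *)
Lemma indep_expectationM (X Y : {mfun T >-> R}) :
  P.-integrable setT (EFin \o X) -> P.-integrable setT (EFin \o Y) ->
  (forall A B, measurable A -> measurable B ->
    indep_event (X @^-1` A) (Y @^-1` B)) ->
  P.-integrable setT (EFin \o (fun w => X w * Y w)) /\
  (\int[P]_w (X w * Y w) = (\int[P]_w X w) * (\int[P]_w Y w))%R.
Proof.
move=> iX iY XY.
pose Zf (w : T) := (X w, Y w).
have mZ : measurable_fun setT Zf by exact: measurable_fun_pair.
pose Z : {mfun T >-> _} := HB.pack Zf (isMeasurableFun.Build _ _ _ _ _ mZ).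
have prodE := @indep_distribution _ _ _ _ X Y Z (fun=> erefl) XY.
pose f : R * R -> \bar R := fun z => (z.1 * z.2)%:E.
have mXY : measurable_fun setT f.
  by apply/measurable_EFinP; apply: measurable_funM.
have iM : (distribution P X \x distribution P Y)%E.-integrable setT f.
  apply/(integrable12ltyP (distribution P X) (distribution P Y) mXY) => /=.
  have mabs : measurable_fun setT (fun y : R => `|y|%:E).
    by apply: (@measurableT_comp _ _ _ _ _ _ EFin) => //; exact: normr_measurable.
  rewrite (eq_integral (fun x : R => `|x|%:E * \int[distribution P Y]_y `|y|%:E))%E; last first.
    move=> x _; rewrite -ge0_integralZl//.
    by apply: eq_integral => y _; rewrite normrM EFinM.
  rewrite ge0_integralZr//; last exact: integral_ge0.
  rewrite !ge0_integral_distribution//.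
  rewrite lte_mul_pinfty//.
  - by apply: integral_ge0 => w _; rewrite lee_fin.
  - rewrite ge0_fin_numE; first by case/integrableP: iX.
    by apply: integral_ge0 => w _; rewrite lee_fin.
  - by case/integrableP: iY.
have iZ : (distribution P Z).-integrable setT f.
  apply/integrableP; split => //; case/integrableP: iM => _.
  by rewrite (eq_measure_integral (distribution P Z))// => A mA _; exact: prodE.
have iXY : P.-integrable setT (EFin \o (fun w => X w * Y w)).
  apply/integrableP; split.
    by apply/measurable_EFinP; apply: measurable_funM.
  case/integrableP: iZ => _.
  by rewrite ge0_integral_distribution//; apply: measurableT_comp.
split => //; apply: EFin_inj.
rewrite EFinM /Rintegral !fineK; [|exact: integrable_fin_num..].
transitivity (\int[distribution P Z]_z f z)%E.
  by rewrite integral_distribution.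
rewrite (eq_measure_integral (distribution P X \x distribution P Y)%E); last first.
  by move=> A mA _; exact/esym/prodE.
rewrite -integral12_prod_meas1//=.
have iXd : (distribution P X).-integrable setT (EFin : R -> \bar R).
  exact: integrable_pushforward.
have iYd : (distribution P Y).-integrable setT (EFin : R -> \bar R).
  exact: integrable_pushforward.
have EX : (\int[distribution P X]_x x%:E = \int[P]_w (X w)%:E)%E.
  by rewrite integral_distribution.
have EY : (\int[distribution P Y]_x x%:E = (fine (\int[P]_w (Y w)%:E))%:E)%E.
  by rewrite integral_distribution// fineK//; exact: integrable_fin_num.
rewrite (eq_integral (fun x : R => x%:E * (fine (\int[P]_w (Y w)%:E))%:E))%E; last first.
  by move=> x _; rewrite -EY -integralZl.
by rewrite integralZr// EX fineK//; exact: integrable_fin_num.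
Qed.

End Independence.

(** * Borel sets of row vectors and measurability through coordinates *)

Section Borel.
Context (R : realType) (d : nat).

Let G : set (set 'rV[R]_d) := [set A | open A].

Lemma borel_continuous_preimage (f : 'rV[R]_d -> R) (A : set R) :
  continuous f -> measurable A -> borel (f @^-1` A).
Proof.
move=> /continuousP cf mA.
have : measurable_fun (setT : set (g_sigma_algebraType G)) f.
  apply: (measurability _ (RGenOpens.measurableE R)).
  move=> _ [_ [a [b ->] <-]]; rewrite setTI.
  by apply: sub_sigma_algebra; exact/cf/interval_open.
by move=> /(_ measurableT A mA); rewrite setTI.
Qed.

Lemma borel_coord (A : set R) (i : 'I_d) :
  measurable A -> borel [set y : 'rV[R]_d | A (y 0 i)].
Proof. by apply: borel_continuous_preimage; exact: coord_continuous. Qed.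

Lemma borelT : borel [set: 'rV[R]_d].
Proof. exact: (@measurableT _ (g_sigma_algebraType G)). Qed.

Lemma borel_box (A : 'I_d -> set R) :
  (forall i, measurable (A i)) -> borel [set y : 'rV[R]_d | forall i, A i (y 0 i)].
Proof.
move=> mA; rewrite (_ : [set y | _] = \bigcap_(i in [set: 'I_d]) [set y : 'rV[R]_d | A i (y 0 i)]).
  apply: (@fin_bigcap_measurable _ (g_sigma_algebraType G)) => [|i _].
    exact: finite_finset.
  exact: borel_coord.
by rewrite predeqE => y; split => [Ay i _|Ay i]; exact: Ay.
Qed.

End Borel.

Section Coordinates.
Context (R : realType) (d : nat).

(* Borel measurability, in a form that needs no sigma-algebra structure on the
   type of row vectors. *)
Definition coord_measurable (f : 'rV[R]_d -> R) :=
  forall disp (T : measurableType disp) (Y : T -> 'rV[R]_d),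
  (forall i, measurable_fun setT (fun w => Y w 0 i)) ->
  measurable_fun setT (fun w => f (Y w)).

Lemma coord_measurable_coord i : coord_measurable (fun y => y 0 i).
Proof. by move=> ? T Y; exact. Qed.

Lemma coord_measurable_cst c : coord_measurable (fun=> c).
Proof. by move=> ? T Y _; exact: measurable_cst. Qed.

Lemma coord_measurableD f g : coord_measurable f -> coord_measurable g ->
  coord_measurable (fun y => f y + g y).
Proof. by move=> mf mg ? T Y mY; apply: measurable_funD; [exact: mf|exact: mg]. Qed.

Lemma coord_measurableM f g : coord_measurable f -> coord_measurable g ->
  coord_measurable (fun y => f y * g y).
Proof. by move=> mf mg ? T Y mY; apply: measurable_funM; [exact: mf|exact: mg]. Qed.

Lemma coord_measurable_sum (I : Type) (s : seq I) (f : I -> 'rV[R]_d -> R) :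
  (forall i, coord_measurable (f i)) -> coord_measurable (fun y => \sum_(i <- s) f i y).
Proof. by move=> mf ? T Y mY; apply: measurable_sum => i; exact: mf. Qed.

Lemma coord_measurable_comp (g : R -> R) f : measurable_fun setT g ->
  coord_measurable f -> coord_measurable (fun y => g (f y)).
Proof. by move=> mg mf ? T Y mY; apply: measurableT_comp => //; exact: mf. Qed.

Lemma coord_measurable_dotv (v : 'rV[R]_d) : coord_measurable (dotv v).
Proof.
apply: coord_measurable_sum => i; apply: coord_measurableM.
  exact: coord_measurable_cst.
exact: coord_measurable_coord.
Qed.

Lemma coord_measurable_sq : coord_measurable (fun y => dotv y y).
Proof.
by apply: coord_measurable_sum => i; apply: coord_measurableM;
  exact: coord_measurable_coord.
Qed.
End Coordinates.

(** * Independence of the next increment from the no-hit event *)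

Section Past.
Context (disp : measure_display) (T : measurableType disp) (R : realType).
Variables (P : probability T R) (d : nat) (x : 'rV[R]_d) (B : R -> T -> 'rV[R]_d).
Hypothesis hB : brownian_motion P x B.

Lemma measurable_coord_bm t i : 0 <= t -> measurable_fun setT (fun w => B t w 0 i).
Proof.
move=> t0 _ A mA; rewrite setTI.
exact: (brownian_measurable hB t0 (borel_coord i mA)).
Qed.

Lemma measurable_increment_coord s t i : 0 <= s -> 0 <= t ->
  measurable_fun setT (fun w => increment B s t w 0 i).
Proof.
move=> s0 t0; rewrite (_ : (fun w => _) = (fun w => B t w 0 i - B s w 0 i)); last first.
  by apply/funext => w; rewrite /increment !mxE.
by apply: measurable_funB; exact: measurable_coord_bm.
Qed.

(** A pi-system generating the past of [t n]. It is phrased through increments, since independence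
    is assumed for these; positions are recovered as their sums. *)
Definition past_boxes (n : nat) (t : nat -> R) : set (set T) :=
  [set F | exists2 A : 'I_n -> 'I_d -> set R, (forall k i, measurable (A k i)) &
    F = [set w | forall k i, A k i (increment B (t k) (t k.+1) w 0 i)]].

Lemma past_boxesI n t : setI_closed (past_boxes n t).
Proof.
move=> _ _ [A mA ->] [C mC ->].
exists (fun k i => A k i `&` C k i); first by move=> k i; exact: measurableI.
rewrite predeqE => w; split => [[Aw Cw] k i|ACw]; first by split; [exact: Aw|exact: Cw].
by split => k i; case: (ACw k i).
Qed.

Section Grid.
Variables (n : nat) (t : nat -> R).
Hypothesis t0 : 0 <= t 0%N.
Hypothesis tS : forall k, (k <= n)%N -> t k < t k.+1.

Let t_ge0 k : (k <= n.+1)%N -> 0 <= t k.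
Proof.
elim: k => // k IH kn; apply: (le_trans (IH (ltnW kn))).
exact/ltW/tS.
Qed.

Lemma past_boxes_measurable : past_boxes n t `<=` measurable.
Proof.
move=> _ [A mA ->].
rewrite (_ : [set w | _] = \bigcap_(k in [set: 'I_n]) \bigcap_(i in [set: 'I_d])
   ((fun w => increment B (t k) (t k.+1) w 0 i) @^-1` A k i)).
  apply: fin_bigcap_measurable => [|k _]; first exact: finite_finset.
  apply: fin_bigcap_measurable => [|i _]; first exact: finite_finset.
  have kn := ltn_ord k.
  rewrite -[X in measurable X]setTI.
  by apply: measurable_increment_coord => //; apply: t_ge0; lia.
by rewrite predeqE => w; split => [Aw k _ i _|Aw k i]; [exact: Aw|exact: Aw].
Qed.

(** On boxes, the product formula for n+1 increments is compared with the one for the first n;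
    [indep_event_sigma] extends this to the generated sigma-algebra. *)
Lemma indep_past (C : set 'rV[R]_d) F : borel C ->
  measurable (increment B (t n) (t n.+1) @^-1` C) ->
  <<s past_boxes n t >> F ->
  measurable F /\ indep_event P (increment B (t n) (t n.+1) @^-1` C) F.
Proof.
move=> bC mC; apply: indep_event_sigma => //.
- exact: past_boxesI.
- exact: past_boxes_measurable.
move=> _ [A mA ->]; rewrite /indep_event.
pose A' (k : 'I_n) : set 'rV[R]_d := [set y | forall i, A k i (y 0 i)].
have bA' k : borel (A' k) by exact: borel_box.
have past : P [set w | forall k i, A k i (increment B (t k) (t k.+1) w 0 i)] =
    (\prod_(k < n) P (increment B (t k) (t k.+1) @^-1` A' k))%E.
  by rewrite -(brownian_independent hB)// => k kn; apply/tS/ltnW.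
(* The boxes of the past, with [C] in the last slot. *)
pose A'' (k : 'I_n.+1) : set 'rV[R]_d :=
  if unlift ord_max k is Some k' then A' k' else C.
have bA'' k : borel (A'' k) by rewrite /A''; case: unliftP.
have tS' k : (k < n.+1)%N -> t k < t k.+1 by rewrite ltnS; exact: tS.
have := brownian_independent hB t0 tS' bA''.
rewrite big_ord_recr/= muleC {2}/A'' unlift_none.
under eq_bigr => k _.
  rewrite /A'' (_ : widen_ord _ k = lift ord_max k) ?liftK; last first.
    by apply/val_inj; rewrite /= /bump leqNgt ltn_ord.
  over.
rewrite /= => H.
rewrite past; transitivity (P [set w | forall k : 'I_n.+1, A'' k (increment B (t k) (t k.+1) w)]).
  congr (P _); rewrite predeqE => w; split.
    move=> [Cw Aw] k; rewrite /A''; case: unliftP => [j ->|->] //.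
    rewrite /= /bump leqNgt ltn_ord add0n; exact: Aw.
  move=> Aw; split; first by have := Aw ord_max; rewrite /A'' unlift_none.
  move=> k; have := Aw (lift ord_max k); rewrite /A'' liftK.
  by rewrite /= /bump leqNgt ltn_ord add0n.
by rewrite H.
Qed.

Lemma measurable_past_increment l c : (l < n)%N ->
  measurable_fun (setT : set (g_sigma_algebraType (past_boxes n t)))
    (fun w => increment B (t l) (t l.+1) w 0 c).
Proof.
move=> ln _ A mA; rewrite setTI; apply: sub_sigma_algebra.
exists (fun k i => if ((k : nat) == l) && (i == c) then A else setT).
  by move=> k i; case: ifP.
rewrite predeqE => w; split => [Aw k i|/(_ (Ordinal ln) c)]; last by rewrite /= !eqxx.
by case: ifP => // /andP[/eqP -> /eqP ->].
Qed.

(* B starts at x only almost surely; bm0 does so everywhere. *)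
Definition bm0 s w := x + (B s w - B 0 w).

(** The position at time [t i] is [x] plus a telescoping sum of increments, because the grid starts
    at time 0. *)
Lemma measurable_past_bm0 i c : t 0%N = 0 -> (i <= n)%N ->
  measurable_fun (setT : set (g_sigma_algebraType (past_boxes n t)))
    (fun w => bm0 (t i) w 0 c).
Proof.
move=> t00 lin.
rewrite (_ : (fun w => _) = (fun w => x 0 c + \sum_(l < i) increment B (t l) (t l.+1) w 0 c)); last first.
  apply/funext => w; rewrite /bm0 !mxE; congr (_ + _).
  rewrite (eq_bigr (fun l : 'I_i => B (t l.+1) w 0 c - B (t l) w 0 c)); last first.
    by move=> l _; rewrite /increment !mxE.
  by rewrite -(big_mkord xpredT (fun l => B (t l.+1) w 0 c - B (t l) w 0 c)) telescope_sumr// t00.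
apply: measurable_funD; first exact: measurable_cst.
apply: measurable_sum => l.
by apply: measurable_past_increment; rewrite (leq_trans (ltn_ord l)).
Qed.

End Grid.

Section NoHit.
Variables (r h : R) (k : nat).
Hypothesis h0 : 0 < h.

(** Mesh h / 2^j up to time k h, then a single step to (k+1) h: the last increment is the same [D]
    for every j, so that independence can be passed to the limit over all the grids. *)
Let n j := (k * 2 ^ j)%N.
Let t j i := if (i <= n j)%N then i%:R * (h / (2 ^+ j)) else k.+1%:R * h.

Let tn j : t j (n j) = k%:R * h.
Proof.
rewrite /t leqnn /n natrM natrX -mulrA; congr (_ * _).
by rewrite mulrCA divff ?mulr1// expf_neq0.
Qed.

Let tSn j : t j (n j).+1 = k.+1%:R * h.
Proof. by rewrite /t ltnn. Qed.

Let tS j i : (i <= n j)%N -> t j i < t j i.+1.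
Proof.
move=> ij; rewrite {1}/t ij /t; case: ifPn => [_|].
  by rewrite ltr_pM2r ?ltr_nat// divr_gt0// exprn_gt0.
rewrite -leqNgt => nj; have -> : i = n j by apply/eqP; rewrite eqn_leq ij.
by have := tn j; rewrite /t leqnn => ->; rewrite ltr_pM2r// ltr_nat.
Qed.

Let t0 j : t j 0%N = 0.
Proof. by rewrite /t leq0n mul0r. Qed.

(** Avoiding the sphere at all grid times would still allow a hit between them. A gap that is
    uniform over all grids excludes this by continuity. *)
Definition grid_away j (m : nat) : set T := [set w | forall i, (i <= k * 2 ^ j)%N ->
  m.+1%:R^-1 <= `|dotv (bm0 (i%:R * (h / (2 ^+ j))) w) (bm0 (i%:R * (h / (2 ^+ j))) w) - r ^+ 2| ].

(* For a continuous path: no visit to the sphere up to time k h. *)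
Definition no_hit : set T := \bigcup_m \bigcap_j grid_away j m.

Let D := increment B (k%:R * h) (k.+1%:R * h).

Let Ceq j C : D @^-1` C = increment B (t j (n j)) (t j (n j).+1) @^-1` C.
Proof. by rewrite tn tSn. Qed.

(** For fixed j and m only finitely many increments are involved. The events decrease in j and
    increase in m, and the lambda-system of events independent of [D] is stable under both
    limits. *)
Lemma indep_no_hit (C : set 'rV[R]_d) (f : 'rV[R]_d -> R) (S : set R) :
  borel C -> measurable (D @^-1` C) -> coord_measurable f -> measurable S ->
  let F := no_hit `&` [set w | S (f (bm0 (k%:R * h) w))] in
  measurable F /\ indep_event P (D @^-1` C) F.
Proof.
move=> bC mC mf mS F.
pose Fs := [set w | S (f (bm0 (k%:R * h) w))].
have step j m : <<s past_boxes (n j) (t j) >> (grid_away j m `&` Fs).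
  pose T' := g_sigma_algebraType (past_boxes (n j) (t j)).
  have mb i c : (i <= n j)%N -> measurable_fun (setT : set T')
      (fun w => bm0 (i%:R * (h / (2 ^+ j))) w 0 c).
    move=> ij; have := @measurable_past_bm0 (n j) (t j) i c (t0 j) ij.
    by have -> : t j i = i%:R * (h / (2 ^+ j)) by rewrite /t ij.
  apply: (@measurableI _ T').
    rewrite (_ : grid_away j m = \bigcap_(i in [set i | (i <= n j)%N])
      ((fun w => `|dotv (bm0 (i%:R * (h / (2 ^+ j))) w) (bm0 (i%:R * (h / (2 ^+ j))) w) - r ^+ 2|) @^-1` `[m.+1%:R^-1, +oo[)).
      apply: (@fin_bigcap_measurable _ T') => [|i/= ij].
        exact: (sub_finite_set _ (finite_II (n j).+1)).
      rewrite -[X in measurable X]setTI.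
      have : measurable_fun (setT : set T') (fun w => `|dotv (bm0 (i%:R * (h / (2 ^+ j))) w) (bm0 (i%:R * (h / (2 ^+ j))) w) - r ^+ 2|).
        apply: measurableT_comp; first exact: normr_measurable.
        apply: measurable_funB; last exact: measurable_cst.
        by apply: coord_measurable_sq => c; exact: mb.
      by move=> mm; apply: mm => //; exact: measurable_itv.
    rewrite predeqE => w; split => [Aw i /= ij|Aw i ij].
      by rewrite /= in_itv/= andbT; exact: Aw.
    by have := Aw i ij; rewrite /= in_itv/= andbT.
  rewrite -[X in measurable X]setTI.
  apply: (mf _ T') => // c.
  rewrite -(_ : (n j)%:R * (h / (2 ^+ j)) = k%:R * h); first exact: mb.
  by have := tn j; rewrite /t leqnn.
have stepi j m : measurable (grid_away j m `&` Fs) /\ indep_event P (D @^-1` C) (grid_away j m `&` Fs).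
  rewrite (Ceq j); apply: indep_past => //.
  - by rewrite t0.
  - exact: tS.
  - by rewrite -Ceq.
have [_ HT HD HU] := (dynkin_lambda_system _).1 (dynkin_indep_event P mC).
have stepm m : measurable (\bigcap_j grid_away j m `&` Fs) /\
   indep_event P (D @^-1` C) (\bigcap_j grid_away j m `&` Fs).
  (* The lambda-system offers differences and increasing unions, so the decreasing intersection is
     written as a complement. *)
  rewrite (_ : _ `&` _ = setT `\` \bigcup_j ~` (grid_away j m `&` Fs)); last first.
    rewrite setTD setC_bigcup predeqE => w; split=> [[Aw Fw] j _|Aw].
      by rewrite setCK; split => //; exact: Aw.
    split=> [j _|]; first by have := Aw j I; rewrite setCK => -[].
    by have := Aw 0%N I; rewrite setCK => -[].
  apply: (HD) => //; apply: (HU) => [|j]; last by rewrite -setTD; apply: (HD) => //; exact: stepi.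
  apply/nondecreasing_seqP => j; apply/subsetPset; apply: subsetC.
  apply: setSI => w Aw i ij.
  (* The points of grid j are those of even index in grid j+1, so the events decrease with j. *)
  have E : (i * 2)%:R * (h / 2 ^+ j.+1) = i%:R * (h / 2 ^+ j) :> R.
    by rewrite natrM exprS; field; rewrite expf_neq0.
  have ij2 : (i * 2 <= k * 2 ^ j.+1)%N by rewrite expnS mulnCA mulnC leq_mul2l.
  by have := Aw _ ij2; rewrite E.
rewrite /F /no_hit setI_bigcupl; apply: (HU) => // m m' mm'.
apply/subsetPset; apply: setSI; apply: subset_bigcap => j _ w Aw i ij.
apply: le_trans (Aw i ij); rewrite lef_pV2 ?posrE//.
by rewrite ler_nat.
Qed.

Let Y (f : 'rV[R]_d -> R) w := \1_no_hit w * f (bm0 (k%:R * h) w).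

(** The variable is 0 off [no_hit]: its preimage of [S] is a part of [no_hit] if [S] misses 0, and
    the complement of such a part otherwise. *)
Lemma indep_no_hit_rv (C : set 'rV[R]_d) (f : 'rV[R]_d -> R) (S : set R) :
  borel C -> measurable (D @^-1` C) -> coord_measurable f -> measurable S ->
  measurable (Y f @^-1` S) /\ indep_event P (D @^-1` C) (Y f @^-1` S).
Proof.
move=> bC mC mf mS.
have [_ HT HD HU] := (dynkin_lambda_system _).1 (dynkin_indep_event P mC).
have [S0|S0] := pselect (S 0).
  rewrite (_ : _ @^-1` _ = setT `\` (no_hit `&` [set w | (~` S) (f (bm0 (k%:R * h) w))])).
    by apply: (HD) => //; exact: (indep_no_hit bC mC mf (measurableC mS)).
  rewrite setTD predeqE => w; split => [/= Yw [nw]|/= nw]; rewrite /Y /=.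
    by apply; move: Yw; rewrite /Y indicE mem_set// mul1r.
  rewrite indicE; case: (pselect (no_hit w)) => hw; last by rewrite memNset// mul0r.
  by rewrite mem_set// mul1r; apply: contrapT => nS; apply: nw.
rewrite (_ : _ @^-1` _ = no_hit `&` [set w | S (f (bm0 (k%:R * h) w))]).
  exact: (indep_no_hit bC mC mf mS).
rewrite predeqE => w; rewrite /Y /= indicE.
case: (pselect (no_hit w)) => hw; last by rewrite memNset// mul0r; split => // -[].
by rewrite mem_set// mul1r; split => [|[]].
Qed.

Lemma measurable_no_hit_rv f : coord_measurable f -> measurable_fun setT (Y f).
Proof.
move=> mf _ A mA; rewrite setTI.
have mT : measurable (D @^-1` setT) by rewrite preimage_setT.
exact: (indep_no_hit_rv (@borelT R d) mT mf mA).1.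
Qed.

(** This takes the place of conditioning on the past: a bounded quantity known at time k h factors
    out of the expectation against a function of the next increment. *)
Lemma expectation_no_hitM f g M :
  coord_measurable f -> (forall w, `|Y f w| <= M) ->
  continuous g -> coord_measurable g ->
  P.-integrable setT (EFin \o (g \o D)) ->
  P.-integrable setT (EFin \o (fun w => Y f w * g (D w))) /\
  \int[P]_w (Y f w * g (D w)) = (\int[P]_w Y f w) * (\int[P]_w g (D w)).
Proof.
move=> mf Yb cg mg ig.
have mY := measurable_no_hit_rv mf.
have mD : measurable_fun setT (g \o D).
  apply: mg => i; apply: measurable_increment_coord; apply: mulr_ge0 => //; exact: ltW.
pose Y' : {mfun T >-> R} := HB.pack (Y f) (isMeasurableFun.Build _ _ _ _ _ mY).
pose D' : {mfun T >-> R} := HB.pack (g \o D) (isMeasurableFun.Build _ _ _ _ _ mD).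
apply: (@indep_expectationM _ _ _ _ Y' D') => //.
  exact: (integrable_bounded P mY Yb).
move=> A A' mA mA'.
rewrite /indep_event setIC muleC.
have := indep_no_hit_rv (borel_continuous_preimage cg mA') _ mf mA.
case=> //.
rewrite -[X in measurable X]setTI.
exact (mD measurableT _ mA').
Qed.

End NoHit.
End Past.

(** * Optional stopping by discretization *)

Section WholeLine.
Context (R : realType).
Local Notation mu := (@lebesgue_measure R).

Lemma cvg_integral_sym (f : R -> R) : mu.-integrable setT (EFin \o f) ->
  (\int[mu]_(x in `[- n%:R, n%:R]) f x)%R @[n --> \oo] --> (\int[mu]_x f x)%R.
Proof.
move=> intf.
have mf : measurable_fun setT f by apply/measurable_EFinP; exact: measurable_int intf.
apply: fine_cvg; rewrite fineK; last exact: integrable_fin_num.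
pose fn (n : nat) : R -> \bar R := (EFin \o f) \_ `[- n%:R, n%:R].
rewrite (_ : (fun n => _) = (fun n : nat => \int[mu]_x fn n x)%E); last first.
  by apply/funext => n; rewrite [LHS]integral_mkcond.
apply: (@dominated_cvg _ _ _ mu _ _ _ _ (abse \o (EFin \o f))) => //.
- move=> n; apply/(measurable_restrict _ _ _).1 => //=.
  by apply: measurable_funTS; exact/measurable_EFinP.
- move=> x _; apply: cvg_near_cst; near=> n.
  rewrite /fn patchE mem_set//= in_itv/= -ler_norml.
  by near: n; exact: nbhs_infty_ger.
- exact: integrable_abse.
- move=> n x _; rewrite /fn patchE; case: ifP => // _.
  by rewrite (_ : point = 0%E)// abse0 /= lee_fin.
Unshelve. all: by end_near. Qed.

(** The bound forces [F] to vanish at both ends, so only boundary terms equal to 0 remain. Every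
    integration by parts below, for Gaussian moments and for Bessel recurrences, is an instance. *)
Lemma integral_derive_line (F f : R -> R) (C : R) :
  (forall x : R, is_derive x (1 : R) F (f x)) -> continuous f ->
  mu.-integrable setT (EFin \o f) ->
  (forall x, `|x| * `|F x| <= C) ->
  (\int[mu]_x f x)%R = 0.
Proof.
move=> dF cf intf FC.
have cF : continuous F.
  move=> x; apply: differentiable_continuous; apply/derivable1_diffP.
  by have [] := dF x.
have FTC n : (\int[mu]_(x in `[- n.+1%:R, n.+1%:R]) f x)%R = F n.+1%:R - F (- n.+1%:R).
  rewrite /Rintegral (@continuous_FTC2 _ f F) //.
  - by rewrite -subr_gt0 opprK -natrD ltr0n addnS.
  - exact: continuous_subspaceT.
  - split; first by move=> x _; have [] := dF x.
    + exact/cvg_at_right_filter/cF.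
    + exact/cvg_at_left_filter/cF.
  - by move=> x _; rewrite derive1E; have [] := dF x.
have F0 (u : nat -> R) : (forall n, `|u n| = n.+1%:R) -> F (u n) @[n --> \oo] --> 0.
  move=> un; apply: norm_cvg0.
  apply: (@squeeze_cvgr _ _ _ _ (cst 0) (fun n => C * n.+1%:R^-1)) => //.
  - near=> n; rewrite normr_ge0/=.
    by rewrite ler_pdivlMr// mulrC -{1}(un n).
  - exact: cvg_cst.
  - rewrite -[X in _ --> X](mulr0 C); apply: cvgMr.
    exact: cvg_harmonic.
have := cvg_integral_sym intf.
rewrite -cvg_shiftS; under eq_fun do rewrite FTC.
have H : F n.+1%:R - F (- n.+1%:R) @[n --> \oo] --> 0 - 0.
  apply: cvgB; [apply: (F0 (fun n => n.+1%:R))|apply: (F0 (fun n => - n.+1%:R))] => n.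
  - exact: normr_nat.
  - by rewrite normrN normr_nat.
by move/(cvg_unique (@Rhausdorff R) H) => <-; rewrite subrr.
Unshelve. all: by end_near. Qed.

Lemma expR_geXfact (n : nat) (y : R) : 0 <= y -> y ^+ n <= n`!%:R * expR y.
Proof.
move=> y0.
rewrite mulrC -ler_pdivrMr ?ltr0n ?fact_gt0//.
case: n => [|n]; first by rewrite expr0 fact0 divr1; have := expR_ge1Dx y; lra.
by apply: le_trans (expR_ge1Dxn n y0); rewrite lerDr.
Qed.

Lemma integrable_le (f g : R -> R) (A : set R) : measurable A -> measurable_fun A f ->
  mu.-integrable A (EFin \o g) -> (forall x, A x -> `|f x| <= g x) ->
  mu.-integrable A (EFin \o f).
Proof.
move=> mA mf ig fg; apply: (@le_integrable _ _ _ mu _ mA _ _ _ _ ig); first exact/measurable_EFinP.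
by move=> x Ax; rewrite /= lee_fin (le_trans (fg x Ax))// ler_norm.
Qed.

(** The explicit density and the Radon-Nikodym derivative have the same integral over every
    measurable set, hence agree almost everywhere. *)
Lemma normal_prob_integral_ge0 (s : R) (f : R -> \bar R) :
  measurable_fun setT f -> (forall x, 0 <= f x)%E ->
  (\int[normal_prob 0 s]_x f x = \int[mu]_x (f x * (normal_pdf 0 s x)%:E))%E.
Proof.
move=> mf f0.
pose N : probability _ R := normal_prob 0 s.
have dom := @normal_prob_dominates R 0 s.
rewrite -(@Radon_Nikodym_SigmaFinite.change_of_variables _ _ _ N mu dom f)//.
apply: ae_eq_integral => //.
- apply: emeasurable_funM => //; apply: measurable_int.
  exact: Radon_Nikodym_SigmaFinite.f_integrable.
- apply: emeasurable_funM => //; apply/measurable_EFinP; exact: measurable_normal_pdf.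
- apply: ae_eqe_mul2l.
  apply: integral_ae_eq => //=.
  + exact: Radon_Nikodym_SigmaFinite.f_integrable.
  + by apply/measurable_EFinP; exact: measurable_normal_pdf.
  + move=> E _ mE; rewrite -Radon_Nikodym_SigmaFinite.f_integral//.
Qed.

Lemma centered_normal_pdfE (s : R) : s != 0 ->
  normal_pdf 0 s = fun x => normal_peak s * expR (- x ^+ 2 / (s ^+ 2 *+ 2)).
Proof.
move=> s0; apply/funext => x.
by rewrite /normal_pdf (negbTE s0) /= /normal_fun subr0.
Qed.

(** Doubling the standard deviation frees a factor exp(-y) with y = 3 x^2 / (8 s^2), which absorbs
    any power of x. *)
Lemma normal_pdf_pow_le (s : R) (k : nat) : 0 < s ->
  exists C, forall x, `|x| ^+ k * normal_pdf 0 s x <= C * normal_pdf 0 (2 * s) x.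
Proof.
move=> s0.
have s1 : s != 0 by rewrite gt_eqF.
have s2 : 2 * s != 0 by rewrite gt_eqF ?mulr_gt0.
(* The two terms come from |x|^k <= 1 + x^(2k), the second one bounded by y^k <= k! exp y. *)
pose K := 1 + k`!%:R * (8 * s ^+ 2 / 3) ^+ k.
exists (normal_peak s * K / normal_peak (2 * s)) => x.
rewrite !centered_normal_pdfE//.
rewrite [leRHS]mulrA divfK; last by rewrite gt_eqF ?normal_peak_gt0.
rewrite mulrCA -mulrA ler_wpM2l ?normal_peak_ge0//.
pose y := 3 * x ^+ 2 / (8 * s ^+ 2).
have y0 : 0 <= y by apply: divr_ge0; apply: mulr_ge0 => //; exact: sqr_ge0.
have -> : - x ^+ 2 / (s ^+ 2 *+ 2) = - y - x ^+ 2 / ((2 * s) ^+ 2 *+ 2).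
  by rewrite /y; field.
rewrite expRD mulNr mulrA ler_wpM2r ?expR_ge0//.
have xk : `|x| ^+ k <= 1 + (x ^+ 2) ^+ k.
  have [x1|x1] := leP `|x| 1.
    have := exprn_ile1 k (normr_ge0 x) x1; have := exprn_ge0 k (sqr_ge0 x); lra.
  rewrite -real_normK ?num_real// -exprM.
  have : `|x| ^+ k <= `|x| ^+ (2 * k) by apply: ler_weXn2l; [exact: ltW|lia].
  lra.
have e1 : expR (- y) <= 1 by rewrite -expR0 ler_expR; lra.
apply: (@le_trans _ _ ((1 + (x ^+ 2) ^+ k) * expR (- y))).
  by rewrite ler_wpM2r ?expR_ge0.
rewrite mulrDl mul1r /K lerD//.
have -> : x ^+ 2 = y * (8 * s ^+ 2 / 3) by rewrite /y; field.
rewrite exprMn mulrAC; apply: ler_wpM2r.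
  by apply: exprn_ge0; apply: divr_ge0 => //; apply: mulr_ge0 => //; exact: sqr_ge0.
by rewrite expRN ler_pdivrMr ?expR_gt0// expR_geXfact.
Qed.

Lemma measurable_pow_pdf (s : R) (k : nat) :
  measurable_fun setT (fun x : R => x ^+ k * normal_pdf 0 s x).
Proof. by apply: measurable_funM; [exact: exprn_measurable|exact: measurable_normal_pdf]. Qed.

Lemma integrable_pow_pdf (s : R) (k : nat) : 0 < s ->
  mu.-integrable setT (EFin \o (fun x : R => x ^+ k * normal_pdf 0 s x)).
Proof.
move=> s0; have [C HC] := normal_pdf_pow_le k s0.
apply: (@integrable_le _ (fun x => C * normal_pdf 0 (2 * s) x)) => //.
- exact: measurable_pow_pdf.
- rewrite (_ : _ \o _ = (fun x => C%:E * (normal_pdf 0 (2 * s) x)%:E)%E) //.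
  by apply: integrableZl => //; exact: integrable_normal_pdf.
- by move=> x _; rewrite normrM normrX [X in _ * X]ger0_norm ?normal_pdf_ge0.
Qed.

Lemma is_derive_normal_pdf (s x : R) : 0 < s ->
  is_derive x (1 : R) (normal_pdf 0 s) (- (x / s ^+ 2) * normal_pdf 0 s x).
Proof.
move=> s0; have s1 : s != 0 by rewrite gt_eqF.
rewrite centered_normal_pdfE//.
apply: is_derive_eq.
by rewrite /GRing.scale /=; field.
Qed.

Lemma pow_pdf_bound (s : R) (k : nat) : 0 < s ->
  exists C, forall x, `|x| ^+ k * normal_pdf 0 s x <= C.
Proof.
move=> s0; have [C HC] := normal_pdf_pow_le k s0.
have s2 : 2 * s != 0 by rewrite gt_eqF ?mulr_gt0.
exists (`|C| * normal_peak (2 * s)) => x.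
apply: le_trans (HC x) _; apply: le_trans (ler_norm _) _.
rewrite normrM ler_wpM2l// ger0_norm ?normal_pdf_ge0//.
exact: normal_pdf_ub.
Qed.

Lemma normal_moment1 (s : R) : 0 < s -> (\int[mu]_x (x * normal_pdf 0 s x))%R = 0.
Proof.
move=> s0; have s1 : s != 0 by rewrite gt_eqF.
have [C HC] := pow_pdf_bound 1 s0.
have ii : mu.-integrable setT (EFin \o (fun x => x * normal_pdf 0 s x)).
  have := integrable_pow_pdf 1 s0.
  by under [X in _ \o X]eq_fun do rewrite expr1.
pose c := - s ^+ 2.
apply: (@integral_derive_line (fun x => c * normal_pdf 0 s x) (fun x => x * normal_pdf 0 s x) (s ^+ 2 * C)).
- move=> x; have := is_derive_normal_pdf x s0 => ?.
  by apply: is_derive_eq; rewrite /GRing.scale /= /c; field.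
- by move=> x; apply: cvgM; [exact: cvg_id|exact: continuous_normal_pdf].
- exact: ii.
- move=> x; rewrite normrM normrN (ger0_norm (sqr_ge0 _)) mulrCA ler_wpM2l ?sqr_ge0//.
  by rewrite ger0_norm ?normal_pdf_ge0//; have := HC x; rewrite expr1.
Qed.

Lemma is_derive_pow (n : nat) (x : R) :
  is_derive x (1 : R) (fun y : R => y ^+ n.+1) (n.+1%:R * x ^+ n).
Proof.
have -> : (fun y : R => y ^+ n.+1) = (@id R) ^+ n.+1 by apply/funext => y; rewrite fctE.
apply: is_derive_eq.
by rewrite /GRing.scale /= mulr1 -mulr_natr mulrC.
Qed.

(** The difference of the two sides is the integral of the derivative of -s^2 x^(k+1) times the
    density. *)
Lemma normal_moment_rec (s : R) (k : nat) : 0 < s ->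
  (\int[mu]_x (x ^+ k.+2 * normal_pdf 0 s x))%R =
  k.+1%:R * s ^+ 2 * (\int[mu]_x (x ^+ k * normal_pdf 0 s x))%R.
Proof.
move=> s0; have s1 : s != 0 by rewrite gt_eqF.
have [C HC] := pow_pdf_bound k.+2 s0.
have i2 := integrable_pow_pdf k.+2 s0.
have i0 := integrable_pow_pdf k s0.
have i0' : mu.-integrable setT (EFin \o (fun x => k.+1%:R * s ^+ 2 * (x ^+ k * normal_pdf 0 s x))).
  have := integrableZl measurableT (k.+1%:R * s ^+ 2) i0; exact.
apply/eqP; rewrite -subr_eq0 -RintegralZl// -RintegralB//.
apply/eqP.
pose c := - s ^+ 2.
apply: (@integral_derive_line (fun x => c * (x ^+ k.+1 * normal_pdf 0 s x)) (fun x => x ^+ k.+2 * normal_pdf 0 s x - k.+1%:R * s ^+ 2 * (x ^+ k * normal_pdf 0 s x)) (s ^+ 2 * C)).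
- move=> x; have := is_derive_normal_pdf x s0 => ?.
  have := is_derive_pow k x => ?.
  apply: is_derive_eq; rewrite /GRing.scale /= /c.
  by rewrite !exprS; field.
- move=> x; apply: cvgB; last apply: cvgM; [|exact: cvg_cst|];
  by apply: cvgM; [exact: exprn_continuous|exact: continuous_normal_pdf].
- have := integrableB measurableT i2 i0'; exact.
- move=> x; rewrite normrM normrN (ger0_norm (sqr_ge0 _)) mulrCA ler_wpM2l ?sqr_ge0//.
  by rewrite normrM normrX (ger0_norm (normal_pdf_ge0 _ _ _)) mulrA -exprS.
Qed.
End WholeLine.

Section IncrementMoments.
Context (disp : measure_display) (T : measurableType disp) (R : realType).
Variables (P : probability T R) (d : nat) (x : 'rV[R]_d) (B : R -> T -> 'rV[R]_d).
Hypothesis hB : brownian_motion P x B.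
Local Notation mu := (@lebesgue_measure R).

Variables (s t : R).
Hypotheses (s0 : 0 <= s) (st : s < t).

Let D i w := increment B s t w 0 i.
Let sg := Num.sqrt (t - s).

Let sg_gt0 : 0 < sg. Proof. by rewrite sqrtr_gt0 subr_gt0. Qed.
Let sg2 : sg ^+ 2 = t - s. Proof. by rewrite sqr_sqrtr// subr_ge0 ltW. Qed.

Let mD i : measurable_fun setT (D i).
Proof. by apply: (measurable_increment_coord hB) => //; exact: (le_trans s0 (ltW st)). Qed.

Lemma increment_coord_law i (A : set R) : measurable A ->
  P (D i @^-1` A) = normal_prob 0 sg A.
Proof.
move=> mA.
have := brownian_normal hB s0 st (A := fun j => if j == i then A else setT).
move=> /(_ (fun j => _)).
have -> : [set w | forall j, (if j == i then A else setT) (increment B s t w 0 j)] = D i @^-1` A.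
  rewrite predeqE => w; split => [/(_ i)|Aw j]; first by rewrite eqxx.
  by case: eqP => // ->.
move=> ->; last by move=> j; case: ifP.
rewrite (bigD1 i)//= eqxx big1 ?mule1// => j /negbTE ->.
exact: probability_setT.
Qed.

Lemma increment_coord_law2 i j (A A' : set R) : i != j -> measurable A -> measurable A' ->
  indep_event P (D i @^-1` A) (D j @^-1` A').
Proof.
move=> ij mA mA'; rewrite /indep_event !increment_coord_law//.
have := brownian_normal hB s0 st
  (A := fun l => if l == i then A else if l == j then A' else setT).
rewrite (_ : [set w | forall l, _] = D i @^-1` A `&` D j @^-1` A').
  move=> ->; last by move=> l; case: ifP => // _; case: ifP.
  rewrite (bigD1 i)//= eqxx (bigD1 j)//=; last by rewrite eq_sym.
  rewrite eqxx eq_sym (negbTE ij) big1 ?mule1//.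
  by move=> l /andP[/negbTE -> /negbTE ->]; exact: probability_setT.
rewrite predeqE => w; split => [H|[Aw A'w] l].
  by split; [have := H i|have := H j]; rewrite eqxx // eq_sym (negbTE ij).
by case: eqP => [->//|_]; case: eqP => // ->.
Qed.

Lemma increment_coord_ge0_integral i (f : R -> \bar R) : measurable_fun setT f ->
  (forall y, 0 <= f y)%E ->
  (\int[P]_w f (D i w) = \int[mu]_y (f y * (normal_pdf 0 sg y)%:E))%E.
Proof.
move=> mf f0; rewrite -normal_prob_integral_ge0//.
have mDi : @measurable_fun _ _ T (measurableTypeR R) setT (D i) by exact: mD.
pose X : {mfun T >-> measurableTypeR R} := HB.pack (D i) (isMeasurableFun.Build _ _ _ _ _ mDi).
transitivity (\int[distribution P X]_y f y)%E; first by rewrite ge0_integral_distribution.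
by apply: eq_measure_integral => A mA _; exact: increment_coord_law.
Qed.

Lemma increment_coord_integral i (f : R -> R) : measurable_fun setT f ->
  mu.-integrable setT (EFin \o (fun y => f y * normal_pdf 0 sg y)) ->
  P.-integrable setT (EFin \o (f \o D i)) /\
  (\int[P]_w f (D i w))%R = (\int[mu]_y (f y * normal_pdf 0 sg y))%R.
Proof.
move=> mf intf; split.
  apply/integrableP; split.
    by apply/measurable_EFinP; apply: measurableT_comp.
  rewrite /= (@increment_coord_ge0_integral i (fun y => `|f y|%:E))//; last first.
    by apply/measurable_EFinP; exact: measurableT_comp.
  case/integrableP: intf => _; apply: le_lt_trans.
  rewrite le_eqVlt; apply/orP; left; apply/eqP; apply: eq_integral => y _.
  by rewrite /= normrM EFinM (ger0_norm (normal_pdf_ge0 _ _ _)).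
rewrite /Rintegral; congr fine.
rewrite integralE [in RHS]integralE; congr (_ - _)%E.
- transitivity (\int[P]_w (fun y : R => (f y)%:E)^\+ (D i w))%E.
    by apply: eq_integral => w _; rewrite !funeposE.
  rewrite increment_coord_ge0_integral//; last first.
    by apply: measurable_funepos; exact/measurable_EFinP.
  apply: eq_integral => y _; rewrite !funeposE -!EFin_max -EFinM.
  by rewrite maxr_pMl ?normal_pdf_ge0// mul0r.
- transitivity (\int[P]_w (fun y : R => (f y)%:E)^\- (D i w))%E.
    by apply: eq_integral => w _; rewrite !funenegE.
  rewrite increment_coord_ge0_integral//; last first.
    by apply: measurable_funeneg; exact/measurable_EFinP.
  apply: eq_integral => y _; rewrite !funenegE -!EFinN -!EFin_max -EFinM.
  by rewrite maxr_pMl ?normal_pdf_ge0// mul0r mulNr.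
Qed.

Lemma increment_coord_pow i k :
  P.-integrable setT (EFin \o (fun w => D i w ^+ k)) /\
  (\int[P]_w (D i w ^+ k))%R = (\int[mu]_y (y ^+ k * normal_pdf 0 sg y))%R.
Proof.
apply: (@increment_coord_integral i (fun y => y ^+ k)).
  exact: exprn_measurable.
exact: integrable_pow_pdf.
Qed.

Lemma increment_coord_mean i : (\int[P]_w D i w)%R = 0.
Proof.
have [_] := increment_coord_pow i 1.
under eq_Rintegral do rewrite expr1.
under [in RHS]eq_Rintegral do rewrite expr1.
by rewrite normal_moment1.
Qed.

Let pdf_mass : (\int[mu]_y (y ^+ 0 * normal_pdf 0 sg y))%R = 1.
Proof.
under eq_Rintegral do rewrite expr0 mul1r.
by rewrite /Rintegral integral_normal_pdf.
Qed.

Lemma increment_coord_sq i : (\int[P]_w (D i w ^+ 2))%R = t - s.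
Proof.
have [_ ->] := increment_coord_pow i 2.
by rewrite normal_moment_rec// pdf_mass mulr1 mul1r sg2.
Qed.

Lemma increment_coord_pow4 i : (\int[P]_w (D i w ^+ 4))%R = 3 * (t - s) ^+ 2.
Proof.
have [_ ->] := increment_coord_pow i 4.
rewrite normal_moment_rec// normal_moment_rec// pdf_mass sg2.
by ring.
Qed.

(** The odd absolute moment is bounded through even ones: |a|^3 <= (sg/2) a^2 + a^4/(2 sg), the
    difference being a^2 (|a| - sg)^2 / (2 sg). The moments sg^2 and 3 sg^4 then give 2 sg^3. *)
Lemma increment_coord_cube_le i :
  P.-integrable setT (EFin \o (fun w => `|D i w| ^+ 3)) /\
  (\int[P]_w (`|D i w| ^+ 3))%R <= 2 * (t - s) * Num.sqrt (t - s).
Proof.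
have [i2 _] := increment_coord_pow i 2.
have [i4 _] := increment_coord_pow i 4.
pose b (w : T) := sg / 2 * D i w ^+ 2 + (2 * sg)^-1 * D i w ^+ 4.
have ib1 : P.-integrable setT (EFin \o (fun w => sg / 2 * D i w ^+ 2)).
  have := integrableZl measurableT (sg / 2) i2; exact.
have ib2 : P.-integrable setT (EFin \o (fun w => (2 * sg)^-1 * D i w ^+ 4)).
  have := integrableZl measurableT (2 * sg)^-1 i4; exact.
have ib : P.-integrable setT (EFin \o b).
  have := integrableD measurableT ib1 ib2; exact.
have bound w : `|D i w| ^+ 3 <= b w.
  rewrite /b -(real_normK (num_real (D i w))).
  have -> : D i w ^+ 4 = `|D i w| ^+ 4.
    by rewrite -[4%N]/(2 * 2)%N 2!exprM real_normK ?num_real.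
  move: (`|D i w|) => a; rewrite -subr_ge0.
  rewrite (_ : _ - _ = a ^+ 2 * (a - sg) ^+ 2 / (2 * sg)); last first.
    by field; rewrite gt_eqF.
  apply: divr_ge0; apply: mulr_ge0 => //; [exact: sqr_ge0..|exact: ltW].
have i3 : P.-integrable setT (EFin \o (fun w => `|D i w| ^+ 3)).
  apply: (@le_integrable _ _ _ P _ measurableT _ (EFin \o b)) => //.
    apply/measurable_EFinP; apply: measurable_funX; exact: measurableT_comp.
  move=> w _ /=; rewrite lee_fin ger0_norm ?exprn_ge0//.
  exact: le_trans (bound w) (ler_norm _).
split => //.
apply: (@le_trans _ _ (\int[P]_w b w)%R).
  by apply: le_Rintegral => // w _; exact: bound.
rewrite RintegralD// !RintegralZl// increment_coord_sq increment_coord_pow4 -sg2.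
rewrite le_eqVlt; apply/orP; left; apply/eqP.
rewrite sqrtr_sqr gtr0_norm//.
by field; rewrite gt_eqF.
Qed.

Lemma increment_coord_prod i j :
  P.-integrable setT (EFin \o (fun w => D i w * D j w)) /\
  (\int[P]_w (D i w * D j w))%R = (i == j)%:R * (t - s).
Proof.
have [<-|ij] := eqVneq i j.
  have [i2 E2] := increment_coord_pow i 2.
  by rewrite mul1r -(increment_coord_sq i); split.
pose X l : {mfun T >-> R} := HB.pack (D l) (isMeasurableFun.Build _ _ _ _ _ (@mD l)).
have iD l : P.-integrable setT (EFin \o D l).
  have [+ _] := increment_coord_pow l 1.
  by under [X in _ \o X]eq_fun do rewrite expr1.
have [] := @indep_expectationM _ _ _ P (X i) (X j) (iD i) (iD j).
  by move=> A A' mA mA'; exact: increment_coord_law2.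
by move=> ? ->; rewrite !increment_coord_mean mulr0 mul0r.
Qed.

End IncrementMoments.

(** * Continuous paths: first visit to a level and its detection on grids *)

Section Paths.
Context (R : realType).
Implicit Types (c : R -> R) (a h : R).

Lemma first_hit c a : continuous c ->
  (forall t, 0 <= t -> c t <> a) \/
  exists s, [/\ 0 <= s, c s = a & forall t, 0 <= t -> t < s -> c t <> a].
Proof.
move=> cc.
pose A := [set t | 0 <= t /\ c t = a].
have [A0|A0] := pselect (A !=set0); last first.
  by left => t t0 ct; apply: A0; exists t.
right; exists (inf A).
have lA : has_lbound A by exists 0 => t [].
have s0 : 0 <= inf A by apply: lb_le_inf => // t [].
split=> //; last first.
  move=> t t0 ts ct; have : A t by [].
  by move=> /(ge_inf lA); rewrite leNgt ts.
apply: contrapT => cs.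
have e0 : 0 < `|a - c (inf A)| by rewrite normr_gt0 subr_eq0; apply/eqP => /esym.
have := cc (inf A); move/cvgrPdist_lt => /(_ _ e0) [/= e e1 he].
have [t At te] := inf_adherent e1 (conj A0 lA).
have st : inf A <= t by apply: ge_inf.
have : `|c (inf A) - c t| < `|a - c (inf A)|.
  apply: he; rewrite /ball_/= distrC ger0_norm ?subr_ge0//.
  by rewrite ltrBlDl.
by case: At => _ ->; rewrite distrC ltxx.
Qed.

(** A hit at time s would bring the last grid point before s arbitrarily close to the level as the
    mesh shrinks, against the uniform gap. Conversely the gap is the positive minimum of the
    distance on a compact interval. *)
Lemma grid_away_iff c a h (k : nat) : continuous c -> 0 < h ->
  (exists m, forall j i, (i <= k * 2 ^ j)%N ->
     m.+1%:R^-1 <= `|c (i%:R * (h / 2 ^+ j)) - a|) <->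
  (forall s, 0 <= s <= k%:R * h -> c s <> a).
Proof.
move=> cc h0; split=> [[m Hm] s /andP[s0 sk] cs|H].
  have m0 : 0 < (m.+1%:R^-1 : R) by rewrite invr_gt0.
  have := cc s; move/cvgrPdist_lt => /(_ _ m0) [/= e e1 he].
  have [j je] : exists j, h / 2 ^+ j < e.
    pose j := Num.bound (h / e).
    exists j; rewrite ltr_pdivrMr ?exprn_gt0// mulrC -ltr_pdivrMr//.
    have /= := @archi_boundP R (h / e) (ltW (divr_gt0 h0 e1)).
    move=> /lt_trans; apply.
    by rewrite -natrX ltr_nat; exact: ltn_expl.
  pose q := h / 2 ^+ j.
  have q0 : 0 < q by rewrite divr_gt0// exprn_gt0.
  have sq0 : 0 <= s / q by rewrite divr_ge0// ltW.
  pose i := Num.truncn (s / q).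
  have /andP[i1 i2] := truncn_itv sq0.
  have il : i%:R * q <= s by rewrite -ler_pdivlMr.
  have ik : (i <= k * 2 ^ j)%N.
    rewrite -(ler_nat R) natrM natrX.
    have : i%:R * q <= k%:R * h by exact: le_trans sk.
    rewrite /q mulrA ler_pdivrMr ?exprn_gt0// -mulrA [h * _]mulrC mulrA.
    by rewrite ler_pM2r.
  have := Hm j i ik; rewrite -/q leNgt => /negP; apply.
  rewrite -cs distrC; apply: he; rewrite /ball_/=.
  rewrite ger0_norm ?subr_ge0// ltrBlDl (lt_trans _ (_ : i%:R * q + q < _))//; last first.
    by rewrite ltrD2l.
  by rewrite -[X in _ + X]mul1r -mulrDl -ltr_pdivrMr// natr1.
have kh : 0 <= k%:R * h by rewrite mulr_ge0// ltW.
have cg : continuous (fun s => `|c s - a|).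
  move=> s; apply: cvg_norm; apply: cvgB; [exact: cc|exact: cvg_cst].
have [s sk smin] := EVT_min kh (continuous_subspaceT cg).
have p0 : 0 < `|c s - a|.
  rewrite normr_gt0 subr_eq0; apply/eqP; apply: H.
  by move: sk; rewrite in_itv.
pose m := Num.bound (`|c s - a|^-1).
exists m => j i ij; apply: (@le_trans _ _ `|c s - a|); last first.
  apply: smin; rewrite in_itv/=; apply/andP; split.
    by rewrite mulr_ge0// ltW// divr_gt0// exprn_gt0.
  rewrite mulrCA [k%:R * h]mulrC ler_wpM2l ?(ltW h0)//.
  by rewrite ler_pdivrMr ?exprn_gt0// -natrX -natrM ler_nat.
rewrite invf_ple ?posrE//.
have /= := @archi_boundP R (`|c s - a|^-1) (ltW _).
rewrite invr_gt0 => /(_ p0) /ltW /le_trans; apply.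
by rewrite ler_nat.
Qed.

Lemma no_hit_side c a (t : R) : continuous c -> 0 <= t ->
  (forall s, 0 <= s <= t -> c s <> a) ->
  (c 0 < a -> c t < a) /\ (a < c 0 -> a < c t).
Proof.
move=> cc t0 H; split => ca; rewrite ltNge; apply/negP => ta.
- have [|s + cs] := @IVT _ c 0 t a t0 (continuous_subspaceT cc).
    by rewrite ge_min le_max (ltW ca) ta orbT.
  by rewrite in_itv => /H.
- have [|s + cs] := @IVT _ c 0 t a t0 (continuous_subspaceT cc).
    by rewrite ge_min le_max (ltW ca) ta !orbT.
  by rewrite in_itv => /H.
Qed.

(** Freezing a path at its value at time 0 for negative times extends it to the line, where ordinary
    continuity is available. *)
Lemma continuous_max0 (V : topologicalType) (b : R -> V) :
  {within `[0, +oo[, continuous b} -> continuous (fun s : R => b (Num.max 0 s)).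
Proof.
move=> /subspace_continuousP cb s.
have A s' : `[0, +oo[%classic (Num.max 0 s' : R).
  by rewrite /= in_itv/= andbT le_max lexx.
apply: cvg_trans (cb _ (A s)).
move=> U; rewrite /= /within/= => WU.
have cm : continuous (fun s : R => Num.max 0 s).
  by move=> y; apply: continuous_max => //; exact: cvg_cst.
have H := cm s _ WU.
change (nbhs s (fun y => U (b (Num.max 0 y)))).
by apply: (@filterS _ (nbhs s) _ _ _ _ H) => y /=; apply; exact: A.
Qed.
End Paths.

Section RealIntegrals.
Context (disp : measure_display) (T : measurableType disp) (R : realType).
Variable P : probability T R.
Implicit Types f g : T -> R.

Definition rintegrable f := P.-integrable setT (EFin \o f).

Lemma rintegrableD f g : rintegrable f -> rintegrable g -> rintegrable (fun w => f w + g w).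
Proof. by move=> i j; have := integrableD measurableT i j; exact. Qed.

Lemma rintegrableB f g : rintegrable f -> rintegrable g -> rintegrable (fun w => f w - g w).
Proof. by move=> i j; have := integrableB measurableT i j; exact. Qed.

Lemma rintegrableZ c f : rintegrable f -> rintegrable (fun w => c * f w).
Proof. by move=> i; have := integrableZl measurableT c i; exact. Qed.

Lemma rintegral_sum (I : Type) (s : seq I) (f : I -> T -> R) :
  (forall i, rintegrable (f i)) ->
  rintegrable (fun w => \sum_(i <- s) f i w) /\
  (\int[P]_w (\sum_(i <- s) f i w) = \sum_(i <- s) \int[P]_w f i w)%R.
Proof.
move=> fi; elim: s => [|i s [IH1 IH2]].
  split.
    rewrite /rintegrable (_ : _ \o _ = cst 0%E); last first.
      by apply/funext => w; rewrite /= big_nil.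
    exact: integrable0.
  rewrite big_nil; under eq_Rintegral do rewrite big_nil.
  by rewrite /Rintegral integral0.
have E : (fun w => \sum_(j <- i :: s) f j w) = (fun w => f i w + \sum_(j <- s) f j w).
  by apply/funext => w; rewrite big_cons.
rewrite E; split; first exact: rintegrableD.
rewrite [LHS]RintegralD//; last exact: fi.
by rewrite big_cons IH2.
Qed.

Variable G : set T.
Hypotheses (mG : measurable G) (PG : P G = 1%E).

Lemma rintegral_full f : rintegrable f -> (\int[P]_w f w = \int[P]_(w in G) f w)%R.
Proof.
move=> fi; rewrite /Rintegral; congr fine.
rewrite (@negligible_integral _ _ _ P setT (~` G))//.
- by rewrite setTD setCK.
- exact: measurableC.
- by have := @probability_setC _ _ _ P G mG; rewrite PG subee.
Qed.

Lemma rintegral_le_ae f g : rintegrable f -> rintegrable g ->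
  (forall w, G w -> f w <= g w) -> (\int[P]_w f w <= \int[P]_w g w)%R.
Proof.
move=> fi gi fg; rewrite !rintegral_full//; apply: le_Rintegral => //.
- exact: integrableS fi.
- exact: integrableS gi.
Qed.

Lemma rintegral_norm_le_ae f g : rintegrable f -> rintegrable g ->
  (forall w, G w -> `|f w| <= g w) -> `|\int[P]_w f w|%R <= (\int[P]_w g w)%R.
Proof.
move=> fi gi fg; rewrite ler_norml; apply/andP; split; last first.
  by apply: rintegral_le_ae => // w Gw; apply: le_trans (fg w Gw); exact: ler_norm.
rewrite lerNl -mulN1r -RintegralZl//; apply: rintegral_le_ae => //.
  exact: rintegrableZ.
by move=> w Gw; rewrite mulN1r; apply: le_trans (fg w Gw); rewrite -normrN; exact: ler_norm.
Qed.

End RealIntegrals.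

(** * The discounted process stopped on a grid, and its limit *)

Section OptionalStopping.
Context (disp : measure_display) (T : measurableType disp) (R : realType).
Variables (P : probability T R) (d : nat) (x : 'rV[R]_d) (B : R -> T -> 'rV[R]_d).
Hypothesis hB : brownian_motion P x B.
Variables (r lambda : R).
Hypotheses (r0 : 0 < r) (lambda0 : 0 < lambda).

Variable G : set T.
Hypotheses (mG : measurable G) (PG : P G = 1%E).
Hypothesis G0 : forall w, G w -> B 0 w = x.
Hypothesis Gc : forall w, G w -> {within `[0, +oo[, continuous (B ^~ w)}.

(** On [Dom], [L] and [Q] play the gradient and the Hessian of [u]. No differentiability is asked
    for: only the third-order estimate counts, for base points in [Dom] but for steps of any length,
    as Gaussian increments are unbounded. *)
Variables (u : 'rV[R]_d -> R) (Dom : set 'rV[R]_d).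
Variables (L : 'I_d -> 'rV[R]_d -> R) (Q : 'I_d -> 'I_d -> 'rV[R]_d -> R) (M K : R).
Hypotheses (mu_ : coord_measurable u) (mL : forall i, coord_measurable (L i)).
Hypothesis mQ : forall i j, coord_measurable (Q i j).
Hypothesis uM : forall y, `|u y| <= M.
Hypothesis LM : forall i y, `|L i y| <= M.
Hypothesis QM : forall i j y, `|Q i j y| <= M.
Hypothesis taylor : forall y dl, Dom y ->
  `|u (y + dl) - u y - \sum_i L i y * dl 0 i
    - 2^-1 * \sum_i \sum_j Q i j y * (dl 0 i * dl 0 j)| <= K * \sum_i `|dl 0 i| ^+ 3.
Hypothesis pde : forall y, Dom y -> 2^-1 * \sum_i Q i i y = lambda * u y.

Lemma bm0E t w : G w -> bm0 x B t w = B t w.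
Proof. by move=> Gw; rewrite /bm0 (G0 Gw) addrC subrK. Qed.

Hypothesis Dom_no_hit : forall w t, G w -> 0 <= t ->
  (forall s, 0 <= s <= t -> enorm (B s w) <> r) -> Dom (B t w).

Let c w (s : R) := dotv (B (Num.max 0 s) w) (B (Num.max 0 s) w).

Lemma continuous_sumr (I : Type) (s : seq I) (V : topologicalType) (f : I -> V -> R) :
  (forall i, continuous (f i)) -> continuous (fun y => \sum_(i <- s) f i y).
Proof.
move=> cf; elim: s => [|i s IH] y.
  by under eq_fun do rewrite big_nil; exact: cvg_cst.
under eq_fun do rewrite big_cons.
by apply: cvgD; [exact: cf|exact: IH].
Qed.

Lemma continuous_dotv : continuous (fun y : 'rV[R]_d => dotv y y).
Proof.
apply: continuous_sumr => i.
have ci : continuous (fun y : 'rV[R]_d => y 0 i) by exact: coord_continuous.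
by move=> y; exact: (continuousM (ci y) (ci y)).
Qed.

Let cc w : G w -> continuous (c w).
Proof.
move=> Gw s; have /= := continuous_max0 (Gc Gw) (x := s).
move=> H; exact: (cvg_comp _ _ H (@continuous_dotv _)).
Qed.

Lemma enorm_eqE (y : 'rV[R]_d) : enorm y = r <-> dotv y y = r ^+ 2.
Proof.
have y0 : 0 <= dotv y y by apply: sumr_ge0 => i _; rewrite -expr2 sqr_ge0.
split=> [<-|yr]; first by rewrite sqr_sqrtr.
by rewrite /enorm yr sqrtr_sqr gtr0_norm.
Qed.

Let c_hit w s : 0 <= s -> c w s = r ^+ 2 <-> enorm (B s w) = r.
Proof. by move=> s0; rewrite enorm_eqE /c max_r. Qed.

Lemma no_hitE h k w : 0 < h -> G w ->
  no_hit x B r h k w <-> (forall s, 0 <= s <= k%:R * h -> enorm (B s w) <> r).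
Proof.
move=> h0 Gw.
have H := grid_away_iff (r ^+ 2) k (cc Gw) h0.
have ge0 (i j : nat) : 0 <= i%:R * (h / 2 ^+ j) by rewrite mulr_ge0// ltW// divr_gt0// exprn_gt0.
have -> : no_hit x B r h k w <-> exists m : nat, forall j i, (i <= k * 2 ^ j)%N ->
     m.+1%:R^-1 <= `|c w (i%:R * (h / 2 ^+ j)) - r ^+ 2|.
  split => [[m _ Hm]|[m Hm]].
    exists m => j i ij; have := Hm j I i ij.
    by rewrite bm0E// /c max_r.
  exists m => // j _ i ij; have := Hm j i ij.
  by rewrite bm0E// /c max_r.
rewrite H; split => Hs s sk; have /andP[s0 _] := sk.
  by move=> /(c_hit w s0); exact: Hs.
by move=> /(c_hit w s0); exact: Hs.
Qed.

Section OneStep.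
Variables (h : R) (k : nat).
Hypothesis h0 : 0 < h.

Let X (j : nat) w := bm0 x B (j%:R * h) w.
Let one w : R := \1_(no_hit x B r h k) w.
Let D := increment B (k%:R * h) (k.+1%:R * h).

Let kh0 : 0 <= k%:R * h. Proof. by rewrite mulr_ge0// ltW. Qed.
Let kh1 : k%:R * h < k.+1%:R * h. Proof. by rewrite ltr_pM2r// ltr_nat. Qed.
Let hE : k.+1%:R * h - k%:R * h = h. Proof. by rewrite -mulrBl -natrB// subSnn mul1r. Qed.

Lemma measurable_bm0_coord t i : 0 <= t -> measurable_fun setT (fun w => bm0 x B t w 0 i).
Proof.
move=> t0; rewrite (_ : (fun w => _) = (fun w => x 0 i + (B t w 0 i - B 0 w 0 i))); last first.
  by apply/funext => w; rewrite !mxE.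
apply: measurable_funD; first exact: measurable_cst.
by apply: measurable_funB; exact: (measurable_coord_bm hB).
Qed.

Let one1 w : no_hit x B r h k w -> one w = 1.
Proof. by move=> nh; rewrite /one indicE mem_set. Qed.

Let one0 w : ~ no_hit x B r h k w -> one w = 0.
Proof. by move=> nh; rewrite /one indicE memNset. Qed.

Let one_le f : (forall y, `|f y| <= M) -> forall w, `|one w * f (X k w)| <= M.
Proof.
move=> fM w; rewrite normrM -[leRHS]mul1r ler_pM//.
by rewrite /one indicE; case: (_ \in _); rewrite ?normr1// normr0.
Qed.

Let mone_cur f : coord_measurable f -> measurable_fun setT (fun w => one w * f (X k w)).
Proof. by move=> mf; exact: (measurable_no_hit_rv hB r k h0 mf). Qed.

Lemma measurable_no_hit : measurable_fun setT one.
Proof.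
have := mone_cur (@coord_measurable_cst R d 1).
by under eq_fun do rewrite mulr1.
Qed.

Let cont_coord i : continuous (fun y : 'rV[R]_d => y 0 i).
Proof. exact: coord_continuous. Qed.

Let int_L i : rintegrable P (fun w => one w * L i (X k w) * D w 0 i) /\
  (\int[P]_w (one w * L i (X k w) * D w 0 i))%R = 0.
Proof.
have [] := @expectation_no_hitM _ _ _ _ _ _ _ hB r h k h0 (L i) (fun y => y 0 i) M (mL i).
- exact: one_le.
- exact: cont_coord.
- exact: coord_measurable_coord.
- have [+ _] := increment_coord_pow hB kh0 kh1 i 1.
  by under [X in _ \o X]eq_fun do rewrite expr1.
by move=> i1 i2; split; [exact: i1|rewrite [LHS]i2 (increment_coord_mean hB kh0 kh1) mulr0].
Qed.

Let int_Q i j : rintegrable P (fun w => one w * Q i j (X k w) * (D w 0 i * D w 0 j)) /\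
  (\int[P]_w (one w * Q i j (X k w) * (D w 0 i * D w 0 j)))%R =
  (\int[P]_w (one w * Q i j (X k w)))%R * ((i == j)%:R * h).
Proof.
have [iD eD] := increment_coord_prod hB kh0 kh1 i j.
have [] := @expectation_no_hitM _ _ _ _ _ _ _ hB r h k h0 (Q i j) (fun y => y 0 i * y 0 j) M (mQ i j).
- exact: one_le.
- by move=> y; exact: (continuousM (@cont_coord i y) (@cont_coord j y)).
- by apply: coord_measurableM; exact: coord_measurable_coord.
- exact: iD.
move=> i1 i2; split; [exact: i1|rewrite [LHS]i2; congr (_ * _)].
by move: eD; rewrite hE.
Qed.

(** By independence the linear and the mixed quadratic terms average to 0, and the pure squares
    contribute h/2 times the trace of [Q], that is [lambda * h * u] by [pde]. The remainder is
    controlled by the third absolute moments of the increment. *)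
Lemma one_step :
  `|(\int[P]_w (one w * u (X k.+1 w)))%R - (1 + lambda * h) * (\int[P]_w (one w * u (X k w)))%R|
  <= `|K| * d%:R * (2 * h * Num.sqrt h).
Proof.
pose Sl w := \sum_i one w * L i (X k w) * D w 0 i.
pose Sq w := \sum_i \sum_j one w * Q i j (X k w) * (D w 0 i * D w 0 j).
pose Er w := one w * u (X k.+1 w) - one w * u (X k w) - Sl w - 2^-1 * Sq w.
have mone := measurable_no_hit.
have X1 w : X k.+1 w = X k w + D w.
  by rewrite /X /D /bm0 /increment; apply/rowP => l; rewrite !mxE; ring.
have m1 : measurable_fun setT (fun w => one w * u (X k.+1 w)).
  apply: measurable_funM => //; apply: mu_ => i; apply: measurable_bm0_coord.
  by rewrite mulr_ge0// ltW.
have i1 : rintegrable P (fun w => one w * u (X k.+1 w)).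
  apply: (@integrable_bounded _ _ _ _ _ M) => // w.
  rewrite normrM -[leRHS]mul1r ler_pM//.
  by rewrite /one indicE; case: (_ \in _); rewrite ?normr1// normr0.
have i0 : rintegrable P (fun w => one w * u (X k w)).
  by apply: (@integrable_bounded _ _ _ _ _ M); [exact: mone_cur|exact: one_le].
have [iSl eSl] : rintegrable P Sl /\ (\int[P]_w Sl w)%R = 0.
  have [i e] := @rintegral_sum _ _ _ P _ (index_enum 'I_d)
     (fun i w => one w * L i (X k w) * D w 0 i) (fun i => (int_L i).1).
  split=> //; rewrite [LHS]e big1// => l _; exact: (int_L l).2.
have [iSq eSq] : rintegrable P Sq /\
    (\int[P]_w Sq w)%R = h * \sum_i (\int[P]_w (one w * Q i i (X k w)))%R.
  have isum l := @rintegral_sum _ _ _ P _ (index_enum 'I_d)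
     (fun j w => one w * Q l j (X k w) * (D w 0 l * D w 0 j)) (fun j => (int_Q l j).1).
  have [i e] := @rintegral_sum _ _ _ P _ (index_enum 'I_d) _ (fun l => (isum l).1).
  split=> //; rewrite [LHS]e mulr_sumr; apply: eq_bigr => l _.
  rewrite (isum l).2 (bigD1 l)//= big1 ?addr0.
    by rewrite (int_Q l l).2 eqxx mul1r mulrC.
  by move=> j jl; rewrite (int_Q l j).2 eq_sym (negbTE jl) mul0r mulr0.
have iQ l : rintegrable P (fun w => one w * Q l l (X k w)).
  by apply: (@integrable_bounded _ _ _ _ _ M); [exact: mone_cur|exact: one_le].
have eQ : \sum_i (\int[P]_w (one w * Q i i (X k w)))%R =
    2 * lambda * (\int[P]_w (one w * u (X k w)))%R.
  have [i <-] := @rintegral_sum _ _ _ P _ (index_enum 'I_d) (fun l w => one w * Q l l (X k w)) iQ.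
  rewrite (rintegral_full mG PG)// [in RHS](rintegral_full mG PG)//.
  rewrite -RintegralZl//; last exact: integrableS i0.
  apply: eq_Rintegral => w /set_mem Gw.
  rewrite -mulr_sumr.
  have [nh|/one0 ->] := pselect (no_hit x B r h k w); last by rewrite !mul0r mulr0.
  rewrite (one1 nh) !mul1r -mulrA -pde ?mulrA ?divff ?mul1r//.
  rewrite /X bm0E//; apply: Dom_no_hit => //.
  exact: (no_hitE k h0 Gw).1.
have iEr : rintegrable P Er.
  by apply: rintegrableB; [apply: rintegrableB => //; exact: rintegrableB|exact: rintegrableZ].
have eEr : (\int[P]_w Er w)%R = (\int[P]_w (one w * u (X k.+1 w)))%R -
    (1 + lambda * h) * (\int[P]_w (one w * u (X k w)))%R.
  rewrite [LHS]RintegralB//; last exact: rintegrableZ.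
    rewrite RintegralB//; last exact: rintegrableB.
    by rewrite RintegralB// RintegralZl// eSl eSq eQ; field.
  by apply: rintegrableB => //; exact: rintegrableB.
rewrite -eEr.
have icube i : rintegrable P (fun w => `|D w 0 i| ^+ 3) by exact: (increment_coord_cube_le hB kh0 kh1 i).1.
have [iC eC] := @rintegral_sum _ _ _ P _ (index_enum 'I_d) _ icube.
apply: (@le_trans _ _ (\int[P]_w (`|K| * \sum_i `|D w 0 i| ^+ 3))%R).
  apply: (rintegral_norm_le_ae mG PG) => //; first exact: rintegrableZ.
  move=> w Gw; rewrite /Er /Sl /Sq.
  under [X in _ - X - _]eq_bigr do rewrite -mulrA.
  under [X in _ - _ * X]eq_bigr => i _.
    under eq_bigr do rewrite -mulrA.
    rewrite -mulr_sumr; over.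
  rewrite -!mulr_sumr mulrCA -!mulrBr normrM.
  have C0 : 0 <= \sum_i `|D w 0 i| ^+ 3 by apply: sumr_ge0 => i _; rewrite exprn_ge0.
  have [nh|/one0 ->] := pselect (no_hit x B r h k w); last first.
    by rewrite normr0 mul0r mulr_ge0.
  rewrite (one1 nh) normr1 mul1r X1; apply: le_trans (taylor _ _) _.
    rewrite /X bm0E//; apply: Dom_no_hit => //.
    exact: (no_hitE k h0 Gw).1.
  by rewrite ler_wpM2r// ler_norm.
rewrite RintegralZl// eC -mulrA ler_wpM2l//.
apply: (@le_trans _ _ (\sum_(i < d) (2 * h * Num.sqrt h))).
  apply: ler_sum => i _; have [_] := increment_coord_cube_le hB kh0 kh1 i.
  by rewrite hE.
by rewrite sumr_const card_ord [leRHS]mulr_natl.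
Qed.

End OneStep.

Definition stopped (w : T) : R :=
  if hitting_time r B w is t%:E then expR (- lambda * t) * u (B t w) else 0.

Lemma hitting_timeP w : G w ->
  (hitting_time r B w = +oo%E /\ forall t, 0 <= t -> enorm (B t w) <> r) \/
  exists s, [/\ hitting_time r B w = s%:E, 0 <= s, enorm (B s w) = r &
    forall t, 0 <= t -> t < s -> enorm (B t w) <> r].
Proof.
move=> Gw; have [H|[s [s0 cs H]]] := first_hit (r ^+ 2) (cc Gw).
  left; have nohit t : 0 <= t -> enorm (B t w) <> r by move=> t0 /(c_hit w t0); exact: H.
  split => //; rewrite /hitting_time.
  rewrite (_ : [set _ | _ in _] = set0) ?ereal_inf0//.
  by rewrite predeqE => e; split => // -[t [t0 /nohit]]; exact.
have nohit t : 0 <= t -> t < s -> enorm (B t w) <> r.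
  by move=> t0 ts /(c_hit w t0); exact: H.
have hs : enorm (B s w) = r by exact/(c_hit w s0).
right; exists s; split => //; rewrite /hitting_time; apply/eqP; rewrite eq_le; apply/andP; split.
  by apply: ereal_inf_lbound; exists s.
apply: le_ereal_inf_tmp => _ [t [t0 ht] <-]; rewrite lee_fin leNgt; apply/negP => ts.
exact: nohit ht.
Qed.

Let X h (k : nat) w := bm0 x B (k%:R * h) w.
Let one h k w : R := \1_(no_hit x B r h k) w.
Let Mt h k w := expR (- lambda * (k%:R * h)) * u (X h k w).
(** The k-th term is present as long as no hit has occurred by time k h. The sum is therefore the
    total change of [Mt] up to the first grid time at or after the hit, or up to N h. *)
Let S h N w := \sum_(k < N) one h k w * (Mt h k.+1 w - Mt h k w).

Lemma telescope_stopped h N w (k : nat) : (k <= N)%N ->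
  (forall i, (i < k)%N -> no_hit x B r h i w) ->
  (forall i, (k <= i)%N -> ~ no_hit x B r h i w) \/ k = N ->
  S h N w = Mt h k w - Mt h 0 w.
Proof.
move=> kN H1 H2; rewrite /S -(big_mkord xpredT (fun k => one h k w * (Mt h k.+1 w - Mt h k w))).
rewrite (big_cat_nat (leq0n k) kN)/= [X in _ + X]big_nat [X in _ + X]big1 ?addr0; last first.
  move=> i /andP[ki iN]; case: H2 => [/(_ i ki) nh|kN']; last by move: ki iN; rewrite kN'; lia.
  by rewrite /one indicE memNset// mul0r.
rewrite big_nat (eq_bigr (fun i => Mt h i.+1 w - Mt h i w)); last first.
  by move=> i /andP[_ ik]; rewrite /one indicE mem_set ?mul1r//; exact: H1.
by rewrite -big_nat telescope_sumr.
Qed.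

Let M0 : 0 <= M. Proof. exact: le_trans (normr_ge0 _) (uM 0). Qed.

Let Mt_le h k w : 0 <= h -> `|Mt h k w| <= M.
Proof.
move=> h0; rewrite /Mt normrM ger0_norm ?expR_ge0// -[leRHS]mul1r ler_pM ?expR_ge0//.
by rewrite -expR0 ler_expR mulNr oppr_le0 !mulr_ge0// ltW.
Qed.

(** The index is the smaller of [N] and the first grid index at or after the hit, so the delay is
    less than one mesh. When the path never hits, the index is [N]. *)
Lemma hit_index h N w : 0 < h -> G w ->
  exists k, [/\ (k <= N)%N, S h N w = Mt h k w - Mt h 0 w,
    (k < N)%N -> exists2 s, hitting_time r B w = s%:E & s <= k%:R * h < s + h
  & k = N -> forall s, hitting_time r B w = s%:E -> s <= N%:R * h -> N%:R * h < s + h].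
Proof.
move=> h0 Gw; have [[hoo nh]|[s [hs s0 bs nh]]] := hitting_timeP Gw.
  exists N; split => //; last by move=> _ s; rewrite hoo.
  - apply: telescope_stopped => //; last by right.
    by move=> i _; apply/no_hitE => // t /andP[t0 _]; exact: nh.
  - by rewrite ltnn.
have nhE i : no_hit x B r h i w <-> i%:R * h < s.
  rewrite no_hitE//; split => [H|H t /andP[t0 th]]; last by apply: nh => //; exact: le_lt_trans th H.
  by rewrite ltNge; apply/negP => sh; apply: (H s) => //; rewrite s0.
have exk : exists k, s <= k%:R * h.
  exists (Num.bound (s / h)); rewrite -ler_pdivrMr//.
  by have := archi_boundP (divr_ge0 s0 (ltW h0)) => /ltW.
case: (ex_minnP exk) => k sk kmin.
have km i : (i < k)%N -> i%:R * h < s.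
  by move=> ik; rewrite ltNge; apply/negP => /kmin; rewrite leqNgt ik.
have kmax i : (k <= i)%N -> ~ (i%:R * h < s).
  move=> ki; rewrite ltNge; apply/negP; rewrite negbK (le_trans sk)//.
  by rewrite ler_wpM2r ?ler_nat// ltW.
have ks : k%:R * h < s + h.
  case: (k) km sk => [|k'] km' sk'; first by rewrite mul0r ltr_wpDl.
  by rewrite -natr1 mulrDl mul1r ltrD2r km'.
have [kN|Nk] := leqP k N.
  exists k; split => //.
  - apply: telescope_stopped => //; first by move=> i ik; apply/nhE/km.
    by left => i ki /nhE; exact: kmax.
  - by move=> _; exists s => //; rewrite sk.
  - by move=> <- s'; rewrite hs => -[<-].
exists N; split => //.
- apply: telescope_stopped => //; last by right.
  by move=> i iN; apply/nhE/km; exact: leq_trans iN (ltnW Nk).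
- by rewrite ltnn.
- by move=> _ s'; rewrite hs => -[<-]; rewrite leNgt km.
Qed.

Hypothesis u_cont : forall y, enorm y = r -> {for y, continuous u}.

(** Two demands compete: the horizon N h must tend to infinity while the accumulated error N h^(3/2)
    tends to 0. With 16^(-j) and 32^j they are 2^j and 2^(-j). *)
Let h_ (j : nat) : R := (16 ^+ j)^-1.
Let N_ (j : nat) : nat := (32 ^ j)%N.

Let h_gt0 j : 0 < h_ j. Proof. by rewrite invr_gt0 exprn_gt0. Qed.

Let NhE j : (N_ j)%:R * h_ j = 2 ^+ j :> R.
Proof.
rewrite /N_ /h_ natrX (_ : 32%:R = 2 * 16 :> R); last by rewrite -natrM.
by rewrite exprMn mulfK// expf_neq0.
Qed.

Let h_cvg0 : h_ j @[j --> \oo] --> 0.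
Proof.
rewrite /h_; under eq_fun do rewrite -exprVn.
by apply: cvg_expr; rewrite ger0_norm ?invr_ge0// invf_lt1// ltr1n.
Qed.

Let twoV_cvg0 : (2 ^+ j)^-1 @[j --> \oo] --> (0 : R).
Proof.
under eq_fun do rewrite -exprVn.
by apply: cvg_expr; rewrite ger0_norm ?invr_ge0// invf_lt1// ltr1n.
Qed.

Let two_ge (C : R) : \forall j \near \oo, C <= 2 ^+ j.
Proof.
have C0 : 0 < (`|C| + 1)^-1 by rewrite invr_gt0 ltr_wpDl.
move/cvgrPdist_lt : twoV_cvg0 => /(_ _ C0); apply: filterS => j.
rewrite sub0r normrN gtr0_norm ?invr_gt0 ?exprn_gt0//.
rewrite ltf_pV2 ?posrE ?exprn_gt0// ?ltr_wpDl// => H.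
by have := ler_norm C; lra.
Qed.

(** If the path hits, the stopping grid times converge to the hitting time and [u] is continuous on
    the sphere. If not, the discount at the horizon 2^j kills the bounded [u]. *)
Lemma S_cvg w : G w -> S (h_ j) (N_ j) w @[j --> \oo] --> stopped w - u x.
Proof.
move=> Gw.
have k_ j := hit_index (N_ j) (h_gt0 j) Gw.
have Mt0 h : Mt h 0 w = u x.
  by rewrite /Mt mul0r mulr0 expR0 mul1r /X bm0E// mul0r (G0 Gw).
have /choice[k Hk] := k_.
have -> : (fun j => S (h_ j) (N_ j) w) = (fun j => Mt (h_ j) (k j) w - u x).
  by apply/funext => j; case: (Hk j) => _ -> _ _; rewrite Mt0.
apply: cvgB; last exact: cvg_cst.
rewrite /stopped; have [[hoo nh]|[s [hs s0 bs nh]]] := hitting_timeP Gw.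
  rewrite hoo.
  have kN j : k j = N_ j.
    case: (Hk j) => kN _ H _; apply/eqP; rewrite eqn_leq kN leqNgt.
    by apply/negP => /H[s]; rewrite hoo.
  apply: norm_cvg0.
  apply: (@squeeze_cvgr _ _ _ _ (cst 0) (fun j => (2 ^+ j)^-1 * (lambda^-1 * M))) => //.
  - near=> j; rewrite normr_ge0/= kN /Mt NhE normrM ger0_norm ?expR_ge0//.
    rewrite mulrA ler_pM ?expR_ge0//.
    rewrite mulNr expRN -invfM lef_pV2 ?posrE ?expR_gt0 ?mulr_gt0 ?exprn_gt0//.
    by rewrite mulrC; have := expR_ge1Dx (lambda * 2 ^+ j); lra.
  - exact: cvg_cst.
  - by rewrite -[X in _ --> X](mul0r (lambda^-1 * M)); apply: cvgM => //; exact: cvg_cst.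
rewrite hs.
have kb : \forall j \near \oo, s <= (k j)%:R * h_ j <= s + h_ j.
  near=> j; have sj : s <= 2 ^+ j by near: j; exact: two_ge.
  case: (Hk j) => kN _ H1 H2; have [kN'|kN'] := ltnP (k j) (N_ j).
    by have [s'] := H1 kN'; rewrite hs => -[<-] /andP[-> /ltW ->].
  have kE : k j = N_ j by apply/eqP; rewrite eqn_leq kN.
  have := H2 kE _ hs; rewrite kE NhE => /(_ sj) /ltW ->.
  by rewrite sj.
have kcvg : (k j)%:R * h_ j @[j --> \oo] --> s.
  apply: (@squeeze_cvgr _ _ _ _ (cst s) (fun j => s + h_ j)) => //.
    exact: cvg_cst.
  by rewrite -[X in _ --> X]addr0; apply: cvgD => //; exact: cvg_cst.
have Bc := continuous_max0 (Gc Gw).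
have bE j : X (h_ j) (k j) w = B (Num.max 0 ((k j)%:R * h_ j)) w.
  by rewrite /X bm0E// max_r// mulr_ge0// ltW.
rewrite /Mt; apply: cvgM.
  apply: (@cvg_comp _ _ _ (fun j => - lambda * ((k j)%:R * h_ j)) expR _ (nbhs (- lambda * s))).
    by apply: cvgM => //; exact: cvg_cst.
  exact: continuous_expR.
have -> : (fun j => u (X (h_ j) (k j) w)) = u \o (fun t => B (Num.max 0 t) w) \o (fun j => (k j)%:R * h_ j).
  by apply/funext => j; rewrite bE.
apply: (@cvg_comp _ _ _ (fun j => (k j)%:R * h_ j) (u \o (fun t => B (Num.max 0 t) w)) _ (nbhs s)) => //.
have := u_cont bs.
have Bs : B s w = B (Num.max 0 s) w by rewrite max_r.
rewrite Bs => uc.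
exact: (cvg_comp _ _ (Bc s) uc).
Unshelve. all: by end_near. Qed.

Lemma S_le h N w : 0 < h -> G w -> `|S h N w| <= 2 * M.
Proof.
move=> h0 Gw; have [k [_ -> _ _]] := hit_index N h0 Gw.
apply: le_trans (ler_normB _ _) _.
by rewrite mulr_natl mulr2n lerD// Mt_le// ltW.
Qed.

Let m_one h k : 0 < h -> measurable_fun setT (one h k).
Proof. by move=> h0; exact: measurable_no_hit. Qed.

Let m_Mt h k : 0 < h -> measurable_fun setT (Mt h k).
Proof.
move=> h0; apply: measurable_funM; first exact: measurable_cst.
apply: mu_ => i; apply: measurable_bm0_coord.
by rewrite mulr_ge0// ltW.
Qed.

Let rint_term h k : 0 < h ->
  rintegrable P (fun w => one h k w * (Mt h k.+1 w - Mt h k w)).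
Proof.
move=> h0; apply: (@integrable_bounded _ _ _ _ _ (2 * M)).
  by apply: measurable_funM; [exact: m_one|apply: measurable_funB; exact: m_Mt].
move=> w; rewrite normrM -[leRHS]mul1r ler_pM//.
  by rewrite /one indicE; case: (_ \in _); rewrite ?normr1// normr0.
apply: le_trans (ler_normB _ _) _.
by rewrite mulr_natl mulr2n lerD// Mt_le// ltW.
Qed.

Let C := 2 * `|K| * d%:R + 2 * lambda ^+ 2 * M.

Lemma expR_quadratic (y : R) : 0 <= y <= 2^-1 -> `|expR y - (1 + y)| <= 2 * y ^+ 2.
Proof.
move=> /andP[y0 y1]; have e1 := expR_ge1Dx y.
rewrite ger0_norm ?subr_ge0// lerBlDr.
have e2 := expR_ge1Dx (- y).
have y2 : 0 < 1 - y by lra.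
have : expR y <= (1 - y)^-1.
  by rewrite -[expR y]invrK -expRN lef_pV2 ?posrE ?expR_gt0.
move=> /le_trans; apply.
rewrite -div1r ler_pdivrMr//.
have : 0 <= y ^+ 2 * (1 - 2 * y) by rewrite mulr_ge0 ?sqr_ge0//; lra.
nra.
Qed.

(** [one_step] after discounting. Exchanging [1 + lambda * h] for the exponential costs at most 2
    (lambda h)^2 M, again of order h^(3/2) because h <= 1. *)
Lemma term_le h k : 0 < h -> h <= 1 -> lambda * h <= 2^-1 ->
  `|\int[P]_w (one h k w * (Mt h k.+1 w - Mt h k w))|%R <= C * (h * Num.sqrt h).
Proof.
move=> h0 h1 lh.
have := @one_step h k h0.
set I1 := (\int[P]_w _)%R; set I0 := (\int[P]_w _)%R => os.
have iU j : rintegrable P (fun w => one h k w * u (X h j w)).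
  apply: (@integrable_bounded _ _ _ _ _ M).
    apply: measurable_funM; first exact: m_one.
    apply: mu_ => i; apply: measurable_bm0_coord; by rewrite mulr_ge0// ltW.
  move=> w; rewrite normrM -[leRHS]mul1r ler_pM//.
  by rewrite /one indicE; case: (_ \in _); rewrite ?normr1// normr0.
have I0M : `|I0| <= M.
  have iM : rintegrable P (fun _ => M) by apply: (@integrable_bounded _ _ _ _ _ M) => // w; rewrite ger0_norm.
  apply: (@le_trans _ _ (\int[P]_w (fun=> M) w)%R).
    apply: (rintegral_norm_le_ae mG PG (iU k) iM) => w _.
    rewrite normrM -[leRHS]mul1r ler_pM//.
    by rewrite /one indicE; case: (_ \in _); rewrite ?normr1// normr0.
  by rewrite Rintegral_cst//= probability_setT mulr1.
pose e1 := expR (- lambda * (k.+1%:R * h)).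
have E : (\int[P]_w (one h k w * (Mt h k.+1 w - Mt h k w)))%R = e1 * (I1 - expR (lambda * h) * I0).
  rewrite mulrBr mulrA -expRD.
  rewrite (_ : - lambda * (k.+1%:R * h) + lambda * h = - lambda * (k%:R * h)); last first.
    by rewrite -natr1; ring.
  rewrite /I1 /I0 -RintegralZl//; last exact: iU.
  rewrite -RintegralZl//; last exact: iU.
  rewrite -(RintegralB measurableT (rintegrableZ e1 (iU k.+1)) (rintegrableZ _ (iU k))).
  apply: eq_Rintegral => w _; rewrite /Mt /e1; ring.
rewrite E normrM ger0_norm ?expR_ge0//.
have e1_le : e1 <= 1.
  by rewrite -expR0 ler_expR mulNr oppr_le0 !mulr_ge0// ltW.
apply: (@le_trans _ _ `|I1 - expR (lambda * h) * I0|).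
  by rewrite ler_piMl.
rewrite (_ : I1 - _ = (I1 - (1 + lambda * h) * I0) - (expR (lambda * h) - (1 + lambda * h)) * I0); last by ring.
apply: le_trans (ler_normB _ _) _.
have q : `|(expR (lambda * h) - (1 + lambda * h)) * I0| <= 2 * (lambda * h) ^+ 2 * M.
  rewrite normrM ler_pM// expR_quadratic// lh andbT.
  by rewrite mulr_ge0// ltW.
apply: le_trans (lerD os q) _.
have hs : h <= Num.sqrt h.
  rewrite -{1}[h]gtr0_norm// -sqrtr_sqr ler_sqrt//; last exact: ltW.
  by rewrite expr2 ler_piMl// ltW.
rewrite /C [leRHS]mulrDl lerD//.
  by rewrite le_eqVlt; apply/orP; left; apply/eqP; ring.
rewrite (_ : 2 * (lambda * h) ^+ 2 * M = 2 * lambda ^+ 2 * M * (h * h)); last by ring.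
rewrite ler_wpM2l//; last by rewrite ler_wpM2l// ltW.
by rewrite !mulr_ge0// ltW.
Qed.

Let sqrt_h j : Num.sqrt (h_ j) = (4 ^+ j)^-1.
Proof.
rewrite /h_ (_ : (16 ^+ j)^-1 = ((4 ^+ j)^-1) ^+ 2 :> R); last first.
  by rewrite exprVn -exprM mulnC exprM (_ : 4 ^+ 2 = 16 :> R)//; ring.
by rewrite sqrtr_sqr ger0_norm// invr_ge0 exprn_ge0.
Qed.

Lemma S_integral_cvg : (\int[P]_w S (h_ j) (N_ j) w)%R @[j --> \oo] --> (0 : R).
Proof.
have C0 : 0 <= C by rewrite addr_ge0// !mulr_ge0// ltW.
apply: norm_cvg0.
apply: (@squeeze_cvgr _ _ _ _ (cst 0) (fun j => (2 ^+ j)^-1 * C)) => //; last 2 first.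
  exact: cvg_cst.
  by rewrite -[X in _ --> X](mul0r C); apply: cvgM => //; exact: cvg_cst.
near=> j; rewrite normr_ge0/=.
have [_ ->] := @rintegral_sum _ _ _ P _ (index_enum 'I_(N_ j)) _
  (fun k : 'I_(N_ j) => @rint_term (h_ j) k (h_gt0 j)).
apply: le_trans (ler_norm_sum _ _ _) _.
apply: (@le_trans _ _ (\sum_(k < N_ j) C * (h_ j * Num.sqrt (h_ j)))).
  apply: ler_sum => k _; apply: term_le => //.
  - by rewrite invf_le1 ?exprn_gt0// exprn_ege1// ler1n.
  - near: j.
    have e0 : 0 < (2 * lambda)^-1 by rewrite invr_gt0 mulr_gt0.
    move/cvgrPdist_lt : h_cvg0 => /(_ _ e0); apply: filterS => j.
    rewrite sub0r normrN gtr0_norm// invfM => /ltW H.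
    by rewrite -ler_pdivlMl// mulrC.
rewrite sumr_const card_ord -[leLHS]mulr_natl.
rewrite (_ : _%:R * _ = (N_ j)%:R * h_ j * Num.sqrt (h_ j) * C); last by ring.
rewrite NhE sqrt_h (_ : 4%:R = 2 * 2 :> R); last by rewrite -natrM.
by rewrite exprMn invfM mulrA divff ?expf_neq0// mul1r.
Unshelve. all: by end_near. Qed.

(** On [G] the grid sums converge to [stopped w - u x] and are bounded by 2 M, so dominated
    convergence meets [S_integral_cvg]. The measurability of [stopped] on [G] is a by-product of the
    same limit. *)
Theorem optional_stopping :
  measurable_fun G stopped /\ (\int[P]_(w in G) stopped w)%R = u x.
Proof.
have mS j : measurable_fun setT (S (h_ j) (N_ j)).
  apply: measurable_sum => k; apply: measurable_funM; first exact: m_one.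
  by apply: measurable_funB; exact: m_Mt.
have m1 : measurable_fun G (fun w => stopped w - u x).
  apply: (measurable_fun_cvg (fun j => measurable_funTS (mS j))) => w Gw.
  exact: S_cvg.
have ms : measurable_fun G stopped.
  rewrite (_ : stopped = fun w => (stopped w - u x) + u x); last first.
    by apply/funext => w; rewrite subrK.
  by apply: measurable_funD => //; exact: measurable_cst.
split=> //.
have i2M : P.-integrable G (EFin \o (fun=> 2 * M)).
  apply: (@integrableS _ _ _ _ setT) => //.
  by apply: (@integrable_bounded _ _ _ _ _ `|2 * M|).
have cv w : G w -> (S (h_ j) (N_ j) w)%:E @[j --> \oo] --> (stopped w - u x)%:E.
  by move=> Gw; apply: cvg_EFin; [exact: nearW|exact: S_cvg].
have [i1 _ c1] := @dominated_convergence _ _ _ P G mG (fun j w => (S (h_ j) (N_ j) w)%:E)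
  (fun w => (stopped w - u x)%:E) (fun=> (2 * M)%:E)
  (fun j => (measurable_EFinP _ _).2 (measurable_funTS (mS j)))
  ((measurable_EFinP _ _).2 m1) (aeW _ cv) i2M
  (aeW _ (fun w j Gw => S_le (N_ j) (h_gt0 j) Gw)).
have iS j : rintegrable P (S (h_ j) (N_ j)).
  exact: (rintegral_sum (index_enum _) (fun k : 'I_(N_ j) => @rint_term (h_ j) k (h_gt0 j))).1.
have E0 : (\int[P]_(w in G) (stopped w - u x))%R = 0.
  have c3 : (\int[P]_w S (h_ j) (N_ j) w)%R @[j --> \oo] --> (\int[P]_(w in G) (stopped w - u x))%R.
    under eq_fun do rewrite (rintegral_full mG PG (iS _)).
    apply: fine_cvg; rewrite fineK//; exact: integrable_fin_num.
  exact: (cvg_unique (@Rhausdorff R) c3 S_integral_cvg).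
have icst : P.-integrable G (EFin \o (fun=> u x)).
  apply: (@integrableS _ _ _ _ setT) => //.
  by apply: (@integrable_bounded _ _ _ _ _ M) => // w; exact: uM.
transitivity (\int[P]_(w in G) ((stopped w - u x) + u x))%R.
  by apply: eq_Rintegral => w _; rewrite subrK.
by rewrite RintegralD// E0 add0r Rintegral_cst//= PG mulr1.
Qed.

End OptionalStopping.

(** * Harmonic polynomials times radial functions *)

Section Expressions.
Context (R : realType) (d : nat).
Implicit Types (y a dl : 'rV[R]_d) (i j l : 'I_d).

(* Formal functions of y, to be differentiated symbolically: EPhi k stands for
   phi_k (|y|^2), where phi_k' = phi_(k+1), and ELin b for <b, y>. *)
Inductive expr :=
  | EPhi of nat
  | ECst of R
  | ECoord of 'I_d
  | ELin of 'rV[R]_d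
  | ESq
  | EAdd of expr & expr
  | EMul of expr & expr.

Fixpoint pdiff i (e : expr) : expr :=
  match e with
  | EPhi k => EMul (EMul (ECst 2) (ECoord i)) (EPhi k.+1)
  | ECst _ => ECst 0
  | ECoord j => ECst (j == i)%:R
  | ELin a => ECst (a 0 i)
  | ESq => EMul (ECst 2) (ECoord i)
  | EAdd e1 e2 => EAdd (pdiff i e1) (pdiff i e2)
  | EMul e1 e2 => EAdd (EMul (pdiff i e1) e2) (EMul e1 (pdiff i e2))
  end.

(* Every monomial contains some phi_k. *)
Fixpoint decaying (e : expr) : bool :=
  match e with
  | EPhi k => true
  | ECst _ | ECoord _ | ELin _ | ESq => false
  | EAdd e1 e2 => decaying e1 && decaying e2
  | EMul e1 e2 => decaying e1 || decaying e2
  end.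

Lemma decaying_pdiff i e : decaying e -> decaying (pdiff i e).
Proof.
elim: e => //= [e1 IH1 e2 IH2 /andP[/IH1 -> /IH2 ->]//|e1 IH1 e2 IH2].
by move=> /orP[H|H]; rewrite H ?(IH1 H) ?(IH2 H) ?orbT.
Qed.

Variable phi : nat -> R -> R.

Fixpoint ev (e : expr) y : R :=
  match e with
  | EPhi k => phi k (dotv y y)
  | ECst c => c
  | ECoord i => y 0 i
  | ELin a => dotv a y
  | ESq => dotv y y
  | EAdd e1 e2 => ev e1 y + ev e2 y
  | EMul e1 e2 => ev e1 y * ev e2 y
  end.

Variable J : set R.
Hypothesis phiJ : forall k q, J q -> is_derive q (1 : R) (phi k) (phi k.+1 q).

Lemma is_derive_sumr (I : Type) (s : seq I) (f : I -> R -> R) (df : I -> R) (t : R) :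
  (forall k, is_derive t (1 : R) (f k) (df k)) ->
  is_derive t (1 : R) (fun x => \sum_(k <- s) f k x) (\sum_(k <- s) df k).
Proof.
move=> H; elim: s => [|k s IH].
  by under eq_fun do rewrite big_nil; rewrite big_nil; exact: is_derive_cst.
under eq_fun do rewrite big_cons; rewrite big_cons.
have := H k => ?.
by apply: is_derive_eq.
Qed.

Lemma is_derive_coord y dl (t : R) i :
  is_derive t (1 : R) (fun t => (y + t *: dl) 0 i) (dl 0 i).
Proof.
rewrite (_ : (fun t => _) = fun t : R => y 0 i + t * dl 0 i); last first.
  by apply/funext => s; rewrite !mxE.
by apply: is_derive_eq; rewrite /GRing.scale /=; ring.
Qed.

Lemma is_derive_lin a y dl (t : R) :
  is_derive t (1 : R) (fun t => dotv a (y + t *: dl)) (dotv a dl).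
Proof.
apply: is_derive_sumr => i; have := is_derive_coord y dl t i => ?.
by apply: is_derive_eq; rewrite /GRing.scale /=; ring.
Qed.

Lemma is_derive_sq y dl (t : R) :
  is_derive t (1 : R) (fun t => dotv (y + t *: dl) (y + t *: dl))
    (\sum_i 2 * (y + t *: dl) 0 i * dl 0 i).
Proof.
apply: is_derive_sumr => i; have := is_derive_coord y dl t i => ?.
by apply: is_derive_eq; rewrite /GRing.scale /=; ring.
Qed.

Lemma is_derive_ev e y dl (t : R) : J (dotv (y + t *: dl) (y + t *: dl)) ->
  is_derive t (1 : R) (fun t => ev e (y + t *: dl))
    (\sum_i ev (pdiff i e) (y + t *: dl) * dl 0 i).
Proof.
move=> Jt; elim: e => [k|c|j|a||e1 IH1 e2 IH2|e1 IH1 e2 IH2] /=.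
- have := phiJ k Jt => ?; have := is_derive_sq y dl t => ?.
  apply: is_derive_eq; rewrite mulr_sumr; apply: eq_bigr => i _; ring.
- by rewrite big1 => [|i _]; [exact: is_derive_cst|rewrite mul0r].
- rewrite (bigD1 j)//= eqxx mul1r big1 ?addr0; first exact: is_derive_coord.
  by move=> i /negbTE ij; rewrite eq_sym ij mul0r.
- exact: is_derive_lin.
- exact: is_derive_sq.
- apply: is_derive_eq; rewrite -big_split; apply: eq_bigr => i _ /=; ring.
- apply: is_derive_eq; rewrite /GRing.scale /= !mulr_sumr -big_split.
  by apply: eq_bigr => i _ /=; ring.
Qed.

Lemma bound_primitive (f df : R -> R) (C : R) : f 0 = 0 ->
  (forall t : R, 0 <= t <= 1 -> is_derive t (1 : R) f (df t)) ->
  (forall t : R, 0 <= t <= 1 -> `|df t| <= C) ->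
  forall t : R, 0 <= t <= 1 -> `|f t| <= C.
Proof.
move=> f0 Df dfC t /andP[t0 t1].
have C0 : 0 <= C by apply: le_trans (dfC 0 _); rewrite ?lexx ?ler01.
have D s : s \in `]0, t[ -> is_derive s (1 : R) f (df s).
  rewrite in_itv/= => /andP[s0 st]; apply: Df.
  by rewrite (ltW s0)/= (le_trans (ltW st)).
have cf : {within `[0, t], continuous f}.
  apply: derivable_within_continuous => s; rewrite in_itv/= => /andP[s0 st].
  by have [] := Df s; rewrite ?s0 ?(le_trans st).
have [s + E] := MVT_segment t0 D cf.
rewrite in_itv/= => /andP[s0 st].
rewrite -[f t]subr0 -f0 E subr0 normrM (ger0_norm t0) -[leRHS]mulr1 ler_pM//.
by apply: dfC; rewrite s0 (le_trans st).
Qed.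

Lemma ev_taylor e y dl (C : R) :
  (forall t : R, 0 <= t <= 1 -> J (dotv (y + t *: dl) (y + t *: dl))) ->
  (forall i j l z, J (dotv z z) -> `|ev (pdiff l (pdiff j (pdiff i e))) z| <= C) ->
  `|ev e (y + dl) - ev e y - \sum_i ev (pdiff i e) y * dl 0 i
    - 2^-1 * \sum_i \sum_j ev (pdiff j (pdiff i e)) y * (dl 0 i * dl 0 j)|
  <= C * (\sum_i `|dl 0 i|) ^+ 3.
Proof.
move=> seg HC.
pose z (t : R) := y + t *: dl.
pose g0 t := ev e (z t).
pose g1 t := \sum_i ev (pdiff i e) (z t) * dl 0 i.
pose g2 t := \sum_i \sum_j ev (pdiff j (pdiff i e)) (z t) * (dl 0 i * dl 0 j).
pose g3 t := \sum_i \sum_j \sum_l ev (pdiff l (pdiff j (pdiff i e))) (z t) * (dl 0 i * dl 0 j * dl 0 l).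
have z0 : z 0 = y by rewrite /z scale0r addr0.
have d0 (t : R) : 0 <= t <= 1 -> is_derive t (1 : R) g0 (g1 t).
  by move=> /seg; exact: is_derive_ev.
have d1 (t : R) : 0 <= t <= 1 -> is_derive t (1 : R) g1 (g2 t).
  move=> /seg st; apply: is_derive_sumr => i.
  have := is_derive_ev (pdiff i e) st => ?.
  apply: is_derive_eq; rewrite /GRing.scale/= mulr0 add0r mulr_sumr.
  by apply: eq_bigr => j _; ring.
have d2 (t : R) : 0 <= t <= 1 -> is_derive t (1 : R) g2 (g3 t).
  move=> /seg st; apply: is_derive_sumr => i; apply: is_derive_sumr => j.
  have := is_derive_ev (pdiff j (pdiff i e)) st => ?.
  apply: is_derive_eq; rewrite /GRing.scale/= mulr0 add0r mulr_sumr.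
  by apply: eq_bigr => l _; ring.
set K := C * _.
have b3 (t : R) : 0 <= t <= 1 -> `|g3 t| <= K.
  move=> /seg st; rewrite /K (_ : _ ^+ 3 = \sum_i \sum_j \sum_l (`|dl 0 i| * `|dl 0 j| * `|dl 0 l|)); last first.
    rewrite !exprS expr0 mulr1 mulr_suml; apply: eq_bigr => i _.
    rewrite mulr_suml mulr_sumr; apply: eq_bigr => j _.
    by rewrite !mulr_sumr; apply: eq_bigr => l _; ring.
  do 3 (rewrite mulr_sumr; apply: le_trans (ler_norm_sum _ _ _) _; apply: ler_sum => ? _).
  by rewrite !normrM ler_wpM2r ?mulr_ge0//; exact: HC.
have b2 : forall t : R, 0 <= t <= 1 -> `|g2 t - g2 0| <= K.
  apply: (bound_primitive _ _ b3); first by rewrite subrr.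
  move=> t t01; have := d2 _ t01 => ?.
  by apply: is_derive_eq; rewrite subr0.
have b1 : forall t : R, 0 <= t <= 1 -> `|g1 t - g1 0 - t * g2 0| <= K.
  apply: (bound_primitive _ _ b2); first by rewrite subrr mul0r subrr.
  move=> t t01; have := d1 _ t01 => ?.
  by apply: is_derive_eq; rewrite /GRing.scale/=; ring.
have b0 : forall t : R, 0 <= t <= 1 -> `|g0 t - g0 0 - t * g1 0 - 2^-1 * (t * t) * g2 0| <= K.
  apply: (bound_primitive _ _ b1); first by ring.
  move=> t t01; have := d0 _ t01 => ?.
  by apply: is_derive_eq; rewrite /GRing.scale/=; field.
have := b0 1; rewrite ler01 lexx => /(_ isT).
by rewrite /g0 /g1 /g2 z0 /z scale1r !mul1r !mulr1.
Qed.

Hypothesis phi_decay : forall k m, exists C, forall q, 0 <= q -> J q ->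
  (1 + q) ^+ m * `|phi k q| <= C.

Lemma dotv_ge0 y : 0 <= dotv y y.
Proof. by apply: sumr_ge0 => i _; rewrite -expr2 sqr_ge0. Qed.

Lemma coord_sq_le y i : y 0 i ^+ 2 <= dotv y y.
Proof.
rewrite /dotv (bigD1 i)//= expr2 lerDl.
by apply: sumr_ge0 => j _; rewrite -expr2 sqr_ge0.
Qed.

Lemma coord_le y i : `|y 0 i| <= 1 + dotv y y.
Proof.
have := coord_sq_le y i; rewrite -real_normK ?num_real//.
have := normr_ge0 (y 0 i); move: (`|_|) => t t0.
nra.
Qed.

Lemma one_le_exp1q y m : 1 <= (1 + dotv y y) ^+ m.
Proof. by apply: exprn_ege1; rewrite lerDl dotv_ge0. Qed.

Lemma ev_growth e : exists C, exists m, forall y, J (dotv y y) ->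
  `|ev e y| <= C * (1 + dotv y y) ^+ m.
Proof.
elim: e => [k|c|i|a||e1 [C1 [m1 H1]] e2 [C2 [m2 H2]]|e1 [C1 [m1 H1]] e2 [C2 [m2 H2]]] /=.
- have [C HC] := phi_decay k 0; exists C; exists 0%N => y Jy.
  by have := HC _ (dotv_ge0 y) Jy; rewrite !expr0 mul1r mulr1.
- by exists `|c|; exists 0%N => y _; rewrite expr0 mulr1.
- by exists 1; exists 1%N => y _; rewrite mul1r expr1 coord_le.
- exists (\sum_i `|a 0 i|); exists 1%N => y _; rewrite expr1 mulr_suml.
  apply: le_trans (ler_norm_sum _ _ _) _; apply: ler_sum => i _.
  by rewrite normrM ler_wpM2l// coord_le.
- by exists 1; exists 1%N => y _; rewrite mul1r expr1 ger0_norm ?dotv_ge0// lerDr.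
- exists (`|C1| + `|C2|); exists (m1 + m2)%N => y Jy.
  apply: le_trans (ler_normD _ _) _; rewrite mulrDl lerD//.
  + apply: le_trans (H1 y Jy) _; apply: ler_pM.
    * by have := le_trans (normr_ge0 _) (H1 y Jy); rewrite pmulr_lge0// exprn_gt0// ltr_wpDr// dotv_ge0.
    * by rewrite (le_trans ler01)// one_le_exp1q.
    * exact: ler_norm.
    * by rewrite ler_weXn2l ?leq_addr// lerDl dotv_ge0.
  + apply: le_trans (H2 y Jy) _; apply: ler_pM.
    * by have := le_trans (normr_ge0 _) (H2 y Jy); rewrite pmulr_lge0// exprn_gt0// ltr_wpDr// dotv_ge0.
    * by rewrite (le_trans ler01)// one_le_exp1q.
    * exact: ler_norm.
    * by rewrite ler_weXn2l ?leq_addl// lerDl dotv_ge0.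
- exists (C1 * C2); exists (m1 + m2)%N => y Jy.
  by rewrite normrM exprD mulrACA ler_pM// ?H1 ?H2.
Qed.

(** In a product one factor containing some phi_k suffices: the other grows polynomially by
    [ev_growth], and a larger exponent in the decay of the first absorbs this. *)
Lemma ev_decay e : decaying e -> forall m, exists C, forall y, J (dotv y y) ->
  (1 + dotv y y) ^+ m * `|ev e y| <= C.
Proof.
have mul e1 e2 : (forall m, exists C, forall y, J (dotv y y) ->
    (1 + dotv y y) ^+ m * `|ev e1 y| <= C) ->
    forall m, exists C, forall y, J (dotv y y) ->
    (1 + dotv y y) ^+ m * `|ev e1 y * ev e2 y| <= C.
  move=> H m; have [C2 [m2 H2]] := ev_growth e2.
  have [C1 H1] := H (m + m2)%N.
  exists (C1 * `|C2|) => y Jy.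
  have H2' : `|ev e2 y| <= `|C2| * (1 + dotv y y) ^+ m2.
    apply: le_trans (H2 y Jy) _; rewrite ler_wpM2r ?ler_norm//.
    by rewrite (le_trans ler01)// one_le_exp1q.
  have p0 : 0 <= (1 + dotv y y) ^+ m by rewrite (le_trans ler01)// one_le_exp1q.
  rewrite normrM; apply: le_trans (_ : (1 + dotv y y) ^+ m * (`|ev e1 y| * (`|C2| * (1 + dotv y y) ^+ m2)) <= _).
    by rewrite ler_wpM2l// ler_wpM2l.
  rewrite (_ : _ * _ = (1 + dotv y y) ^+ (m + m2) * `|ev e1 y| * `|C2|); last by rewrite exprD; ring.
  by rewrite ler_wpM2r// H1.
elim: e => //= [k _ m|e1 IH1 e2 IH2 /andP[d1 d2] m|e1 IH1 e2 IH2].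
- by have [C HC] := phi_decay k m; exists C => y; apply: HC; exact: dotv_ge0.
- have [C1 H1] := IH1 d1 m; have [C2 H2] := IH2 d2 m.
  exists (C1 + C2) => y Jy; apply: le_trans (lerD (H1 y Jy) (H2 y Jy)).
  by rewrite -mulrDr ler_wpM2l ?ler_normD// (le_trans ler01)// one_le_exp1q.
- move=> /orP[d1|d2]; first exact/mul/IH1.
  move=> m; have [C HC] := mul e2 e1 (IH2 d2) m.
  by exists C => y; rewrite mulrC; rewrite [X in `|X|]mulrC mulrC; exact: HC.
Qed.

Lemma ev_bounded e : decaying e -> exists C, forall y, J (dotv y y) -> `|ev e y| <= C.
Proof.
move=> /ev_decay /(_ 0%N)[C HC]; exists C => y Jy.
by have := HC y Jy; rewrite expr0 mul1r.
Qed.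

Hypothesis mJ : measurable J.
Hypothesis mphi : forall k, measurable_fun setT (fun q => \1_J q * phi k q).

(** Extension by 0 makes decaying expressions bounded and measurable on the whole space. The jump at
    the edge of [J] is out of reach of steps of l1-size at most [rho] from points of [DQ]. *)
Definition cutoff (e : expr) y := \1_J (dotv y y) * ev e y.

Lemma coord_measurable_cutoff e : coord_measurable (cutoff e).
Proof.
have mone : coord_measurable (fun y => \1_J (dotv y y) : R).
  apply: (@coord_measurable_comp _ _ (\1_J : R -> R)); last exact: coord_measurable_sq.
  exact: measurable_indic.
rewrite /cutoff; elim: e => [k|c|i|a||e1 IH1 e2 IH2|e1 IH1 e2 IH2] /=.
- apply: (@coord_measurable_comp _ _ (fun q => \1_J q * phi k q)) => //.
  exact: coord_measurable_sq.
- by apply: coord_measurableM => //; exact: coord_measurable_cst.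
- by apply: coord_measurableM => //; exact: coord_measurable_coord.
- by apply: coord_measurableM => //; exact: coord_measurable_dotv.
- by apply: coord_measurableM => //; exact: coord_measurable_sq.
- rewrite (_ : (fun y => _) = fun y => \1_J (dotv y y) * ev e1 y + \1_J (dotv y y) * ev e2 y).
    exact: coord_measurableD.
  by apply/funext => y; rewrite mulrDr.
- rewrite (_ : (fun y => _) = fun y => (\1_J (dotv y y) * ev e1 y) * (\1_J (dotv y y) * ev e2 y)).
    exact: coord_measurableM.
  apply/funext => y; rewrite mulrACA; congr (_ * _).
  by rewrite indicE; case: (_ \in _); rewrite ?mulr1// mulr0.
Qed.

Lemma cutoffE e y : J (dotv y y) -> cutoff e y = ev e y.
Proof. by move=> Jy; rewrite /cutoff indicE mem_set// mul1r. Qed.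

Lemma cutoff_bounded e : decaying e -> exists C, forall y, `|cutoff e y| <= C.
Proof.
move=> /ev_bounded [C HC]; exists `|C| => y.
rewrite /cutoff indicE; have [Jy|Jy] := pselect (J (dotv y y)).
  by rewrite mem_set// mul1r (le_trans (HC y Jy))// ler_norm.
by rewrite memNset// mul0r normr0.
Qed.

Lemma sum_cube_le (s : seq 'I_d) : exists C : R, 0 <= C /\
  forall f : 'I_d -> R, (forall i, 0 <= f i) ->
  (\sum_(i <- s) f i) ^+ 3 <= C * \sum_(i <- s) f i ^+ 3.
Proof.
elim: s => [|i s [C [C0 HC]]].
  by exists 0; split => // f _; rewrite !big_nil expr0n mulr0.
exists (4 + 4 * C); split => [|f f0]; first lra.
rewrite !big_cons; have := HC f f0.
have S0 : 0 <= \sum_(j <- s) f j by exact: sumr_ge0.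
have T0 : 0 <= \sum_(j <- s) f j ^+ 3 by apply: sumr_ge0 => j _; rewrite exprn_ge0.
move: S0 T0 (f0 i); move: (\sum_(j <- s) f j) (\sum_(j <- s) f j ^+ 3) (f i) => b t a b0 t0 a0 bt.
have conv : (a + b) ^+ 3 <= 4 * (a ^+ 3 + b ^+ 3).
  rewrite -subr_ge0 (_ : _ - _ = 3 * (a + b) * (a - b) ^+ 2); last by ring.
  by rewrite mulr_ge0 ?sqr_ge0// mulr_ge0// addr_ge0.
apply: le_trans conv _.
have a3 : 0 <= a ^+ 3 by exact: exprn_ge0.
nra.
Qed.

Variable DQ : set R.
Hypothesis mDQ : measurable DQ.
Variable rho : R.
Hypothesis rho_gt0 : 0 < rho.
Hypothesis segment : forall y dl (t : R), DQ (dotv y y) -> \sum_i `|dl 0 i| <= rho ->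
  0 <= t <= 1 -> J (dotv (y + t *: dl) (y + t *: dl)).

Lemma DQ_J y : DQ (dotv y y) -> J (dotv y y).
Proof.
move=> Dy; have := @segment y 0 0 Dy.
rewrite scaler0 addr0 big1 ?(ltW rho_gt0) ?lexx ?ler01; first by apply.
by move=> i _; rewrite mxE normr0.
Qed.

Lemma fin_bound (I : finType) (f : I -> R -> Prop) :
  (forall k, exists C, forall C', C <= C' -> f k C') ->
  exists C, forall k, f k C.
Proof.
move=> H; have /choice[C HC] := H.
exists (\sum_k `|C k|) => k; apply: HC.
rewrite (bigD1 k)//= (le_trans (ler_norm _))// lerDl.
exact: sumr_ge0.
Qed.

(** Short steps stay in [J], where [ev_taylor] applies. For a step longer than [rho] nothing is
    expanded: every term is bounded separately and compared with the cube of the step. *)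
Lemma cutoff_taylor e : decaying e -> exists K, forall y dl, DQ (dotv y y) ->
  `|cutoff e (y + dl) - cutoff e y - \sum_i cutoff (pdiff i e) y * dl 0 i
    - 2^-1 * \sum_i \sum_j cutoff (pdiff j (pdiff i e)) y * (dl 0 i * dl 0 j)|
  <= K * \sum_i `|dl 0 i| ^+ 3.
Proof.
move=> de.
have bd e' : decaying e' -> exists C, forall C', C <= C' -> forall y, `|cutoff e' y| <= C'.
  by move=> /cutoff_bounded [C HC]; exists C => C' CC' y; exact: le_trans CC'.
have [C0 HC0] := cutoff_bounded de.
have [C1 HC1] : exists C, forall i y, `|cutoff (pdiff i e) y| <= C.
  by apply: fin_bound => i; apply: bd; exact: decaying_pdiff.
have [C2 HC2] : exists C, forall i j y, `|cutoff (pdiff j (pdiff i e)) y| <= C.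
  apply: fin_bound => i; have [C HC] : exists C, forall j y, `|cutoff (pdiff j (pdiff i e)) y| <= C.
    by apply: fin_bound => j; apply: bd; do 2 apply: decaying_pdiff.
  by exists C => C' CC' j y; exact: le_trans CC'.
have [C3 HC3] : exists C, forall i j l y, `|cutoff (pdiff l (pdiff j (pdiff i e))) y| <= C.
  apply: fin_bound => i; have [C HC] : exists C, forall j l y, `|cutoff (pdiff l (pdiff j (pdiff i e))) y| <= C.
    apply: fin_bound => j; have [C HC] : exists C, forall l y, `|cutoff (pdiff l (pdiff j (pdiff i e))) y| <= C.
      by apply: fin_bound => l; apply: bd; do 3 apply: decaying_pdiff.
    by exists C => C' CC' l y; exact: le_trans CC'.
  by exists C => C' CC' j l y; exact: le_trans CC'.
have [S [S0 HS]] := sum_cube_le (index_enum 'I_d).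
(* The first summand serves short steps. For long ones s / rho >= 1, and each further summand lifts
   one bound, of degree 0, 1 or 2 in s, to degree 3. *)
pose K := `|C3| + 2 * `|C0| / rho ^+ 3 + `|C1| / rho ^+ 2 + `|C2| / rho.
have rge0 m : 0 <= rho ^- m by rewrite invr_ge0 exprn_ge0// ltW.
have K0 : 0 <= K.
  by rewrite /K !addr_ge0// ?mulr_ge0// invr_ge0 ltW.
exists (K * S) => y dl Dy.
have Jy := DQ_J Dy.
rewrite -mulrA; apply: le_trans (_ : K * (\sum_i `|dl 0 i|) ^+ 3 <= _); last first.
  by rewrite ler_wpM2l//; apply: HS.
set s := \sum_i `|dl 0 i|.
have s0 : 0 <= s by exact: sumr_ge0.
have [sr|rs] := leP s rho.
  have seg (t : R) : 0 <= t <= 1 -> J (dotv (y + t *: dl) (y + t *: dl)) by exact: segment.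
  have Jyd : J (dotv (y + dl) (y + dl)).
    by have := seg 1; rewrite ler01 lexx scale1r; apply.
  rewrite !cutoffE//.
  under eq_bigr do rewrite cutoffE//.
  under [X in _ - _ * X]eq_bigr do under eq_bigr do rewrite cutoffE//.
  apply: le_trans (ev_taylor seg (C := `|C3|) _) _.
    move=> i j l z Jz; rewrite -cutoffE//; apply: le_trans (HC3 i j l z) _; exact: ler_norm.
  rewrite ler_wpM2r ?exprn_ge0// /K -!addrA lerDl !addr_ge0// ?mulr_ge0// invr_ge0 ltW//.
have C0' : 0 <= `|C0| by [].
have b0 z : `|cutoff e z| <= `|C0| by apply: le_trans (HC0 z) (ler_norm _).
have b1 : `|\sum_i cutoff (pdiff i e) y * dl 0 i| <= `|C1| * s.
  rewrite mulr_sumr; apply: le_trans (ler_norm_sum _ _ _) _; apply: ler_sum => i _.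
  by rewrite normrM ler_wpM2r// (le_trans (HC1 i y))// ler_norm.
have b2 : `|\sum_i \sum_j cutoff (pdiff j (pdiff i e)) y * (dl 0 i * dl 0 j)| <= `|C2| * s ^+ 2.
  rewrite (_ : s ^+ 2 = \sum_i \sum_j `|dl 0 i| * `|dl 0 j|); last first.
    by rewrite expr2 mulr_suml; apply: eq_bigr => i _; rewrite mulr_sumr.
  do 2 (rewrite mulr_sumr; apply: le_trans (ler_norm_sum _ _ _) _; apply: ler_sum => ? _).
  rewrite normrM [X in _ * X <= _]normrM ler_wpM2r ?mulr_ge0//.
  by apply: le_trans (HC2 _ _ y) _; exact: ler_norm.
apply: le_trans (_ : 2 * `|C0| + `|C1| * s + `|C2| * s ^+ 2 <= _).
  apply: le_trans (ler_normB _ _) _; apply: lerD.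
    apply: le_trans (ler_normB _ _) _; apply: lerD => //.
    apply: le_trans (ler_normB _ _) _.
    by have := b0 (y + dl); have := b0 y; lra.
  rewrite normrM (ger0_norm (_ : 0 <= 2^-1))//.
  by have := normr_ge0 (\sum_i \sum_j cutoff (pdiff j (pdiff i e)) y * (dl 0 i * dl 0 j)); lra.
pose a := s / rho.
have a1 : 1 <= a by rewrite /a ler_pdivlMr// mul1r ltW.
have sa : s = a * rho by rewrite /a divfK// gt_eqF.
have -> : K * s ^+ 3 = `|C3| * s ^+ 3 + 2 * `|C0| * a ^+ 3 + `|C1| * s * a ^+ 2 + `|C2| * s ^+ 2 * a.
  by rewrite /K sa; field; rewrite gt_eqF.
have p0 : 0 <= `|C3| * s ^+ 3 by rewrite mulr_ge0// exprn_ge0.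
have p1 : 2 * `|C0| <= 2 * `|C0| * a ^+ 3 by rewrite ler_peMr ?mulr_ge0// exprn_ege1.
have p2 : `|C1| * s <= `|C1| * s * a ^+ 2 by rewrite ler_peMr ?mulr_ge0// exprn_ege1.
have p3 : `|C2| * s ^+ 2 <= `|C2| * s ^+ 2 * a by rewrite ler_peMr ?mulr_ge0// exprn_ge0.
lra.
Qed.

End Expressions.

(** * Zonal harmonic polynomials and their products with radial functions *)

Section Harmonic.
Context (R : realType) (d : nat).
Implicit Types (e : expr R d) (y : 'rV[R]_d) (i j l : 'I_d).
Variables (nu : R) (a : 'rV[R]_d).
Hypothesis nuE : nu = (d%:R - 2) / 2.
Hypothesis nu0 : 0 <= nu.
Hypothesis a1 : dotv a a = 1.

(* At n = nu = 0 the quotient is 0, as it should. *)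
Definition gam (n : nat) : R := n%:R / (n%:R + nu).

Lemma gamS_neq0 n : gam n.+1 != 0.
Proof.
rewrite mulf_neq0 ?invr_eq0 ?pnatr_eq0// gt_eqF// ltr_pwDl//.
Qed.

Lemma two_subgam n : (0 < n%:R + nu) -> 2 - gam n = (n%:R + 2 * nu) / (n%:R + nu).
Proof. by move=> h; rewrite /gam; field; rewrite gt_eqF. Qed.

(* r^n times the normalized Gegenbauer polynomial (1 + n / nu) C_n^nu of
   <a, y> / r, as a harmonic polynomial of y. *)
Fixpoint harm2 (n : nat) : expr R d * expr R d :=
  if n is n'.+1 then
    let: (h0, h1) := harm2 n' in
    (h1, EMul (ECst d (gam n'.+2)^-1)
           (EAdd (EMul (ECst d 2) (EMul (ELin a) h1))
                 (EMul (ECst d (gam n' - 2)) (EMul (ESq R d) h0))))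
  else (ECst d 1, EMul (ECst d (2 * (1 + nu))) (ELin a)).

Definition harm n := (harm2 n).1.

Lemma harm0 : harm 0 = ECst d 1. Proof. by []. Qed.
Lemma harm1 : harm 1 = EMul (ECst d (2 * (1 + nu))) (ELin a). Proof. by []. Qed.
Lemma harmSS n : harm n.+2 = EMul (ECst d (gam n.+2)^-1)
   (EAdd (EMul (ECst d 2) (EMul (ELin a) (harm n.+1)))
         (EMul (ECst d (gam n - 2)) (EMul (ESq R d) (harm n)))).
Proof. by rewrite /harm /=; case: (harm2 n). Qed.

Variable phi : nat -> R -> R.
Local Notation ev := (ev phi).

Definition euler e y := \sum_i y 0 i * ev (pdiff i e) y.
Definition dirder e y := \sum_i a 0 i * ev (pdiff i e) y.
Definition lapl e y := \sum_i ev (pdiff i (pdiff i e)) y.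

Lemma harmSS_ind (P : nat -> Prop) : P 0%N -> P 1%N ->
  (forall n, P n -> P n.+1 -> P n.+2) -> forall n, P n.
Proof.
move=> P0 P1 PSS n; suff: P n /\ P n.+1 by case.
by elim: n => [|n [IH1 IH2]]; split => //; exact: PSS.
Qed.

Lemma harm_recE n y : ev (harm n.+2) y =
  (gam n.+2)^-1 * (2 * (dotv a y * ev (harm n.+1) y)
      + (gam n - 2) * (dotv y y * ev (harm n) y)).
Proof. by rewrite harmSS. Qed.

Lemma diff_harm i n y : ev (pdiff i (harm n.+2)) y =
  (gam n.+2)^-1 * (2 * (a 0 i * ev (harm n.+1) y + dotv a y * ev (pdiff i (harm n.+1)) y)
      + (gam n - 2) * (2 * y 0 i * ev (harm n) y + dotv y y * ev (pdiff i (harm n)) y)).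
Proof. rewrite harmSS /=; ring. Qed.

Lemma diff2_harm i n y : ev (pdiff i (pdiff i (harm n.+2))) y =
  (gam n.+2)^-1 * (2 * (2 * a 0 i * ev (pdiff i (harm n.+1)) y
       + dotv a y * ev (pdiff i (pdiff i (harm n.+1))) y)
      + (gam n - 2) * (2 * ev (harm n) y + 4 * y 0 i * ev (pdiff i (harm n)) y
            + dotv y y * ev (pdiff i (pdiff i (harm n))) y)).
Proof. rewrite harmSS /= eqxx /=; ring. Qed.

Lemma dotvE (u w : 'rV[R]_d) : \sum_(i < d) u 0 i * w 0 i = dotv u w :> R. Proof. by []. Qed.

Lemma euler_rec n y : euler (harm n.+2) y =
  (gam n.+2)^-1 * (2 * (dotv a y * ev (harm n.+1) y + dotv a y * euler (harm n.+1) y)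
      + (gam n - 2) * (2 * dotv y y * ev (harm n) y + dotv y y * euler (harm n) y)).
Proof.
rewrite /euler; under eq_bigr do rewrite diff_harm.
rewrite (eq_bigr (fun i => (gam n.+2)^-1 * 2 * ev (harm n.+1) y * (a 0 i * y 0 i)
  + (gam n.+2)^-1 * 2 * dotv a y * (y 0 i * ev (pdiff i (harm n.+1)) y)
  + (gam n.+2)^-1 * (gam n - 2) * 2 * ev (harm n) y * (y 0 i * y 0 i)
  + (gam n.+2)^-1 * (gam n - 2) * dotv y y * (y 0 i * ev (pdiff i (harm n)) y))); last first.
  by move=> i _; ring.
by rewrite !big_split /= -!mulr_sumr !dotvE; ring.
Qed.

(** Euler's identity: the polynomial is homogeneous of degree n, as both terms of the recurrence
    show. *)
Lemma euler_harm n y : euler (harm n) y = n%:R * ev (harm n) y.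
Proof.
move: n; apply: harmSS_ind.
- by rewrite /euler big1 => [|i _] /=; rewrite ?mulr0// mul0r.
- rewrite /euler /harm /=.
  rewrite (eq_bigr (fun i => (2 * (1 + nu)) * (a 0 i * y 0 i))); last by move=> i _; ring.
  by rewrite -mulr_sumr dotvE; ring.
- move=> n IH0 IH1; rewrite euler_rec IH0 IH1 harm_recE -!natr1; ring.
Qed.

Lemma dirder_rec n y : dirder (harm n.+2) y =
  (gam n.+2)^-1 * (2 * (ev (harm n.+1) y + dotv a y * dirder (harm n.+1) y)
      + (gam n - 2) * (2 * dotv a y * ev (harm n) y + dotv y y * dirder (harm n) y)).
Proof.
rewrite /dirder; under eq_bigr do rewrite diff_harm.
rewrite (eq_bigr (fun i => (gam n.+2)^-1 * 2 * ev (harm n.+1) y * (a 0 i * a 0 i)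
  + (gam n.+2)^-1 * 2 * dotv a y * (a 0 i * ev (pdiff i (harm n.+1)) y)
  + (gam n.+2)^-1 * (gam n - 2) * 2 * ev (harm n) y * (a 0 i * y 0 i)
  + (gam n.+2)^-1 * (gam n - 2) * dotv y y * (a 0 i * ev (pdiff i (harm n)) y))); last first.
  by move=> i _; ring.
by rewrite !big_split /= -!mulr_sumr !dotvE a1; ring.
Qed.

(** Differentiation along the axis [a] lowers the degree within the family. In the induction, |y|^2
    times the lower polynomial is eliminated by the recurrence, so that only members of the family
    remain. *)
Lemma dirder_harm n y : dirder (harm n.+1) y = (2 - gam n) * (n.+1%:R + nu) * ev (harm n) y.
Proof.
have d0 z : dirder (harm 0) z = 0 by rewrite /dirder big1 => [|i _] //=; rewrite mulr0.
have d1 z : dirder (harm 1) z = 2 * (1 + nu).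
  rewrite /dirder /harm /=.
  rewrite (eq_bigr (fun i => (2 * (1 + nu)) * (a 0 i * a 0 i))); last by move=> i _; ring.
  by rewrite -mulr_sumr dotvE a1; ring.
have pos k : 0 < k.+1%:R + nu :> R by rewrite ltr_pwDl.
move: n; apply: harmSS_ind.
- by rewrite d1 /gam mul0r /=; ring.
- rewrite dirder_rec d0 d1 mulr0 addr0 /gam mul0r /=.
  have := pos 0%N; have := pos 1%N => p1 p0.
  by field; rewrite ?gt_eqF//.
- move=> n IH0 IH1; rewrite dirder_rec IH0 IH1.
  have -> : dotv y y * ((2 - gam n) * (n.+1%:R + nu) * ev (harm n) y) =
     (n.+1%:R + nu) * (2 * dotv a y * ev (harm n.+1) y - gam n.+2 * ev (harm n.+2) y).
    by rewrite harm_recE; field; exact: gamS_neq0.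
  have g2 := two_subgam (pos n.+1); have g1 := two_subgam (pos n).
  rewrite (_ : gam n.+1 - 2 = - (2 - gam n.+1)); last by ring.
  rewrite g1 g2 /gam -!natr1.
  have p0 := pos n; have p1 := pos n.+1; have p2 := pos n.+2.
  rewrite -!natr1 in p0 p1 p2.
  by field; rewrite ?gt_eqF//.
Qed.

(** The Laplacian of <a,y> H_(n+1) leaves twice the derivative along [a], and that of |y|^2 H_n
    leaves (2d + 4n) H_n by Euler's identity. With d = 2 nu + 2 the recurrence coefficient
    [gam n - 2] makes the two cancel. *)
Lemma lapl_harm n y : lapl (harm n) y = 0.
Proof.
move: n; apply: harmSS_ind.
- by rewrite /lapl big1.
- by rewrite /lapl big1// => i _ /=; ring.
- move=> n IH0 IH1; rewrite /lapl; under eq_bigr do rewrite diff2_harm.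
  rewrite (eq_bigr (fun i => (gam n.+2)^-1 * 4 * (a 0 i * ev (pdiff i (harm n.+1)) y)
    + (gam n.+2)^-1 * 2 * dotv a y * ev (pdiff i (pdiff i (harm n.+1))) y
    + (gam n.+2)^-1 * (gam n - 2) * 2 * ev (harm n) y
    + (gam n.+2)^-1 * (gam n - 2) * 4 * (y 0 i * ev (pdiff i (harm n)) y)
    + (gam n.+2)^-1 * (gam n - 2) * dotv y y * ev (pdiff i (pdiff i (harm n))) y)); last first.
    by move=> i _; ring.
  rewrite !big_split /= -!mulr_sumr -!/(lapl _ _) -!/(dirder _ _) -!/(euler _ _) IH0 IH1.
  rewrite dirder_harm euler_harm sumr_const card_ord -(mulr_natr (ev (harm n) y) d).
  have -> : d%:R = 2 * nu + 2 :> R by rewrite nuE; field.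
  by rewrite -natr1; ring.
Qed.

Definition radial n := EMul (harm n) (EPhi R d 0).

Lemma decaying_radial n : decaying (radial n).
Proof. by rewrite /= orbT. Qed.

(** In Lap(H phi) = phi Lap H + 2 <grad H, grad phi> + H Lap phi the first term vanishes and the
    second is evaluated by Euler's identity. *)
Lemma lapl_radial n y :
  lapl (radial n) y = ev (harm n) y * (4 * dotv y y * phi 2 (dotv y y)
    + 2 * (d%:R + 2 * n%:R) * phi 1 (dotv y y)).
Proof.
rewrite /lapl /=.
rewrite (eq_bigr (fun i => phi 0 (dotv y y) * ev (pdiff i (pdiff i (harm n))) y
   + 4 * phi 1 (dotv y y) * (y 0 i * ev (pdiff i (harm n)) y)
   + 2 * phi 1 (dotv y y) * ev (harm n) y
   + 4 * phi 2 (dotv y y) * ev (harm n) y * (y 0 i * y 0 i))); last first.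
  by move=> i _; rewrite eqxx /=; ring.
rewrite !big_split /= -!mulr_sumr dotvE -!/(lapl _ _) -!/(euler _ _).
by rewrite lapl_harm euler_harm sumr_const card_ord -(mulr_natr (ev (harm n) y) d); ring.
Qed.

End Harmonic.

(** * Discounted expectation of a harmonic polynomial at the hitting point *)

Section RadialDirichlet.
Context (disp : measure_display) (T : measurableType disp) (R : realType).
Variables (P : probability T R) (d : nat) (x : 'rV[R]_d) (B : R -> T -> 'rV[R]_d).
Hypothesis hB : brownian_motion P x B.
Variables (r lambda : R).
Hypotheses (r0 : 0 < r) (lambda0 : 0 < lambda).
Variable G : set T.
Hypotheses (mG : measurable G) (PG : P G = 1%E).
Hypothesis G0 : forall w, G w -> B 0 w = x.
Hypothesis Gc : forall w, G w -> {within `[0, +oo[, continuous (B ^~ w)}.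

Variables (nu : R) (a : 'rV[R]_d).
Hypothesis nuE : nu = (d%:R - 2) / 2.
Hypothesis nu0 : 0 <= nu.
Hypothesis a1 : dotv a a = 1.

Variables (phi : nat -> R -> R) (J DQ : set R) (rho : R) (n : nat).
Hypothesis phiJ : forall k q, J q -> is_derive q (1 : R) (phi k) (phi k.+1 q).
Hypothesis phi_decay : forall k m, exists C, forall q, 0 <= q -> J q ->
  (1 + q) ^+ m * `|phi k q| <= C.
Hypothesis mJ : measurable J.
Hypothesis mphi : forall k, measurable_fun setT (fun q => \1_J q * phi k q).
Hypothesis mDQ : measurable DQ.
Hypothesis rho_gt0 : 0 < rho.
Hypothesis segment : forall (y dl : 'rV[R]_d) (t : R), DQ (dotv y y) -> \sum_i `|dl 0 i| <= rho ->
  0 <= t <= 1 -> J (dotv (y + t *: dl) (y + t *: dl)).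
Hypothesis J_near : \forall q \near r ^+ 2, J q.
Hypothesis DQ_side :
  (DQ = [set q | q < r ^+ 2] /\ dotv x x < r ^+ 2) \/
  (DQ = [set q | r ^+ 2 < q] /\ r ^+ 2 < dotv x x).
Hypothesis ode : forall q, J q ->
  2 * q * phi 2 q + (d%:R + 2 * n%:R) * phi 1 q = lambda * phi 0 q.
Hypothesis phi_r : phi 0 (r ^+ 2) != 0.

Let e := radial nu a n.

Lemma ev_continuous e' (y : 'rV[R]_d) : J (dotv y y) -> {for y, continuous (ev phi e')}.
Proof.
move=> Jy; have cq := @continuous_dotv R d y.
elim: e' => [k|c|i|b||e1 IH1 e2 IH2|e1 IH1 e2 IH2] /=.
- have pc : {for dotv y y, continuous (phi k)}.
    by apply: differentiable_continuous; apply/derivable1_diffP; have [] := phiJ k Jy.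
  exact: (cvg_comp _ _ cq pc).
- exact: cst_continuous.
- exact: coord_continuous.
- have cl : continuous (dotv b).
    apply: continuous_sumr => i z.
    exact: (continuousM (@cst_continuous _ _ (b 0 i) z) (@coord_continuous R 1 d 0 i z)).
  exact: cl.
- exact: cq.
- exact: (continuousD IH1 IH2).
- exact: (continuousM IH1 IH2).
Qed.

Let Jx : J (dotv x x).
Proof. by apply: (DQ_J rho_gt0 segment); case: DQ_side => -[-> ?]. Qed.

Let Dom (y : 'rV[R]_d) := DQ (dotv y y).

Let ind_cut e' (y : 'rV[R]_d) := \1_DQ (dotv y y) * cutoff phi J e' y.

Let ind_cutE e' y : Dom y -> ind_cut e' y = cutoff phi J e' y.
Proof. by move=> Dy; rewrite /ind_cut indicE mem_set// mul1r. Qed.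

Let m_ind_cut e' : coord_measurable (ind_cut e').
Proof.
apply: coord_measurableM; last exact: coord_measurable_cutoff.
apply: (@coord_measurable_comp _ _ (\1_DQ : R -> R)); last exact: coord_measurable_sq.
exact: measurable_indic.
Qed.

Let ind_cut_bounded e' : decaying e' -> exists C, forall C', C <= C' ->
  forall y, `|ind_cut e' y| <= C'.
Proof.
move=> /(cutoff_bounded phi_decay)[C HC]; exists C => C' CC' y.
rewrite normrM -[leRHS]mul1r ler_pM//; last exact: le_trans CC'.
by rewrite indicE; case: (_ \in _); rewrite ?normr1// normr0.
Qed.

Lemma radial_stopped :
  measurable_fun G (stopped B r lambda (cutoff phi J e)) /\
  (\int[P]_(w in G) stopped B r lambda (cutoff phi J e) w)%R = ev phi e x.
Proof.
have de : decaying e by exact: decaying_radial.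
have [K HK] := cutoff_taylor phiJ phi_decay rho_gt0 segment de.
have [C0 HC0] := cutoff_bounded phi_decay de.
have [C1 HC1] : exists C, forall i y, `|ind_cut (pdiff i e) y| <= C.
  by apply: fin_bound => i; apply: ind_cut_bounded; exact: decaying_pdiff.
have [C2 HC2] : exists C, forall i j y, `|ind_cut (pdiff j (pdiff i e)) y| <= C.
  apply: fin_bound => i; have [C HC] : exists C, forall j y, `|ind_cut (pdiff j (pdiff i e)) y| <= C.
    by apply: fin_bound => j; apply: ind_cut_bounded; do 2 apply: decaying_pdiff.
  by exists C => C' CC' j y; exact: le_trans CC'.
pose M := `|C0| + `|C1| + `|C2|.
have M0 : C0 <= M by rewrite /M; have := ler_norm C0; have := normr_ge0 C1; have := normr_ge0 C2; lra.
have M1 : C1 <= M by rewrite /M; have := ler_norm C1; have := normr_ge0 C0; have := normr_ge0 C2; lra.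
have M2 : C2 <= M by rewrite /M; have := ler_norm C2; have := normr_ge0 C1; have := normr_ge0 C0; lra.
rewrite -(cutoffE phi e Jx).
apply: (@optional_stopping _ _ _ P d x B hB r lambda r0 lambda0 G mG PG G0 Gc
   (cutoff phi J e) Dom (fun i => ind_cut (pdiff i e))
   (fun i j => ind_cut (pdiff j (pdiff i e))) M K).
- exact: coord_measurable_cutoff.
- by move=> i; exact: m_ind_cut.
- by move=> i j; exact: m_ind_cut.
- by move=> y; exact: le_trans M0.
- by move=> i y; exact: le_trans M1.
- by move=> i j y; exact: le_trans M2.
- move=> y dl Dy.
  under eq_bigr do rewrite ind_cutE//.
  under [X in _ - _ * X]eq_bigr do under eq_bigr do rewrite ind_cutE//.
  exact: HK.
- move=> y Dy; have Jy : J (dotv y y) by exact: (DQ_J rho_gt0 segment Dy).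
  under eq_bigr do rewrite ind_cutE// cutoffE//.
  rewrite -/(lapl phi e y) lapl_radial// cutoffE//=.
  transitivity (ev phi (harm nu a n) y * (lambda * phi 0 (dotv y y))); last by ring.
  by rewrite -(ode Jy); field.
- move=> w t Gw t0 nh.
  pose c (s : R) := dotv (B (Num.max 0 s) w) (B (Num.max 0 s) w).
  have cc : continuous c.
    by move=> s; exact: (cvg_comp _ _ (continuous_max0 (Gc Gw) (x := s)) (@continuous_dotv R d _)).
  have nc s : 0 <= s <= t -> c s <> r ^+ 2.
    move=> st; have /andP[s0 _] := st; rewrite /c max_r// => /(enorm_eqE r0).
    exact: nh.
  have [H1 H2] := no_hit_side cc t0 nc.
  rewrite /Dom; have <- : c t = dotv (B t w) (B t w) by rewrite /c max_r.
  have c0 : c 0 = dotv x x by rewrite /c maxxx (G0 Gw).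
  by case: DQ_side => -[-> h]; [apply: H1|apply: H2]; rewrite c0.
- move=> y /(enorm_eqE r0) yr.
  have Jy : J (dotv y y) by rewrite yr; exact: nbhs_singleton.
  have H : \forall z \near y, J (dotv z z).
    by have := @continuous_dotv R d y; rewrite /continuous_at yr; apply.
  rewrite /prop_for /continuous_at (cutoffE phi e Jy).
  have := @ev_continuous e y Jy; rewrite /prop_for /continuous_at => ce U /ce HU.
  by apply: (@filterS2 _ (nbhs y) _ _ _ _ _ HU H) => z /= Uz Jz; rewrite cutoffE.
Qed.

Definition stopped_harm (w : T) : R := stopped B r lambda (ev phi (harm nu a n)) w.

(** On the sphere the radial factor is the constant phi_0(r^2); dividing by it leaves the harmonic
    polynomial alone at the hitting point. *)
Lemma stopped_harm_expectation :
  measurable_fun G stopped_harm /\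
  (\int[P]_(w in G) stopped_harm w)%R =
    ev phi (harm nu a n) x * (phi 0 (dotv x x) / phi 0 (r ^+ 2)).
Proof.
have [ms es] := radial_stopped.
have E w : G w -> stopped_harm w = (phi 0 (r ^+ 2))^-1 * stopped B r lambda (cutoff phi J e) w.
  move=> Gw; rewrite /stopped_harm /stopped.
  have [[-> _]|[s [-> s0 bs _]]] := hitting_timeP r0 Gc Gw; first by rewrite mulr0.
  have qs := (enorm_eqE r0 _).1 bs.
  rewrite cutoffE /=; last by rewrite qs; exact: nbhs_singleton.
  by rewrite qs; field.
split.
  apply: (eq_measurable_fun (fun w => (phi 0 (r ^+ 2))^-1 * stopped B r lambda (cutoff phi J e) w)).
    by move=> w /set_mem Gw; rewrite E.
  by apply: measurable_funM => //; exact: measurable_cst.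
transitivity (\int[P]_(w in G) ((phi 0 (r ^+ 2))^-1 * stopped B r lambda (cutoff phi J e) w))%R.
  by apply: eq_Rintegral => w /set_mem Gw; rewrite E.
have [C HC] := cutoff_bounded phi_decay (decaying_radial nu a n).
rewrite RintegralZl//; last first.
  apply: measurable_bounded_integrable => //.
    by rewrite (le_lt_trans (probability_le1 _ mG))// ltry.
  exists C; split; first exact: num_real.
  move=> N CN w Gw; rewrite /stopped /=.
  have C0 : 0 <= C by apply: le_trans (normr_ge0 _) (HC 0).
  have [[-> _]|[s [-> s0 bs _]]] := hitting_timeP r0 Gc Gw.
    by rewrite normr0 (le_trans C0)// ltW.
  rewrite normrM ger0_norm ?expR_ge0// (le_trans _ (ltW CN))//.
  rewrite -[leRHS]mul1r ler_pM ?expR_ge0//.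
  by rewrite -expR0 ler_expR mulNr oppr_le0 mulr_ge0// ltW.
by rewrite es /=; field.
Qed.

End RadialDirichlet.

(** * Bessel functions *)

Section BesselIntegral.
Context (R : realType).
Local Notation mu := (@lebesgue_measure R).
Implicit Types s w t : R.

Lemma integrable_exp_abs (c : R) : 0 < c ->
  mu.-integrable setT (EFin \o (fun t : R => expR (- c * `|t|))).
Proof.
move=> c0.
have ce : continuous (fun t : R => expR (- c * `|t|)).
  move=> t; apply: (@cvg_comp _ _ _ (fun t => - c * `|t|) expR _ (nbhs (- c * `|t|))).
    by apply: cvgM; [exact: cvg_cst|exact: norm_continuous].
  exact: continuous_expR.
have me : measurable_fun setT (fun t : R => expR (- c * `|t|)) by exact: continuous_measurable_fun.
apply/integrableP; split; first exact/measurable_EFinP.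
under eq_integral do rewrite /= ger0_norm ?expR_ge0//.
rewrite ge0_symfun_integralT//; last first.
  by move=> t /=; rewrite normrN.
rewrite -set_itvcy.
have -> : (\int[mu]_(x in `[0%R, +oo[) (expR (- c * `|x|))%:E =
    \int[mu]_(x in `[0%R, +oo[) ((c^-1 * exponential_pdf c x)%R)%:E)%E.
  apply: eq_integral => t /[!inE]/=; rewrite in_itv/= andbT => t0.
  by rewrite exponential_pdfE// mulrA mulVf ?gt_eqF// mul1r ger0_norm.
rewrite muleC lte_mul_pinfty//.
- by apply: integral_ge0 => t _; rewrite lee_fin mulr_ge0 ?invr_ge0 ?exponential_pdf_ge0// ltW.
- have : mu.-integrable `[0, +oo[ (EFin \o (fun t => c^-1 * exponential_pdf c t)).
    have := integrableZl measurableT c^-1 (integrable_exponential_pdf c0).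
    by move=> i; exact: integrableS i.
  exact: integrable_fin_num.
- by rewrite ltry.
Qed.

(** With tau = exp t this is tau^s exp(-tau - w/tau), and dt = dtau / tau. The logarithmic variable
    makes the domain the whole line, so that derivatives integrate to 0 without boundary terms. *)
Definition ker s w t := expR (s * t - expR t - w * expR (- t)).

Lemma ker_gt0 s w t : 0 < ker s w t. Proof. exact: expR_gt0. Qed.
Lemma ker_ge0 s w t : 0 <= ker s w t. Proof. exact: expR_ge0. Qed.

Lemma is_derive_ker_t s w t : is_derive t (1 : R) (ker s w)
  (s * ker s w t - ker (s + 1) w t + w * ker (s - 1) w t).
Proof.
rewrite /ker; apply: is_derive_eq.
rewrite (_ : (s + 1) * t - _ - _ = t + (s * t - expR t - w * expR (- t))); last by ring.
rewrite (_ : (s - 1) * t - _ - _ = - t + (s * t - expR t - w * expR (- t))); last by ring.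
by rewrite !expRD /GRing.scale /=; ring.
Qed.

Lemma is_derive_ker_w s w t : is_derive w (1 : R) (fun w => ker s w t) (- ker (s - 1) w t).
Proof.
pose c := s * t - expR t; pose b := - expR (- t).
have d1 : is_derive w (1 : R) (fun w => c + b * w) b.
  by apply: is_derive_eq; rewrite /GRing.scale /=; ring.
rewrite (_ : (fun w => ker s w t) = fun w => expR (c + b * w)); last first.
  by apply/funext => v; rewrite /ker /c /b mulNr [v * _]mulrC.
apply: is_derive_eq.
rewrite /ker (_ : (s - 1) * t - _ - _ = - t + (c + b * w)); last by rewrite /c /b; ring.
by rewrite [expR (- t + _)]expRD /b; ring.
Qed.

Lemma continuous_ker s w : continuous (ker s w).
Proof.
move=> t; apply: differentiable_continuous; apply/derivable1_diffP.
by have [] := is_derive_ker_t s w t.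
Qed.

Lemma measurable_ker s w : measurable_fun setT (ker s w).
Proof. by apply: continuous_measurable_fun => t; exact: continuous_ker. Qed.

Lemma expR_quadratic_bound (K t : R) : 0 <= t -> K * t - expR t <= K ^+ 2 / 2.
Proof.
move=> t0; have := expR_geXfact 2 t0; rewrite (_ : 2`!%:R = 2 :> R)// => h.
by have := sqr_ge0 (K - t); nra.
Qed.

(** At plus infinity the double exponential beats any rate. At minus infinity the decay comes from
    exp(s t) if 0 < s, and from exp(-w exp(-t)) if 0 < w. *)
Lemma ker_le s w : 0 <= w -> (0 < s) || (0 < w) ->
  exists c C, 0 < c /\ forall t, ker s w t <= C * expR (- c * `|t|).
Proof.
move=> w0 /orP[s0|wp].
  exists s; exists (expR ((2 * s) ^+ 2 / 2)); split => // t.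
  rewrite /ker -expRD ler_expR.
  have we : 0 <= w * expR (- t) by rewrite mulr_ge0// expR_ge0.
  have [t0|t0] := leP 0 t.
    by rewrite ger0_norm//; have := expR_quadratic_bound (2 * s) t0; lra.
  rewrite ltr0_norm//; have := expR_ge0 t; have := sqr_ge0 (2 * s); lra.
exists 1; exists (expR ((s + 1) ^+ 2 / 2 + w * (((1 - s) / w) ^+ 2 / 2))); split => // t.
rewrite /ker -expRD ler_expR.
have we : 0 <= w * expR (- t) by rewrite mulr_ge0// expR_ge0.
have b1 := sqr_ge0 (s + 1).
have b2 : 0 <= w * (((1 - s) / w) ^+ 2 / 2) by rewrite mulr_ge0// divr_ge0// sqr_ge0.
have [t0|t0] := leP 0 t.
  by rewrite ger0_norm//; have := expR_quadratic_bound (s + 1) t0; lra.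
rewrite ltr0_norm//.
have tN : 0 <= - t by lra.
have := expR_quadratic_bound ((1 - s) / w) tN.
rewrite -(ler_pM2l wp) mulrBr [w * (_ / w * _)]mulrA [w * (_ / w)]mulrC divfK ?gt_eqF// => b3.
have := expR_ge0 t; lra.
Qed.

Lemma integrable_ker s w : 0 <= w -> (0 < s) || (0 < w) ->
  mu.-integrable setT (EFin \o ker s w).
Proof.
move=> w0 sw; have [c [C [c0 HC]]] := ker_le w0 sw.
apply: (@integrable_le _ _ (fun t => C * expR (- c * `|t|))) => //.
- exact: measurable_ker.
- have := integrableZl measurableT C (integrable_exp_abs c0); exact.
- by move=> t _; rewrite ger0_norm ?ker_ge0.
Qed.

Lemma ker_bound s w : 0 <= w -> (0 < s) || (0 < w) ->
  exists C, forall t, `|t| * `|ker s w t| <= C.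
Proof.
move=> w0 sw; have [c [C [c0 HC]]] := ker_le w0 sw.
exists (`|C| / c) => t; rewrite (ger0_norm (ker_ge0 _ _ _)).
apply: (@le_trans _ _ (`|t| * (`|C| * expR (- c * `|t|)))).
  rewrite ler_wpM2l// (le_trans (HC t))// ler_wpM2r ?expR_ge0// ler_norm//.
rewrite mulrCA ler_wpM2l// -[leRHS]mul1r ler_pdivlMr// mulNr expRN mulrAC.
rewrite ler_pdivrMr ?expR_gt0// mul1r mulrC.
by have := expR_ge1Dx (c * `|t|); lra.
Qed.

(* bint s w = 2 w^(s/2) K_s (2 sqrt w) for 0 < w, and bint s 0 = Gamma s. *)
Definition bint s w := (\int[mu]_t ker s w t)%R.

(** The left side is the integral of the t-derivative of [ker s w]. *)
Lemma bint_rec s w : 0 < w -> s * bint s w - bint (s + 1) w + w * bint (s - 1) w = 0.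
Proof.
move=> w0; have sw s' : (0 < s') || (0 < w) by rewrite w0 orbT.
have i s' := integrable_ker (ltW w0) (sw s').
have iZ s' c : mu.-integrable setT (EFin \o (fun t => c * ker s' w t)).
  by have := integrableZl measurableT c (i s'); exact.
have [C HC] := ker_bound (ltW w0) (sw s).
have iB : mu.-integrable setT (EFin \o (fun t => s * ker s w t - ker (s + 1) w t)).
  by have := integrableB measurableT (iZ s s) (i (s + 1)); exact.
have iD : mu.-integrable setT (EFin \o (fun t => s * ker s w t - ker (s + 1) w t + w * ker (s - 1) w t)).
  by have := integrableD measurableT iB (iZ (s - 1) w); exact.
rewrite /bint -!RintegralZl// -RintegralB// -RintegralD//.
apply: (integral_derive_line _ _ iD HC).
- by move=> t; exact: is_derive_ker_t.
- move=> t; apply: cvgD; last by apply: cvgM; [exact: cvg_cst|exact: continuous_ker].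
  apply: cvgB; last exact: continuous_ker.
  by apply: cvgM; [exact: cvg_cst|exact: continuous_ker].
Qed.

Lemma bint0_rec s : 0 < s -> bint (s + 1) 0 = s * bint s 0.
Proof.
move=> s0; have i1 : mu.-integrable setT (EFin \o ker s 0) by apply: integrable_ker; rewrite ?s0.
have i2 : mu.-integrable setT (EFin \o ker (s + 1) 0).
  by apply: integrable_ker; rewrite // addr_gt0.
have iZ : mu.-integrable setT (EFin \o (fun t => s * ker s 0 t)).
  by have := integrableZl measurableT s i1; exact.
have iB : mu.-integrable setT (EFin \o (fun t => s * ker s 0 t - ker (s + 1) 0 t)).
  by have := integrableB measurableT iZ i2; exact.
have [C HC] : exists C, forall t, `|t| * `|ker s 0 t| <= C by apply: ker_bound; rewrite ?s0.
apply/eqP; rewrite eq_sym -subr_eq0 /bint -RintegralZl// -RintegralB//; apply/eqP.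
apply: (integral_derive_line _ _ iB HC).
- by move=> t; have := is_derive_ker_t s 0 t; rewrite mul0r addr0.
- move=> t; apply: cvgB; last exact: continuous_ker.
  by apply: cvgM; [exact: cvg_cst|exact: continuous_ker].
Qed.

Lemma Rintegral_gt0 (f : R -> R) : continuous f -> (forall t, 0 < f t) ->
  mu.-integrable setT (EFin \o f) -> 0 < (\int[mu]_t f t)%R.
Proof.
move=> cf f0 i.
have [c cI fc] := EVT_min (@ler01 R) (continuous_subspaceT cf).
apply: lt_le_trans (f0 c) _.
have -> : f c = (\int[mu]_(t in `[0%R, 1%R]) f c)%R.
  by rewrite Rintegral_cst//= lebesgue_measure_itv/= lte01 oppr0 adde0 mulr1.
rewrite /Rintegral fine_le//.
- apply: integrable_fin_num => //; apply: continuous_compact_integrable; first exact: segment_compact.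
  by move=> ?; exact: cvg_cst.
- exact: integrable_fin_num.
- apply: (@le_trans _ _ (\int[mu]_(t in `[0%R, 1%R]) (f t)%:E)%E).
    apply: ge0_le_integral => //.
    + by move=> t _; rewrite lee_fin ltW.
    + by apply/measurable_EFinP; exact: measurable_funTS (continuous_measurable_fun cf).
  apply: ge0_subset_integral => //.
  + by apply/measurable_EFinP; exact: continuous_measurable_fun.
  + by move=> t _; rewrite lee_fin ltW.
Qed.

Lemma bint_gt0 s w : 0 <= w -> (0 < s) || (0 < w) -> 0 < bint s w.
Proof.
move=> w0 sw; apply: Rintegral_gt0.
- exact: continuous_ker.
- exact: ker_gt0.
- exact: integrable_ker.
Qed.

Lemma ker_le_w s w w' t : w <= w' -> ker s w' t <= ker s w t.
Proof.
move=> ww; rewrite ler_expR lerD2l lerN2 ler_wpM2r// expR_ge0//.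
Qed.

(** Differentiation under the integral sign: [ker] decreases in w, so on (w/2, 2w) the derivative is
    dominated by its value at w/2. *)
Lemma is_derive_bint s w : 0 < w -> is_derive w (1 : R) (bint s) (- bint (s - 1) w).
Proof.
move=> w0; pose f (v : R) t := ker s v t.
have I v : v \in `](w / 2), (w * 2)[ -> 0 < v.
  by rewrite in_itv/= => /andP[wv _]; apply: lt_trans wv; rewrite divr_gt0.
have Iw : `](w / 2), (w * 2)[%classic w by rewrite /= in_itv/=; apply/andP; split; lra.
have i2 : mu.-integrable setT (EFin \o ker (s - 1) (w / 2)).
  by apply: integrable_ker; rewrite ?divr_gt0 ?orbT// ltW// divr_gt0.
have dk v t : derivable (f ^~ t) v 1 by have [] := is_derive_ker_w s v t.
have dkE v t : 'D_1 (f ^~ t) v = - ker (s - 1) v t.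
  by have [] := is_derive_ker_w s v t.
have i1 v : `](w / 2), (w * 2)[%classic v -> mu.-integrable setT (EFin \o f v).
  by move=> /I v0; apply: integrable_ker; [exact: ltW|rewrite v0 orbT].
have bd v t : `](w / 2), (w * 2)[%classic v -> setT t -> `|partial1of2 f v t| <= ker (s - 1) (w / 2) t.
  move=> /= vI _; rewrite partial1of2E dkE normrN ger0_norm ?ker_ge0//.
  by apply: ker_le_w; move: vI; rewrite in_itv/= => /andP[/ltW].
have D := @derivable_under_integral _ _ _ mu f setT measurableT w (w / 2) (w * 2) Iw i1 (fun v t _ _ => dk v t)
  (ker (s - 1) (w / 2)) (fun t => ker_ge0 _ _ t) i2 bd.
have E := @differentiation_under_integral _ _ _ mu f setT measurableT w (w / 2) (w * 2) Iw i1 (fun v t _ _ => dk v t)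
  (ker (s - 1) (w / 2)) (fun t => ker_ge0 _ _ t) i2 bd.
apply: DeriveDef; first exact: D.
rewrite -derive1E [LHS]E -[RHS]mulN1r /bint -RintegralZl//; last first.
  by apply: integrable_ker; rewrite ?w0 ?orbT// ltW.
by apply: eq_Rintegral => t _; rewrite partial1of2E dkE mulN1r.
Qed.

Lemma Rintegral_opp (f : R -> R) : continuous f -> (forall t, 0 <= f t) ->
  (\int[mu]_t f (- t) = \int[mu]_t f t)%R.
Proof.
move=> cf f0; rewrite /Rintegral; congr fine.
have mf : measurable_fun setT (fun t : measurableTypeR R => (f t)%:E).
  by apply/measurable_EFinP; exact: continuous_measurable_fun.
have mN : measurable_fun setT (-%R : measurableTypeR R -> measurableTypeR R).
  exact: oppr_measurable.
rewrite [RHS](eq_measure_integral (pushforward mu (-%R : measurableTypeR R -> measurableTypeR R))); last first.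
  by move=> A mA _; exact/esym/lebesgue_measureN.
by rewrite ge0_integral_pushforward// => t; rewrite lee_fin.
Qed.

Lemma Rintegral_shift (f : R -> R) (c : R) : continuous f -> (forall t, 0 <= f t) ->
  (\int[mu]_t f (t + c) = \int[mu]_t f t)%R.
Proof.
move=> cf f0; rewrite /Rintegral; congr fine.
pose F (t : R) := t + c.
have dF (t : R) : is_derive t (1 : R) F 1 by apply: is_derive_eq; rewrite addr0.
have F'E : F^`()%classic = cst 1 by apply/funext => t; rewrite derive1E; have [] := dF t.
rewrite (@increasing_ge0_integration_by_substitutionT R F f)//.
- by rewrite F'E; apply: eq_integral => t _ /=; rewrite mulr1.
- by move=> u v uv; rewrite /F ltrD2r.
- by rewrite F'E; exact: cst_continuous.
- by rewrite F'E; exact: is_cvg_cst.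
- by rewrite F'E; exact: is_cvg_cst.
- exact: cvg_addrr_Ny.
- exact: cvg_addrr.
Qed.

(** The substitution t -> ln w - t exchanges exp t and w exp(-t). In terms of K, this is evenness in
    the order. *)
Lemma bint_sym s w : 0 < w -> bint (- s) w = w `^ (- s) * bint s w.
Proof.
move=> w0.
have E t : ker (- s) w (- (t - ln w)) = w `^ (- s) * ker s w t.
  rewrite /ker /powR gt_eqF// -expRD; congr expR.
  rewrite !opprB !expRD !expRN !lnK ?posrE//.
  have e0 : expR t != 0 by rewrite gt_eqF ?expR_gt0.
  have w1 : w != 0 by rewrite gt_eqF.
  by field; apply/andP.
have i : mu.-integrable setT (EFin \o ker s w).
  by apply: integrable_ker; [exact: ltW|rewrite w0 orbT].
rewrite /bint -RintegralZl//.
under [RHS]eq_Rintegral do rewrite -E.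
rewrite -(@Rintegral_opp (ker (- s) w)); [|exact: continuous_ker|exact: ker_ge0].
rewrite -(@Rintegral_shift (fun t => ker (- s) w (- t)) (- ln w))//.
- move=> t; apply: (@cvg_comp _ _ _ -%R (ker (- s) w) _ (nbhs (- t))).
    exact: opp_continuous.
  exact: continuous_ker.
- by move=> t; exact: ker_ge0.
Qed.

(** From w^p exp(-p t) <= p! exp(w exp(-t)) one gets w^p [ker s w] <= p! [ker (s + p) 0] pointwise.
    Here p is at least m, and so large that s + p > 0 makes the right side integrable. *)
Lemma bint_decay s (c : R) m : 0 < c -> exists C, forall w, c <= w -> w ^+ m * bint s w <= C.
Proof.
move=> c0.
pose p := (m + (Num.bound `|s|).+1)%N.
have sp : 0 < s + p%:R.
  rewrite /p natrD -addn1 natrD; have := archi_boundP (normr_ge0 s).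
  by have := ler_norm (- s); rewrite normrN; have : 0 <= m%:R :> R by []; lra.
have ip : mu.-integrable setT (EFin \o ker (s + p%:R) 0) by apply: integrable_ker; rewrite ?sp.
exists (p`!%:R * bint (s + p%:R) 0 / c ^+ (p - m)) => w cw.
have w0 : 0 < w by exact: lt_le_trans cw.
have iw : mu.-integrable setT (EFin \o ker s w).
  by apply: integrable_ker; [exact: ltW|rewrite w0 orbT].
rewrite ler_pdivlMr ?exprn_gt0//.
apply: (@le_trans _ _ (w ^+ p * bint s w)).
  have -> : w ^+ p = w ^+ m * w ^+ (p - m) by rewrite -exprD subnKC// /p leq_addr.
  rewrite mulrAC ler_wpM2r//.
    by rewrite ltW// bint_gt0 ?w0 ?orbT// ltW.
  rewrite ler_wpM2l ?exprn_ge0//; first exact: ltW.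
  by rewrite lerXn2r// nnegrE ltW.
rewrite /bint -RintegralZl// -RintegralZl//.
apply: le_Rintegral => //.
- by have := integrableZl measurableT (w ^+ p) iw; exact.
- by have := integrableZl measurableT (p`!%:R) ip; exact.
move=> t _; rewrite /ker mul0r subr0.
have := expR_geXfact p (mulr_ge0 (ltW w0) (expR_ge0 (- t))).
rewrite exprMn => H.
have -> : expR (s * t - expR t - w * expR (- t)) =
   expR (s * t - expR t) * (expR (- t) ^+ p * expR t ^+ p) / expR (w * expR (- t)).
  by rewrite -exprMn -expRD addNr expR0 expr1n mulr1 expRD expRN.
have -> : expR ((s + p%:R) * t - expR t) = expR (s * t - expR t) * expR t ^+ p.
  rewrite -expRM_natl -expRD; congr expR; ring.
rewrite mulrA ler_pdivrMr ?expR_gt0//.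
rewrite (_ : _ * _ = expR (s * t - expR t) * expR t ^+ p * (w ^+ p * expR (- t) ^+ p)); last by ring.
rewrite [leRHS](_ : _ = expR (s * t - expR t) * expR t ^+ p * (p`!%:R * expR (w * expR (- t)))); last by ring.
by rewrite ler_wpM2l// mulr_ge0 ?exprn_ge0// expR_ge0.
Qed.

Lemma bint_continuous_s s w : 0 <= w -> (0 < s) || (0 < w) -> {for s, continuous (bint ^~ w)}.
Proof.
move=> w0 sw.
have [e [e0 He]] : exists e, 0 < e /\ forall s', s - e <= s' -> (0 < s') || (0 < w).
  case/orP: sw => [s0|->]; last by exists 1; split => // s' _; rewrite orbT.
  by exists (s / 2); split; [rewrite divr_gt0|move=> s' ss; apply/orP; left; lra].
have ig : mu.-integrable setT (EFin \o (fun t => ker (s - e) w t + ker (s + e) w t)).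
  have i1 : mu.-integrable setT (EFin \o ker (s - e) w) by apply: integrable_ker => //; exact: He.
  have i2 : mu.-integrable setT (EFin \o ker (s + e) w) by apply: integrable_ker => //; apply: He; lra.
  by have := integrableD measurableT i1 i2; exact.
have sI : s \in `](s - e), (s + e)[ by rewrite in_itv/=; apply/andP; split; lra.
have H := @continuity_under_integral _ _ _ mu (fun s t => ker s w t) setT measurableT (s - e) (s + e) _ _
   (fun t => ker (s - e) w t + ker (s + e) w t) ig _.
apply: H; last by rewrite inE.
- by move=> v /=; rewrite in_itv/= => /andP[v1 v2]; apply: integrable_ker => //; apply: He; exact: ltW.
- apply: aeW => t _ v _.
  apply: differentiable_continuous; apply/derivable1_diffP.
  have -> : (fun s0 => ker s0 w t) = fun s0 => expR (t * s0 + (- expR t - w * expR (- t))).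
    by apply/funext => z; rewrite /ker; congr expR; ring.
  by [].
- move=> v /=; rewrite in_itv/= => /andP[v1 v2]; apply: aeW => t _.
  rewrite ger0_norm ?ker_ge0//; have [t0|t0] := leP 0 t.
    rewrite (le_trans _ (_ : ker (s + e) w t <= _))//; last by rewrite lerDr ker_ge0.
    by rewrite ler_expR !lerD2r ler_wpM2r// ltW.
  rewrite (le_trans _ (_ : ker (s - e) w t <= _))//; last by rewrite lerDl ker_ge0.
  by rewrite ler_expR !lerD2r ler_wnM2r// ltW.
Qed.

Lemma bint_cvg0 s : 0 < s -> bint s w @[w --> 0^'+] --> bint s 0.
Proof.
move=> s0.
have i0 : mu.-integrable setT (EFin \o ker s 0) by apply: integrable_ker; rewrite ?s0.
(* The absolute value makes the integrand meaningful on both sides of 0, as continuity under the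
   integral is stated on an open interval. *)
have c0 : {for 0, continuous (fun w : R => bint s `|w|)}.
  have zI : (0 : R) \in `](-1), 1[ by rewrite in_itv/= ltrN10 ltr01.
  have H := @continuity_under_integral _ _ _ mu (fun w t => ker s `|w| t) setT measurableT (-1) 1 _ _ (ker s 0) i0 _.
  apply: H; last by rewrite inE.
  - by move=> v _; apply: integrable_ker; rewrite ?s0.
  - apply: aeW => t _ v _.
    apply: (@cvg_comp _ _ _ (fun w : R => `|w|) (fun w => ker s w t) _ (nbhs `|v|)).
      exact: norm_continuous.
    have [dk _] := is_derive_ker_w s `|v| t.
    have c : {for `|v|, continuous (fun w => ker s w t)}.
      by apply: differentiable_continuous; apply/derivable1_diffP.
    exact: c.
  - move=> v _; apply: aeW => t _; rewrite ger0_norm ?ker_ge0//.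
    exact: ker_le_w.
have := cvg_at_right_filter c0; rewrite normr0; apply: cvg_trans; apply: near_eq_cvg.
by near=> w; rewrite gtr0_norm.
Unshelve. all: by end_near. Qed.

End BesselIntegral.

(** * The Gamma function and its reciprocal *)

Section GammaFunction.
Context (R : realType).
Local Notation mu := (@lebesgue_measure R).
Implicit Types s w t : R.

(** Substitution by the exponential on the segments from exp(-n) to exp n, then monotone convergence
    on both sides. *)
Lemma euler_integral_bint s : 0 < s -> euler_integral s = bint s 0.
Proof.
move=> s0; rewrite /euler_integral /bint /Rintegral; congr fine.
pose G (t : R) := t `^ (s - 1) * expR (- t).
have dG (t : R) : 0 < t -> derivable G t 1.
  by move=> t0; apply: derivableM => //; apply: derivable_powR; rewrite in_itv/= t0.
have cG (t : R) : 0 < t -> {for t, continuous G}.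
  move=> t0; apply: differentiable_continuous; apply/derivable1_diffP; exact: dG.
have dE : (@expR R)^`()%classic = expR.
  by apply/funext => t; rewrite derive1E; case: (is_derive_expR t).
have subst (n : nat) : (\int[mu]_(t in `[expR (- n%:R)%R, expR n%:R]) (G t)%:E =
    \int[mu]_(t in `[(- n%:R)%R, n%:R%R]) (ker s 0 t)%:E)%E.
  rewrite (@integration_by_substitution_increasing R expR G)//.
  - apply: eq_integral => t _; rewrite dE /= /G /ker mul0r subr0.
    rewrite !fctE /= /powR gt_eqF ?expR_gt0// expRK -!expRD; congr (expR _)%:E; ring.
  - by rewrite (@le_trans _ _ 0) ?oppr_le0.
  - by move=> t u _ _; rewrite ltr_expR.
  - by rewrite dE => t _; exact: continuous_expR.
  - by rewrite dE; apply: (cvgP (expR (- n%:R))); apply: cvg_at_right_filter; exact: continuous_expR.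
  - by rewrite dE; apply: (cvgP (expR n%:R)); apply: cvg_at_left_filter; exact: continuous_expR.
  - split => //.
    + by apply: cvg_at_right_filter; exact: continuous_expR.
    + by apply: cvg_at_left_filter; exact: continuous_expR.
  - apply: continuous_in_subspaceT => t; rewrite inE/= in_itv/= => /andP[t0 _].
    by apply: cG; apply: lt_le_trans t0; exact: expR_gt0.
have nn : forall i j : nat, (i <= j)%N -> (i%:R <= j%:R :> R) by move=> i j; rewrite ler_nat.
have U1 : \bigcup_n `[expR (- n%:R), expR n%:R]%classic = `]0, +oo[%classic :> set R.
  apply/seteqP; split => t /=.
    by move=> [n _] /=; rewrite !in_itv/= andbT => /andP[+ _]; apply: lt_le_trans; exact: expR_gt0.
  rewrite in_itv/= andbT => t0; have := archi_boundP (normr_ge0 (ln t)).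
  set n := Num.bound _ => tn; exists n => //=; rewrite in_itv/= -{1 2}(lnK t0) !ler_expR -ler_norml.
  exact: ltW.
have U2 : \bigcup_(n : nat) `[- n%:R, n%:R]%classic = setT :> set R.
  apply/seteqP; split => t //= _; have := archi_boundP (normr_ge0 t).
  by set n := Num.bound _ => tn; exists n => //=; rewrite in_itv/= -ler_norml ltW.
have mG : measurable_fun setT G.
  apply: measurable_funM; first exact: measurable_powR.
  by apply: measurableT_comp => //; exact: measurable_oppr.
have c1 : (\int[mu]_(t in `[expR (- n%:R)%R, expR n%:R]) (G t)%:E)%E @[n --> \oo] -->
    (\int[mu]_(t in \bigcup_n `[expR (- n%:R)%R, expR n%:R]%classic) (G t)%:E)%E.
  apply: ge0_nondecreasing_set_cvg_integral.
  - apply/nondecreasing_seqP => n; apply/subsetPset => t /=; rewrite !in_itv/= => /andP[a b].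
    by rewrite (le_trans _ a) ?(le_trans b)// ler_expR ?lerN2 nn.
  - by [].
  - by move=> n; apply/measurable_EFinP; exact: measurable_funTS.
  - by move=> n t _; rewrite lee_fin mulr_ge0 ?powR_ge0 ?expR_ge0.
have c2 : (\int[mu]_(t in `[(- n%:R)%R, n%:R%R]) (ker s 0 t)%:E)%E @[n --> \oo] -->
    (\int[mu]_(t in \bigcup_(n : nat) `[(- n%:R)%R, n%:R%R]%classic) (ker s 0 t)%:E)%E.
  apply: ge0_nondecreasing_set_cvg_integral.
  - apply/nondecreasing_seqP => n; apply/subsetPset => t /=; rewrite !in_itv/= => /andP[a b].
    by rewrite (le_trans _ a) ?(le_trans b)// ?lerN2 nn.
  - by [].
  - by move=> n; apply/measurable_EFinP; apply: measurable_funTS; exact: measurable_ker.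
  - by move=> n t _; rewrite lee_fin ker_ge0.
rewrite -U1 -U2; apply: (cvg_unique (@ereal_hausdorff R) c1).
by rewrite /= (funext subst).
Qed.

Lemma Gamma_bint s : 0 < s -> Gamma s = bint s 0.
Proof. by move=> s0; rewrite /Gamma s0 euler_integral_bint. Qed.

Lemma Gamma_gt0 s : 0 < s -> 0 < Gamma s.
Proof. by move=> s0; rewrite Gamma_bint// bint_gt0// s0. Qed.

Lemma GammaS s : 0 < s -> Gamma (s + 1) = s * Gamma s.
Proof. by move=> s0; rewrite !Gamma_bint ?addr_gt0// bint0_rec. Qed.

Definition rGamma s : R := (Gamma s)^-1.

(* No condition on s: both sides vanish at the poles of Gamma. *)
Lemma rGamma_rec s : rGamma s = s * rGamma (s + 1).
Proof.
rewrite /rGamma; have [s0|s0] := ltP 0 s.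
  by rewrite GammaS// invfM mulrA divff ?mul1r// gt_eqF.
rewrite /Gamma ltNge s0/= [0 < s + 1]ltNge.
have sN : 0 <= - s by rewrite oppr_ge0.
have [s1|s1] /= := leP (s + 1) 0.
  have -> : Num.truncn (- s) = (Num.truncn (- (s + 1))).+1.
    apply: truncn_def; have : 0 <= - (s + 1) by lra.
    by move=> /truncn_itv /andP[a b]; rewrite -![in _.+1%:R]natr1; apply/andP; split; lra.
  set m := (Num.truncn (- (s + 1))).+1.
  rewrite big_ord_recl/= addr0 !invf_div mulrAC mulrA.
  rewrite (eq_bigr (fun i : 'I_m => s + 1 + i%:R)); last first.
    by move=> i _; rewrite /bump/= natrD addrA.
  have -> : s + m.+1%:R = s + 1 + m%:R by rewrite -natr1; ring.
  by rewrite mulrAC.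
have -> : Num.truncn (- s) = 0%N by apply: truncn_def; apply/andP; split; lra.
by rewrite big_ord_recl big_ord0 addr0 mulr1 invf_div.
Qed.

Lemma rGamma_gt0 s : 0 < s -> 0 < rGamma s.
Proof. by move=> s0; rewrite invr_gt0 Gamma_gt0. Qed.

Lemma rGamma1 : rGamma 1 = 1.
Proof.
rewrite /rGamma /Gamma ltr01 /euler_integral /Rintegral.
suff -> : (\int[mu]_(t in `]0%R, +oo[) (t `^ (1 - 1) * expR (- t))%:E)%E = 1%E by rewrite invr1.
rewrite -(@integral_exponential_pdf R 1)//.
rewrite (_ : (fun x => (exponential_pdf 1 x)%:E) =
    (EFin \o (fun t : R => t `^ (1 - 1) * expR (- t))) \_ `[0, +oo[); last first.
  apply/funext => t; rewrite patchE /=; case: ifPn => t0.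
    rewrite exponential_pdfE; last by move: t0; rewrite inE/= in_itv/= andbT.
    by rewrite subrr powRr0 mulN1r.
  rewrite lt0_exponential_pdf//; move: t0; rewrite notin_setE/= in_itv/= andbT => /negP.
  by rewrite -ltNge.
rewrite -integral_mkcond integral_itv_obnd_cbnd//.
apply/measurable_EFinP; apply: measurable_funM.
  by apply: measurable_funTS; exact: measurable_powR.
by apply: measurable_funTS; apply: measurableT_comp => //; exact: measurableT_comp.
Qed.
Lemma rGamma_decr s (k : nat) : 1 <= s -> rGamma (s + k%:R) <= rGamma s.
Proof.
move=> s1; elim: k => [|k IH]; first by rewrite addr0.
apply: le_trans IH; rewrite [leRHS]rGamma_rec -natr1 addrA ler_peMl//.
  by rewrite ltW// rGamma_gt0//; have : 0 <= k%:R :> R by []; lra.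
by have : 0 <= k%:R :> R by []; lra.
Qed.

Lemma rGamma_bounded s : exists C, forall k : nat, `|rGamma (s + k%:R)| <= C.
Proof.
pose m := (Num.bound `|s|).+1.
have sm : 1 <= s + m%:R.
  rewrite /m -natr1; have := archi_boundP (normr_ge0 s); have := ler_norm (- s); rewrite normrN; lra.
exists (rGamma (s + m%:R) + \sum_(i < m) `|rGamma (s + i%:R)|) => k.
have p0 : 0 < rGamma (s + m%:R) by rewrite rGamma_gt0; lra.
have [km|km] := ltnP k m.
  rewrite (bigD1 (Ordinal km))//= addrCA lerDl addr_ge0 ?sumr_ge0//; exact: ltW.
rewrite -(subnKC km) natrD addrA ler_wpDr ?sumr_ge0// ger0_norm; first exact: rGamma_decr.
by rewrite ltW// rGamma_gt0//; have : 0 <= (k - m)%:R :> R by []; lra.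
Qed.

End GammaFunction.

(** * The power series of I and its connection with the integral *)

Section BesselSeries.
Context (R : realType).
Implicit Types rho s w z : R.

Definition bcoef rho (k : nat) : R := rGamma (rho + k%:R + 1) / k`!%:R.

Lemma is_cvg_bcoef rho w : cvgn (pseries (bcoef rho) w).
Proof.
have [C HC] := rGamma_bounded (rho + 1).
apply: normed_cvg; apply: (@series_le_cvg _ _ (fun k => C * exp_coeff `|w| k)).
- by move=> k /=.
- by move=> k; rewrite mulr_ge0 ?exp_coeff_ge0// (le_trans _ (HC 0%N)).
- move=> k /=; rewrite /bcoef normrM normrM normrX /exp_coeff/= [`|k`!%:R^-1|]ger0_norm ?invr_ge0//.
  rewrite mulrAC mulrA ler_wpM2r ?invr_ge0// ler_wpM2r ?exprn_ge0//.
  by rewrite addrAC HC.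
- by rewrite -[X in cvgn (series X)]/(C *: exp_coeff `|w|); apply: is_cvg_seriesZ; exact: is_cvg_series_exp_coeff.
Qed.

(* The entire function for which I_rho (z) = (z/2)^rho bser rho (z^2/4). *)
Definition bser rho w : R := limn (pseries (bcoef rho) w).

Lemma bcoef_diffs rho : pseries_diffs (bcoef rho) = bcoef (rho + 1).
Proof.
apply/funext => k; rewrite /pseries_diffs /bcoef factS natrM invfM mulrCA.
rewrite [k.+1%:R * _]mulrA divff ?mul1r ?pnatr_eq0//.
by rewrite -natr1 addrA [rho + _ + 1]addrAC.
Qed.

Lemma is_derive_bser rho w : is_derive w (1 : R) (bser rho) (bser (rho + 1) w).
Proof.
rewrite /bser -bcoef_diffs.
apply: (@pseries_snd_diffs _ (bcoef rho) (`|w| + 1)).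
- exact: is_cvg_bcoef.
- by rewrite bcoef_diffs; exact: is_cvg_bcoef.
- by rewrite !bcoef_diffs; exact: is_cvg_bcoef.
- by rewrite [ltRHS]ger0_norm ?addr_ge0// ltrDl.
Qed.

Lemma bser_continuous rho : continuous (bser rho).
Proof.
move=> w; apply: differentiable_continuous; apply/derivable1_diffP.
by have [] := is_derive_bser rho w.
Qed.

(** Coefficientwise it is [rGamma_rec] at rho + k: the part rho gives the first term, and the part k
    gives w times the derivative, whose order is shifted by one. It holds for all rho since
    [rGamma_rec] survives at the poles. *)
Lemma bser_rec rho w : bser (rho - 1) w = rho * bser rho w + w * bser (rho + 1) w.
Proof.
apply: (@cvg_lim _ (@Rhausdorff R)).
have D : cvgn (pseries (pseries_diffs (bcoef rho)) w) by rewrite bcoef_diffs; exact: is_cvg_bcoef.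
have := pseries_diffs_equiv D; rewrite bcoef_diffs -/(bser _ _) => D2.
have -> : pseries (bcoef (rho - 1)) w = (fun N => rho * pseries (bcoef rho) w N +
    w * series (fun i => i%:R * bcoef rho i * w ^+ i.-1) N).
  apply/funext => N; rewrite /pseries/series/= !mulr_sumr -big_split/=.
  apply: eq_bigr => k _; rewrite /bcoef.
  rewrite (_ : rho - 1 + k%:R + 1 = rho + k%:R); last by ring.
  rewrite [rGamma (rho + k%:R)]rGamma_rec.
  case: k => [|k]/=; first by rewrite !addr0 mul0r mul0r mulr0 addr0 -!mulrA.
  rewrite exprS; ring.
by apply: cvgD; apply: cvgM; [exact: cvg_cst|exact: is_cvg_bcoef|exact: cvg_cst|exact: D2].
Qed.

Lemma bser0 rho : bser rho 0 = rGamma (rho + 1).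
Proof.
apply: (@cvg_lim _ (@Rhausdorff R)); apply: cvg_near_cst; near=> N.
have N0 : (0 < N)%N by near: N; exact: nbhs_infty_gt.
rewrite /pseries/series/= -(prednK N0) big_nat_recl//= big1 ?addr0; last first.
  by move=> i _; rewrite expr0n/= mulr0.
by rewrite expr0 mulr1 /bcoef addr0 fact0 divr1.
Unshelve. all: by end_near. Qed.

Lemma bcoef_ge0 rho k : -1 < rho -> 0 <= bcoef rho k.
Proof.
move=> r1; rewrite divr_ge0// ltW// rGamma_gt0//.
have : 0 <= k%:R :> R by []; lra.
Qed.

Lemma bser_gt0 rho w : -1 < rho -> 0 <= w -> 0 < bser rho w.
Proof.
move=> r1 w0; apply: (@lt_le_trans _ _ (rGamma (rho + 1))); first by rewrite rGamma_gt0; lra.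
apply: limr_ge; first exact: is_cvg_bcoef.
near=> N.
have N0 : (0 < N)%N by near: N; exact: nbhs_infty_gt.
rewrite /pseries/series/= -(prednK N0) big_nat_recl//= expr0 mulr1.
rewrite {1}/bcoef addr0 fact0 divr1 lerDl sumr_ge0// => i _.
by rewrite mulr_ge0 ?exprn_ge0// bcoef_ge0.
Unshelve. all: by end_near. Qed.

Lemma bser_le rho w : 0 <= rho -> 0 <= w -> bser rho w <= rGamma (rho + 1) * expR w.
Proof.
move=> r0 w0; apply: (@ler_cvg_to nat \oo _ R (pseries (bcoef rho) w)
  (fun N => rGamma (rho + 1) * series (exp_coeff w) N)); first exact: is_cvg_bcoef.
- apply: cvgM; first exact: cvg_cst.
  by rewrite /expR; exact: is_cvg_series_exp_coeff.
- near=> N; rewrite /pseries/series/= mulr_sumr ler_sum// => k _.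
  rewrite /bcoef /exp_coeff/= mulrAC mulrA ler_wpM2r ?invr_ge0// ler_wpM2r ?exprn_ge0//.
  by rewrite addrAC rGamma_decr// lerDr.
Unshelve. all: by end_near. Qed.

Lemma besselI_bser rho z : 0 < z -> besselI rho z = (z / 2) `^ rho * bser rho ((z / 2) ^+ 2).
Proof.
move=> z0; have z2 : 0 < z / 2 by rewrite divr_gt0.
apply: (@cvg_lim _ (@Rhausdorff R)).
rewrite (_ : series _ = fun N => (z / 2) `^ rho * pseries (bcoef rho) ((z / 2) ^+ 2) N).
  by apply: cvgM; [exact: cvg_cst|exact: is_cvg_bcoef].
apply/funext => N; rewrite /pseries/series/= mulr_sumr; apply: eq_bigr => k _.
rewrite powRD; last by apply/implyP => _; rewrite gt_eqF.
rewrite -natrM powR_mulrn ?ltW// exprM /bcoef /rGamma -!mulrA; congr (_ * _).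
by rewrite invfM mulrC -mulrA mulrCA.
Qed.

Lemma const_from_right0 (f : R -> R) (l : R) : (forall w, 0 < w -> is_derive w (1 : R) f 0) ->
  f w @[w --> 0^'+] --> l -> forall w, 0 < w -> f w = l.
Proof.
move=> df fl w w0.
suff H : f v @[v --> 0^'+] --> f w by exact: (cvg_unique (@Rhausdorff R) H fl).
apply: cvg_near_cst; near=> v.
have v0 : 0 < v by near: v; exact: nbhs_right_gt.
have vw : v <= w by near: v; exact: nbhs_right_le.
apply: esym; apply/eqP; rewrite -subr_eq0; apply/eqP.
have [| |c _ ->] := @MVT_segment R f (cst 0) v w vw; last by rewrite mul0r.
- by move=> u; rewrite in_itv/= => /andP[vu _]; apply: df; exact: lt_trans vu.
- apply: derivable_within_continuous => u; rewrite in_itv/= => /andP[vu _].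
  by have [] := df u (lt_le_trans v0 vu).
Unshelve. all: by end_near. Qed.

Section Connection.
Variable s : R.
Hypotheses (s0 : 0 < s) (s1 : s < 1).
Local Notation gg := (Gamma s * Gamma (1 - s)).

Let bN (t w : R) : 0 < w -> bint (- t) w = w `^ (- t) * bint t w.
Proof. exact: bint_sym. Qed.

Let powR_bint w : 0 < w -> w * bint (- s) w = w `^ (1 - s) * bint s w.
Proof.
move=> w0; rewrite bN// powRD; last by apply/implyP => _; rewrite gt_eqF.
by rewrite powRr1 ?ltW// mulrA.
Qed.

(* w^(1 - s) times the Wronskian of bser (- s) and bint s + gg w^s bser s; it is
   constant because both functions solve w f'' + (1 - s) f' = f. *)
Let wronskian w := bser (- s) w * (gg * bser (s - 1) w - bint (1 - s) w) -
  w * (bser (1 - s) w * (bint (- s) w + gg * bser s w)).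

Let wronskian0 w : 0 < w -> wronskian w = 0.
Proof.
apply: const_from_right0 => {w} [w w0|].
  have d1 (rho : R) := is_derive_bser rho w.
  have d2 (t : R) := @is_derive_bint R t w w0.
  apply: is_derive_eq; rewrite /GRing.scale/=.
  have r1 := bser_rec (1 - s) w; have r2 := bser_rec s w; have r3 := bint_rec (- s) w0.
  rewrite (_ : 1 - s - 1 = - s) in r1 *; last by ring.
  rewrite (_ : - s + 1 = 1 - s) in r3 *; last by ring.
  rewrite (_ : s - 1 + 1 = s); last by ring.
  move: r1 r2 r3; move: (bser (1 - s + 1) w) (bser (s + 1) w) (bint (- s - 1) w).
  move: (bser (- s) w) (bser (s - 1) w) (bser (1 - s) w) (bint (- s) w) (bser s w) (bint (1 - s) w).
  move=> a b c e f g x y z -> -> r3.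
  have -> : g = - s * e + w * z by lra.
  ring.
have c0 rho : bser rho w @[w --> 0^'+] --> rGamma (rho + 1).
  by rewrite -bser0; apply: cvg_at_right_filter; exact: bser_continuous.
have t0 : 0 < 1 - s by rewrite subr_gt0.
have L0 : rGamma (- s + 1) * (gg * rGamma (s - 1 + 1) - Gamma (1 - s)) -
   (0 * Gamma s * rGamma (1 - s + 1) + 0 * (rGamma (1 - s + 1) * (gg * rGamma (s + 1)))) = 0.
  by rewrite subrK /rGamma mulrAC divff ?mul1r ?subrr ?mulr0 ?mul0r ?addr0 ?subrr// gt_eqF// Gamma_gt0.
(* At 0 [bint (- s)] blows up but w times it does not: rewritten with [bint s], it carries the
   factor w^(1-s), which tends to 0. The constant [gg] is what makes the remaining limit vanish. *)
have E : {near 0^'+, (fun w => bser (- s) w * (gg * bser (s - 1) w - bint (1 - s) w) -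
   (w `^ (1 - s) * bint s w * bser (1 - s) w + w * (bser (1 - s) w * (gg * bser s w)))) =1 wronskian}.
  near=> w; have w0 : 0 < w by near: w; exact: nbhs_right_gt.
  by rewrite /wronskian -powR_bint//; ring.
rewrite -[X in _ --> X]L0.
apply: cvg_trans; first exact: (near_eq_cvg E).
apply: cvgB.
  apply: cvgM; first exact: c0.
  apply: cvgB; first by apply: cvgM; [exact: cvg_cst|exact: c0].
  by rewrite Gamma_bint//; exact: bint_cvg0.
apply: cvgD.
  apply: cvgM; last exact: c0.
  apply: cvgM; first exact: powR_cvg0.
  by rewrite Gamma_bint//; exact: bint_cvg0.
apply: cvgM; first exact: cvg_at_right_filter.
apply: cvgM; first exact: c0.
by apply: cvgM; [exact: cvg_cst|exact: c0].
Unshelve. all: by end_near. Qed.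

(** The quotient [Q] below has derivative w^(s-1) times the Wronskian over a square, that is 0; its
    limit at 0 is [gg]. *)
Lemma bint_bser w : 0 < w -> bint s w = gg * (bser (- s) w - w `^ s * bser s w).
Proof.
have up w' : 0 <= w' -> 0 < bser (- s) w' by move=> ?; apply: bser_gt0 => //; rewrite ltrN2.
move=> w0.
suff Q : (bint s w + gg * (w `^ s * bser s w)) / bser (- s) w = gg.
  have u0 := up w (ltW w0).
  have -> : bint s w = (bint s w + gg * (w `^ s * bser s w)) / bser (- s) w * bser (- s) w - gg * (w `^ s * bser s w).
    by rewrite divfK ?gt_eqF//; ring.
  by rewrite Q; ring.
move: w w0; apply: (@const_from_right0 (fun w => (bint s w + gg * (w `^ s * bser s w)) / bser (- s) w)) => [w w0|].
  have d1 (rho : R) := is_derive_bser rho w.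
  have d2 (t : R) := @is_derive_bint R t w w0.
  have d3 := is_derive1_powR s w0.
  have u0 : bser (- s) w != 0 by rewrite gt_eqF// up// ltW.
  apply: is_derive_eq; rewrite /GRing.scale/=.
  have W := wronskian0 w0; rewrite /wronskian in W.
  have r2 := bser_rec s w.
  have b1 : bint (s - 1) w = w `^ (s - 1) * bint (1 - s) w.
    by rewrite -[s - 1]opprB bN.
  have b2 : bint s w = w `^ (s - 1) * (w * bint (- s) w).
    rewrite powR_bint// mulrA -powRD; last by apply/implyP => _; rewrite gt_eqF.
    by rewrite (_ : s - 1 + (1 - s) = 0) ?powRr0 ?mul1r//; ring.
  have b3 : w `^ s = w `^ (s - 1) * w.
    rewrite -[X in _ * X]powRr1 ?ltW// -powRD ?subrK//; apply/implyP => _; rewrite gt_eqF//.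
  rewrite (_ : - s + 1 = 1 - s); last by ring.
  rewrite b1 b2 b3.
  apply: (mulIf u0); apply: (mulIf u0); rewrite !mul0r.
  transitivity (w `^ (s - 1) * 0); last by rewrite mulr0.
  rewrite -W r2; field.
  exact: u0.
have c0 rho : bser rho w @[w --> 0^'+] --> rGamma (rho + 1).
  by rewrite -bser0; apply: cvg_at_right_filter; exact: bser_continuous.
have L0 : (Gamma s + gg * (0 * rGamma (s + 1))) / rGamma (- s + 1) = gg.
  by rewrite mul0r mulr0 addr0 /rGamma invrK [- s + 1]addrC.
rewrite -[X in _ --> X]L0.
apply: cvgM.
  apply: cvgD; first by rewrite Gamma_bint//; exact: bint_cvg0.
  apply: cvgM; first exact: cvg_cst.
  by apply: cvgM; [exact: powR_cvg0|exact: c0].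
apply: cvgV; last exact: c0.
by rewrite gt_eqF// rGamma_gt0// addrC subr_gt0.
Qed.

End Connection.

End BesselSeries.

(** * From the difference quotient to the integral, for every order *)

Section BesselK.
Context (R : realType).
Implicit Types rho s w z : R.

(** At w = (z/2)^2 this is (z/2)^(-rho) times I_(-rho)(z) - I_rho(z). In this normalization
    differentiation in w raises rho by 1. *)
Definition bdiff rho w := w `^ (- rho) * bser (- rho) w - bser rho w.

(* By the reflection formula this is sin (rho * pi) / pi; all that matters is
   that both functions change sign when rho increases by 1. *)
Definition reflection rho : R := rGamma rho * rGamma (1 - rho).

Lemma reflectionS rho : reflection (rho + 1) = - reflection rho.
Proof.
rewrite /reflection [rGamma rho]rGamma_rec (_ : 1 - (rho + 1) = - rho); last by ring.
by rewrite [rGamma (- rho)]rGamma_rec [- rho + 1]addrC; ring.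
Qed.

Lemma reflectionN rho : reflection (- rho) = - reflection rho.
Proof.
rewrite /reflection opprK [rGamma (- rho)]rGamma_rec [rGamma rho]rGamma_rec.
by rewrite [- rho + 1]addrC [rho + 1]addrC; ring.
Qed.

Lemma reflectionE rho : reflection rho = rho * (rGamma (1 + rho) * rGamma (1 - rho)).
Proof. by rewrite /reflection [rGamma rho]rGamma_rec -mulrA addrC. Qed.

Lemma is_derive_bdiff rho w : 0 < w -> is_derive w (1 : R) (bdiff rho) (bdiff (rho + 1) w).
Proof.
move=> w0.
have d1 t := is_derive_bser t w.
have d2 := is_derive1_powR (- rho) w0.
apply: is_derive_eq; rewrite /GRing.scale/= /bdiff.
have r := bser_rec (- rho) w.
rewrite (_ : - (rho + 1) = - rho - 1); last by ring.
have b : w `^ (- rho) = w `^ (- rho - 1) * w.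
  by rewrite -[X in _ * X]powRr1 ?ltW// -powRD ?subrK//; apply/implyP => _; rewrite gt_eqF.
by rewrite r b; ring.
Qed.

(** For positive s this restates [bint_bser]. Negative s is included because integer orders are
    approached from both sides. *)
Lemma bdiff_bint0 s w : -1 < s -> s < 1 -> s != 0 -> 0 < w ->
  bdiff s w = reflection s * bint (- s) w.
Proof.
have pos (t : R) : 0 < t -> t < 1 -> bdiff t w = reflection t * bint (- t) w /\
    bdiff (- t) w = reflection (- t) * bint t w \/ w <= 0.
  move=> t0 t1; have [w0|w0] := ltP 0 w; last by right.
  left; have g0 : Gamma t * Gamma (1 - t) != 0.
    by rewrite mulf_neq0// gt_eqF// Gamma_gt0// subr_gt0.
  have E : bser (- t) w - w `^ t * bser t w = reflection t * bint t w.
    by rewrite (bint_bser t0 t1 w0) mulrA /reflection /rGamma -invfM mulVf// mul1r.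
  have p : w `^ (- t) * w `^ t = 1.
    by rewrite -powRD ?addNr ?powRr0//; apply/implyP => _; rewrite gt_eqF.
  split; last first.
    by rewrite reflectionN mulNr -E /bdiff opprK; ring.
  rewrite bint_sym// mulrCA -E mulrBr mulrA p mul1r//.
move=> s1 s2 s0 w0; have [sp|sn|/eqP] := ltrgtP 0 s; last by rewrite eq_sym (negPf s0).
  by have [[-> //]|] := pos s sp s2; rewrite leNgt w0.
have [||[_]|] := pos (- s); [by rewrite oppr_gt0|by rewrite ltrNl|by rewrite opprK|by rewrite leNgt w0].
Qed.

(** Differentiating the identity in w raises the order by 1 on both sides; the sign from
    [is_derive_bint] is matched by [reflectionS]. *)
Lemma bdiff_bint (n : nat) s w : -1 < s -> s < 1 -> s != 0 -> 0 < w ->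
  bdiff (s + n%:R) w = reflection (s + n%:R) * bint (- (s + n%:R)) w.
Proof.
move=> s1 s2 s0; elim: n w => [|n IH] w w0; first by rewrite addr0 bdiff_bint0.
rewrite -natr1 addrA; set rho := s + n%:R in IH *.
have d1 := is_derive_bdiff rho w0; have d2 := is_derive_bint (- rho) w0.
have d3 : is_derive w (1 : R) (bdiff rho) (reflection rho * (- bint (- rho - 1) w)).
  have d4 : is_derive w (1 : R) (fun w => reflection rho * bint (- rho) w)
      (reflection rho * (- bint (- rho - 1) w)).
    by apply: is_derive_eq; rewrite /GRing.scale/=; ring.
  apply: near_eq_is_derive d4.
  near=> v; rewrite IH//; near: v; exact: lt_nbhsr.
have [_ <-] := d1; have [_ ->] := d3.
by rewrite reflectionS [in RHS]opprD [LHS]mulrN [RHS]mulNr.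
Unshelve. all: by end_near. Qed.

(** Off the integers this is 1/2 by the reflection formula. What is used is its period 1, that it
    does not vanish on (0, 1), and its limit at 0. *)
Definition besselK_const rho : R := pi / 2 * (reflection rho / sin (rho * pi)).

Lemma besselK_constS (n : nat) rho : besselK_const (rho + n%:R) = besselK_const rho.
Proof.
elim: n => [|n IH]; first by rewrite addr0.
rewrite -IH /besselK_const -[n.+1%:R]natr1 addrA reflectionS [(_ + 1) * pi]mulrDl mul1r sinDpi.
by rewrite invrN mulrNN.
Qed.

Lemma besselK_quotientE (n : nat) s z : -1 < s -> s < 1 -> s != 0 -> 0 < z ->
  besselK_quotient (s + n%:R) z =
  besselK_const s * ((z / 2) `^ (s + n%:R) * bint (- (s + n%:R)) ((z / 2) ^+ 2)).
Proof.
move=> s1 s2 s0 z0; have z2 : 0 < z / 2 by rewrite divr_gt0.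
rewrite -(besselK_constS n); set rho := s + n%:R.
rewrite /besselK_quotient /besselK_const !besselI_bser//.
have D := bdiff_bint n s1 s2 s0 (exprn_gt0 2 z2).
have -> : (z / 2) `^ (- rho) * bser (- rho) ((z / 2) ^+ 2) - (z / 2) `^ rho * bser rho ((z / 2) ^+ 2) =
    reflection rho * ((z / 2) `^ rho * bint (- rho) ((z / 2) ^+ 2)).
  rewrite mulrCA -D /bdiff mulrBr mulrA; congr (_ * _ - _).
  rewrite -powR_mulrn ?(ltW z2)// -powRrM -powRD; last by apply/implyP => _; rewrite gt_eqF.
  by congr (_ `^ _); rewrite -/rho; ring.
by ring.
Qed.

Lemma besselK_const_neq0 s : 0 < s -> s < 1 -> besselK_const s != 0.
Proof.
move=> s0 s1; rewrite mulf_neq0//.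
  by rewrite gt_eqF// divr_gt0// pi_gt0.
rewrite mulf_neq0 ?invr_eq0//.
  by rewrite gt_eqF// mulr_gt0// rGamma_gt0// subr_gt0.
by rewrite gt_eqF// sin_gt0_pi// mulr_gt0 ?pi_gt0//= gtr_pMl// pi_gt0.
Qed.

Lemma sin_slope : sin (t * pi) / t @[t --> (0 : R)^'] --> (pi : R).
Proof.
have d : is_derive (0 : R) (1 : R) (fun t => sin (t * pi)) pi.
  by apply: is_derive_eq; rewrite mul0r cos0 /GRing.scale/=; ring.
have [dd] := d; rewrite /derivable => dE.
rewrite -[X in _ --> X]dE; apply: cvg_trans (dd); apply: near_eq_cvg; near=> t.
by rewrite /= addr0 mul0r sin0 subr0 /GRing.scale/= mulr1 mulrC.
Unshelve. all: by end_near. Qed.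

(** [reflectionE] extracts a factor s, which meets the slope of the sine at 0; the rest is the
    continuity of Gamma at 1. *)
Lemma besselK_const_cvg0 : besselK_const s @[s --> (0 : R)^'] --> (2^-1 : R).
Proof.
have c1 e : rGamma (1 + e * s) @[s --> (0 : R)^'] --> (1 : R).
  have c : {for 1, continuous (@rGamma R)}.
    have b : {for (1 : R), continuous ((@bint R) ^~ 0)} by apply: bint_continuous_s; rewrite ?ltr01.
    have g : @Gamma R @ (1 : R) --> Gamma (1 : R).
      rewrite Gamma_bint//; apply: cvg_trans b; apply: near_eq_cvg; near=> s.
      by rewrite Gamma_bint//; near: s; exact: lt_nbhsr.
    by apply: cvgV => //; rewrite gt_eqF// Gamma_gt0.
  rewrite -[X in _ --> X](rGamma1 R).
  have l : (fun s : R => 1 + e * s) @ (0 : R) --> (1 : R).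
    rewrite -[X in _ --> X]addr0 -[X in _ --> _ + X](mulr0 e).
    by apply: cvgD; [exact: cvg_cst|apply: cvgM; [exact: cvg_cst|exact: cvg_id]].
  apply: (@cvg_trans _ (rGamma (1 + e * s) @[s --> (0 : R)])).
    exact: cvg_app (@nbhs_dnbhs _ _).
  by apply: (@cvg_comp _ _ _ (fun s : R => 1 + e * s) (@rGamma R) _ (nbhs (1 : R))); [exact: l|exact: c].
have -> : 2^-1 = pi / 2 * (1 * 1 / pi) :> R.
  by rewrite mul1r mulrAC mul1r divff ?mul1r// gt_eqF// pi_gt0.
have E : {near (0 : R)^', (fun s => pi / 2 * (rGamma (1 + 1 * s) * rGamma (1 + -1 * s) / (sin (s * pi) / s))) =1 besselK_const}.
  near=> s; rewrite /besselK_const reflectionE mul1r mulN1r; congr (_ * _).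
  by rewrite invf_div mulrCA mulrA.
apply: cvg_trans; first exact: (near_eq_cvg E).
apply: cvgM; first exact: cvg_cst.
apply: cvgM; first by apply: cvgM; exact: c1.
by apply: cvgV; [rewrite gt_eqF ?pi_gt0|exact: sin_slope].
Unshelve. all: by end_near. Qed.

Lemma sin_int_pi (n : nat) : sin (n%:R * pi) = 0 :> R.
Proof. by elim: n => [|n IH]; rewrite ?mul0r ?sin0// -natr1 mulrDl mul1r sinDpi IH oppr0. Qed.

(** Split rho into its integer part n and its fractional part. If the latter is 0, K is the limit of
    [besselK_quotient], and the right side of [besselK_quotientE] is continuous at n except for its
    constant, which tends to 1/2. *)
Lemma besselKE rho : 0 <= rho -> exists2 c, c != 0 &
  forall z, 0 < z -> besselK rho z = c * ((z / 2) `^ rho * bint (- rho) ((z / 2) ^+ 2)).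
Proof.
move=> r0; pose n := Num.truncn rho; pose s := rho - n%:R.
have /andP[n1 n2] := truncn_itv r0; rewrite -/n -natr1 in n1 n2.
have rE : rho = s + n%:R by rewrite subrK.
have s1 : s < 1 by rewrite /s; lra.
have : 0 <= s by rewrite subr_ge0.
rewrite le_eqVlt => /predU1P[s0|s0]; last first.
  exists (besselK_const s); first exact: besselK_const_neq0.
  move=> z z0; rewrite /besselK rE ifF; last first.
    have h : sin (s * pi) != 0 by rewrite gt_eqF// sin_gt0_pi// mulr_gt0 ?pi_gt0//= gtr_pMl// pi_gt0.
    apply/negbTE; elim: (n) => [|k IH]; first by rewrite addr0.
    by rewrite -natr1 addrA mulrDl mul1r sinDpi oppr_eq0.
  by rewrite besselK_quotientE// ?gt_eqF//; lra.
rewrite -s0 add0r in rE; exists 2^-1 => // z z0.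
rewrite /besselK rE sin_int_pi eqxx; apply: (@cvg_lim _ (@Rhausdorff R)).
have z2 : 0 < z / 2 by rewrite divr_gt0.
have E : {near (n%:R : R)^', (fun rho => besselK_const (rho - n%:R) *
     ((z / 2) `^ rho * bint (- rho) ((z / 2) ^+ 2))) =1 (fun rho => besselK_quotient rho z)}.
  near=> t; rewrite -{4}(subrK n%:R t) besselK_quotientE ?subrK//.
  - rewrite ltrBrDr; near: t; apply: nbhs_dnbhs; apply: lt_nbhsr; lra.
  - rewrite ltrBlDr; near: t; apply: nbhs_dnbhs; apply: lt_nbhsl; lra.
  - rewrite subr_eq0; near: t; exact: nbhs_dnbhs_neq.
apply: cvg_trans; first exact: (near_eq_cvg E).
apply: cvgM.
  (* Filling the hole at 0 with the limit turns the translate by n into a composition of continuous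
     functions. *)
  pose S (t : R) := if t == 0 then 2^-1 else besselK_const t.
  have Sc : {for 0, continuous S}.
    apply/continuous_withinNx; rewrite /S eqxx; apply: cvg_trans besselK_const_cvg0.
    apply: near_eq_cvg; near=> t; rewrite ifF//; apply/negbTE; near: t; exact: nbhs_dnbhs_neq.
  have E2 : {near (n%:R : R)^', (fun rho => S (rho - n%:R)) =1 (fun rho => besselK_const (rho - n%:R))}.
    near=> t; rewrite /S ifF//; apply/negbTE; rewrite subr_eq0; near: t; exact: nbhs_dnbhs_neq.
  apply: cvg_trans; first exact: (near_eq_cvg E2).
  have S0 : S 0 = 2^-1 by rewrite /S eqxx.
  apply: (@cvg_trans _ (S (t - n%:R) @[t --> (n%:R : R)])).
    exact: cvg_app (@nbhs_dnbhs _ _).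
  have l : (fun t : R => t - n%:R) @ (n%:R : R) --> (0 : R).
    by rewrite -[X in _ --> X](subrr n%:R); apply: cvgB; [exact: cvg_id|exact: cvg_cst].
  by rewrite -S0; apply: (@cvg_comp _ _ _ (fun t : R => t - n%:R) S _ (nbhs (0 : R))); [exact: l|exact: Sc].
have h1 : (fun t => (z / 2) `^ t) @ (n%:R : R) --> (z / 2) `^ n%:R.
  rewrite /powR gt_eqF//; apply: (@cvg_comp _ _ _ (fun t => t * ln (z / 2)) expR _ (nbhs (n%:R * ln (z / 2)))).
    by apply: cvgM; [exact: cvg_id|exact: cvg_cst].
  exact: continuous_expR.
have h2 : (fun t => bint (- t) ((z / 2) ^+ 2)) @ (n%:R : R) --> bint (- n%:R) ((z / 2) ^+ 2).
  apply: (@cvg_comp _ _ _ -%R ((@bint R) ^~ ((z / 2) ^+ 2)) _ (nbhs (- n%:R : R))).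
    exact: opp_continuous.
  by apply: bint_continuous_s; [rewrite sqr_ge0|rewrite exprn_gt0// orbT].
apply: (@cvg_trans _ ((z / 2) `^ t * bint (- t) ((z / 2) ^+ 2) @[t --> (n%:R : R)])).
  exact: cvg_app (@nbhs_dnbhs _ _).
exact: cvgM h1 h2.
Unshelve. all: by end_near. Qed.

End BesselK.

(** * Gegenbauer polynomials and plane waves *)

Section GegenbauerRecurrence.
Context (R : realType) (nu : R).
Hypothesis nu0 : 0 <= nu.
Local Notation gam := (gam nu).

(* nu * ageg n = (nu + n) * C_n^nu; unlike the Gegenbauer polynomials themselves,
   this normalization makes sense for nu = 0 as well. *)
Fixpoint ageg (xi : R) (n : nat) : R :=
  match n with
  | 0 => 1
  | 1 => 2 * (1 + nu) * xi
  | (n'.+1 as m).+1 => (gam m.+1)^-1 * (2 * xi * ageg xi m + (gam n' - 2) * ageg xi n')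
  end.

Lemma agegSS xi n :
  ageg xi n.+2 = (gam n.+2)^-1 * (2 * xi * ageg xi n.+1 + (gam n - 2) * ageg xi n).
Proof. by []. Qed.

Lemma gamS_inv n : (gam n.+1)^-1 = (n.+1%:R + nu) / n.+1%:R.
Proof. by rewrite /gam invf_div. Qed.

Lemma gam_gt0 n : 0 < gam n.+1.
Proof. by rewrite divr_gt0// ltr_wpDr. Qed.

Lemma gam_ge0 n : 0 <= gam n.
Proof. by case: n => [|n]; [rewrite /gam mul0r|exact/ltW/gam_gt0]. Qed.

Lemma gam_le1 n : gam n <= 1.
Proof.
case: n => [|n]; first by rewrite /gam mul0r.
by rewrite ler_pdivrMr ?mul1r ?lerDl// ltr_wpDr.
Qed.

(** A crude bound by the recurrence, with 1/[gam] at most 1 + nu. Geometric growth is enough: it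
    leaves a positive radius of convergence, and factorials beat it in the plane wave. *)
Lemma ageg_bound xi n : `|xi| <= 1 -> `|ageg xi n| <= (4 * (1 + nu)) ^+ n.
Proof.
move=> x1; have n1 : 1 <= 1 + nu by rewrite lerDl.
have K0 : 0 <= 4 * (1 + nu) by lra.
elim/harmSS_ind: n => [||n IH0 IH1]; first by rewrite expr0 normr1.
  rewrite /= expr1 !normrM (ger0_norm (_ : 0 <= 2 :> R))// (ger0_norm (_ : 0 <= 1 + nu)); last by lra.
  have := normr_ge0 xi; nra.
rewrite agegSS normrM gtr0_norm ?invr_gt0 ?gam_gt0//.
have g : (gam n.+2)^-1 <= 1 + nu.
  rewrite gamS_inv ler_pdivrMr// mulrDl mul1r lerD2l ler_peMr//.
  by rewrite ler1n.
have g0 : 0 <= (gam n.+2)^-1 by rewrite invr_ge0 gam_ge0.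
have B : `|2 * xi * ageg xi n.+1 + (gam n - 2) * ageg xi n| <=
    2 * (4 * (1 + nu)) ^+ n.+1 + 2 * (4 * (1 + nu)) ^+ n.
  apply: le_trans (ler_normD _ _) _; apply: lerD; rewrite !normrM.
    rewrite (ger0_norm (_ : 0 <= 2 :> R))// -mulrA ler_wpM2l//.
    by rewrite -[leRHS]mul1r ler_pM.
  rewrite ler_pM// distrC ger0_norm; have := gam_ge0 n; have := gam_le1 n; lra.
apply: le_trans (ler_pM g0 (normr_ge0 _) g B) _.
have p : 0 <= (4 * (1 + nu)) ^+ n by rewrite exprn_ge0.
rewrite !exprS; nra.
Qed.

Lemma ev_harm (d : nat) (phi : nat -> R -> R) (a y : 'rV[R]_d) n : 0 < enorm y ->
  ev phi (harm nu a n) y = enorm y ^+ n * ageg (dotv a y / enorm y) n.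
Proof.
move=> y0; have yy : dotv y y = enorm y ^+ 2 by rewrite sqr_sqrtr// dotv_ge0.
have e0 : enorm y != 0 by rewrite gt_eqF.
elim/harmSS_ind: n => [||n IH0 IH1]; first by rewrite harm0 /= mulr1.
  by rewrite harm1 /= expr1 mulrCA [enorm y * _]mulrC divfK.
rewrite harm_recE agegSS IH0 IH1 yy !exprS.
have -> : dotv a y = dotv a y / enorm y * enorm y by rewrite divfK.
by rewrite mulfK//; ring.
Qed.

End GegenbauerRecurrence.

Section PowerSeriesUniqueness.
Context (R : realType).

Lemma series_const_term (e : R^nat) (M r : R) : 0 < r -> (forall n, `|e n| <= M * r ^+ n) ->
  (\forall t \near (0 : R)^', series (fun n => e n * t ^+ n) @ \oo --> (0 : R)) -> e 0%N = 0.
Proof.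
move=> r0 eM es.
have M0 : 0 <= M by have := le_trans (normr_ge0 _) (eM 0%N); rewrite expr0 mulr1.
apply/eqP; rewrite -normr_le0.
apply/ler_addgt0Pr => eps eps0; rewrite add0r.
have [t [t0 tes tr te]] : exists t : R, [/\ t != 0, series (fun n => e n * t ^+ n) @ \oo --> (0 : R),
   r * `|t| <= 1/2 & 2 * M * (r * `|t|) <= eps].
  have : \forall t \near (0 : R)^', [/\ t != 0, series (fun n => e n * t ^+ n) @ \oo --> (0 : R),
     r * `|t| <= 1/2 & 2 * M * (r * `|t|) <= eps].
    near=> t; split.
    - near: t; exact: nbhs_dnbhs_neq.
    - near: t; exact: es.
    - rewrite mulrC -ler_pdivlMr//; near: t; apply: dnbhs0_le; by rewrite divr_gt0.
    - have h : `|t| <= eps / (r * (2 * M + 1)).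
        near: t; apply: dnbhs0_le; rewrite divr_gt0// mulr_gt0//; lra.
      have p : 0 < r * (2 * M + 1) by rewrite mulr_gt0//; lra.
      rewrite ler_pdivlMr// in h; apply: le_trans h.
      have := normr_ge0 t; have := mulr_ge0 (normr_ge0 t) (ltW r0); nra.
  by move=> /filter_ex[t H]; exists t.
apply: le_trans te.
have B N : `|series (fun n => e n * t ^+ n) N.+1 - e 0%N| <= 2 * M * (r * `|t|).
  rewrite /series/= big_nat_recl// expr0 mulr1 addrAC subrr add0r.
  apply: le_trans (ler_norm_sum _ _ _) _.
  apply: (@le_trans _ _ (\sum_(0 <= i < N) M * (r * `|t|) * (1/2) ^+ i)).
    apply: ler_sum => i _; rewrite normrM normrX.
    apply: (@le_trans _ _ (M * (r * `|t|) ^+ i.+1)).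
      by rewrite exprMn mulrA ler_wpM2r// exprn_ge0.
    rewrite exprS mulrA ler_wpM2l ?mulr_ge0 ?(ltW r0)// lerXn2r// ?nnegrE ?mulr_ge0 ?(ltW r0)//.
  have S : \sum_(0 <= i < N) (1/2) ^+ i <= 2 :> R.
    have -> : \sum_(0 <= i < N) (1/2) ^+ i = 2 - 2 * (1/2) ^+ N :> R.
      elim: N => [|N IH]; first by rewrite big_nil expr0; lra.
      by rewrite big_nat_recr//= IH exprS; lra.
    by have : 0 <= (1/2 : R) ^+ N by [rewrite exprn_ge0]; lra.
  rewrite -mulr_sumr [leRHS](_ : _ = M * (r * `|t|) * 2); last by ring.
  by rewrite ler_wpM2l// !mulr_ge0// ltW.
have c : `|series (fun n => e n * t ^+ n) N.+1 - e 0%N| @[N --> \oo] --> `|0 - e 0%N|.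
  by apply: cvg_norm; apply: cvgB; [move: tes; rewrite -cvg_shiftS|exact: cvg_cst].
rewrite sub0r normrN in c.
by apply: (@ler_cvg_to nat \oo _ R _ _ _ _ c (cvg_cst _)); near=> N; exact: B.
Unshelve. all: by end_near. Qed.

(** The constant term is found by letting t tend to 0; dividing by t then shifts the coefficients.
    This is why convergence is asked on a punctured neighbourhood only. *)
Lemma series_coef0 (e : R^nat) (M r : R) : 0 < r -> (forall n, `|e n| <= M * r ^+ n) ->
  (\forall t \near (0 : R)^', series (fun n => e n * t ^+ n) @ \oo --> (0 : R)) ->
  forall n, e n = 0.
Proof.
move=> r0 eM es n; elim: n e M eM es => [|n IH] e M eM es; first exact: series_const_term eM es.
have e0 := series_const_term r0 eM es.
apply: (IH (fun n => e n.+1) (M * r)).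
  by move=> k; rewrite -mulrA -exprS.
near=> t.
have t0 : t != 0 by near: t; exact: nbhs_dnbhs_neq.
have c : series (fun n => e n * t ^+ n) @ \oo --> (0 : R) by near: t; exact: es.
have -> : series (fun n => e n.+1 * t ^+ n) = fun N => t^-1 * series (fun n => e n * t ^+ n) N.+1.
  apply/funext => N; rewrite /series/= big_nat_recl//= e0 mul0r add0r mulr_sumr.
  by apply: eq_bigr => i _; rewrite exprS; field.
rewrite -[X in _ --> X](mulr0 t^-1); apply: cvgM; first exact: cvg_cst.
by move: c; rewrite -cvg_shiftS.
Unshelve. all: by end_near. Qed.

End PowerSeriesUniqueness.

(** * From the generating function to the three-term recurrence *)

Section GegenbauerGenerating.
Context (R : realType) (nu xi : R).
Hypotheses (nu0 : 0 < nu) (xi1 : `|xi| <= 1).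

Lemma is_cvg_pseries_geometric (c : R^nat) (M r t : R) : (forall n, `|c n| <= M * r ^+ n) ->
  0 <= r -> r * `|t| < 1 -> cvgn (pseries c t).
Proof.
move=> cM r0 rt; apply: normed_cvg.
apply: (@series_le_cvg _ _ (geometric M (r * `|t|))).
- by move=> k /=.
- move=> k /=; rewrite mulr_ge0//; first by have := le_trans (normr_ge0 _) (cM 0%N); rewrite expr0 mulr1.
  by rewrite exprn_ge0// mulr_ge0.
- by move=> k /=; rewrite normrM normrX exprMn mulrA ler_wpM2r// exprn_ge0.
- by apply: is_cvg_geometric_series; rewrite ger0_norm// mulr_ge0.
Qed.

Lemma pseries_diffs_bound (c : R^nat) (M r : R) : 0 <= r -> (forall n, `|c n| <= M * r ^+ n) ->
  forall n, `|pseries_diffs c n| <= (M * (2 * r)) * (2 * r) ^+ n.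
Proof.
move=> r0 cM n; rewrite /pseries_diffs normrM normr_nat.
have := cM n.+1; rewrite -mulrA -exprS exprMn => h.
rewrite mulrCA ler_pM// -natrX ler_nat; exact/ltnW/ltn_expl.
Qed.

Local Notation K := (4 * (1 + nu)).
Let c n := nu * ageg nu xi n / (nu + n%:R).

Let nun n : nu + n%:R != 0.
Proof. by rewrite gt_eqF// ltr_pwDl. Qed.

Let K0 : 0 < K.
Proof. by rewrite mulr_gt0// addr_gt0. Qed.

Let c_bound n : `|c n| <= 1 * K ^+ n.
Proof.
rewrite mul1r /c mulrAC normrM.
rewrite -[leRHS]mul1r ler_pM//; last by apply: ageg_bound => //; exact: ltW.
by rewrite ger0_norm ?divr_ge0 ?addr_ge0 ?(ltW nu0)// ler_pdivrMr ?mul1r ?lerDl// ltr_pwDl.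
Qed.

Let c_rec n : n.+2%:R * c n.+2 =
  2 * xi * (nu + n.+1%:R) * c n.+1 - (n%:R + 2 * nu) * c n.
Proof.
rewrite /c agegSS gamS_inv.
have h := nun n; have h1 := nun n.+1; have h2 := nun n.+2.
have g : gam nu n - 2 = - ((n%:R + 2 * nu) / (n%:R + nu)).
  by rewrite -two_subgam ?opprB// ltr_wpDl.
rewrite g [n.+2%:R + nu]addrC [n%:R + nu]addrC.
have n2 : n.+2%:R != 0 :> R by rewrite pnatr_eq0.
move: h h1 h2 n2; move: (n.+2%:R : R) (n.+1%:R : R) => A B h h1 h2 n2.
by field; rewrite h h1 h2 n2.
Qed.

Let q t := 1 - 2 * t * xi + t ^+ 2.

(** The generating function solves q f' = 2 nu (xi - t) f. Partial sums do so up to terms with the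
    last coefficients, which tend to 0 inside the disc of convergence. *)
Let ode_partial t N : q t * pseries (pseries_diffs c) t N.+1 - 2 * nu * (xi - t) * pseries c t N.+1
  = t ^+ N.+1 * (2 * nu * xi * c N.+1 - pseries_diffs c N.+1 + t * pseries_diffs c N).
Proof.
have c0 : c 0%N = 1 by rewrite /c addr0 mulr1 divff// gt_eqF.
have c1 : c 1%N = 2 * nu * xi.
  by rewrite /c /= -{4}[1]/(1%:R); have := nun 1; set e := nu + 1%:R => e0; rewrite (_ : 1 + nu = e) ?[1 + nu]addrC//; field.
elim: N => [|N IH].
  rewrite /pseries/series/= !big_nat1 !expr0 !mulr1 expr1 /pseries_diffs.
  by rewrite c_rec c1 c0 /q; ring.
rewrite /pseries/series/= big_nat_recr//= [in X in _ - _ * X]big_nat_recr//=.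
move: IH; rewrite /pseries/series/= => IH.
set A := \sum_(0 <= i < N.+1) _ in IH *; set B := \sum_(0 <= i < N.+1) _ in IH *.
rewrite (_ : _ - _ = q t * A - 2 * nu * (xi - t) * B +
  (q t * pseries_diffs c N.+1 - 2 * nu * (xi - t) * c N.+1) * t ^+ N.+1); last by ring.
rewrite {}IH /pseries_diffs (c_rec N.+1) /q !exprS; ring.
Qed.

Let q_gt0 t : `|t| < 1 -> 0 < q t.
Proof.
move=> t1; have : `|t * xi| <= `|t| by rewrite normrM ler_piMr.
have := ler_norm (t * xi); rewrite /q -(real_normK (num_real t)) => h1 h2.
by rewrite -mulrA; nra.
Qed.

Lemma gegenbauer_generating :
  \forall t \near (0 : R), series (fun n => c n * t ^+ n) @ \oo --> (q t) `^ (- nu).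
Proof.
have b1 := pseries_diffs_bound (ltW K0) c_bound.
have K2 : 0 <= 2 * K by rewrite mulr_ge0// ltW.
have b2 := pseries_diffs_bound K2 b1.
(* The coefficients of the second derivative grow at most like (4 K)^n, so that on this disc all
   three series are dominated by a geometric one of ratio 1/2. *)
pose rad := (8 * K)^-1.
have rad0 : 0 < rad by rewrite invr_gt0 mulr_gt0.
have radK : K * rad = 1 / 8 by rewrite /rad; field; rewrite !gt_eqF// addr_gt0.
have cv0 t : `|t| <= rad -> cvgn (pseries c t).
  move=> tr; apply: (is_cvg_pseries_geometric c_bound (ltW K0)).
  by have := ler_wpM2l (ltW K0) tr; lra.
have cv1 t : `|t| <= rad -> cvgn (pseries (pseries_diffs c) t).
  move=> tr; apply: (is_cvg_pseries_geometric b1 K2).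
  by have := ler_wpM2l (ltW K0) tr; lra.
have cv2 t : `|t| <= rad -> cvgn (pseries (pseries_diffs (pseries_diffs c)) t).
  move=> tr; apply: (is_cvg_pseries_geometric b2); first by rewrite mulr_ge0.
  by have := ler_wpM2l (ltW K0) tr; lra.
have rad1 : rad < 1.
  have K1 : 1 <= K by have := nu0; lra.
  have := ler_wpM2r (ltW rad0) K1; lra.
pose f t := limn (pseries c t); pose f' t := limn (pseries (pseries_diffs c) t).
have radE : `|rad| <= rad by rewrite gtr0_norm.
have df t : `|t| < rad -> is_derive t (1 : R) f (f' t).
  move=> tr; apply: (@pseries_snd_diffs _ c rad); [exact: cv0|exact: cv1|exact: cv2|].
  by rewrite [ltRHS]gtr0_norm.
have ode t : `|t| < rad -> q t * f' t = 2 * nu * (xi - t) * f t.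
  move=> tr; apply/eqP; rewrite -subr_eq0; apply/eqP.
  have l1 : (q t * pseries (pseries_diffs c) t N.+1 - 2 * nu * (xi - t) * pseries c t N.+1) @[N --> \oo]
      --> q t * f' t - 2 * nu * (xi - t) * f t.
    apply: cvgB; apply: cvgM; try exact: cvg_cst.
      by have := cv1 t (ltW tr); rewrite -[X in X -> _]/(cvgn _) => h; move: (h); rewrite -cvg_shiftS.
    by have := cv0 t (ltW tr); rewrite -[X in X -> _]/(cvgn _) => h; move: (h); rewrite -cvg_shiftS.
  apply: (cvg_unique (@Rhausdorff R) l1); rewrite /= (funext (ode_partial t)).
  have z1 : (c N * t ^+ N) @[N --> \oo] --> (0 : R) by exact: cvg_series_cvg_0 (cv0 t (ltW tr)).
  have z2 : (pseries_diffs c N * t ^+ N) @[N --> \oo] --> (0 : R).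
    exact: cvg_series_cvg_0 (cv1 t (ltW tr)).
  have E : (fun N => t ^+ N.+1 * (2 * nu * xi * c N.+1 - pseries_diffs c N.+1 + t * pseries_diffs c N)) =
     (fun N => 2 * nu * xi * (c N.+1 * t ^+ N.+1) - (pseries_diffs c N.+1 * t ^+ N.+1)
         + t ^+ 2 * (pseries_diffs c N * t ^+ N)).
    by apply/funext => N; rewrite !exprS; ring.
  have Z : 2 * nu * xi * 0 - 0 + t ^+ 2 * 0 = 0 by rewrite !mulr0 subrr addr0.
  rewrite E -[X in _ --> X]Z.
  apply: cvgD; [apply: cvgB|].
  - by apply: cvgM; [exact: cvg_cst|move: z1; rewrite -cvg_shiftS].
  - by move: z2; rewrite -cvg_shiftS.
  - by apply: cvgM; [exact: cvg_cst|].
have nr : \forall t \near (0 : R), `|t| < rad.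
  by apply/nbhs_ballP; exists rad => //= u; rewrite /ball/= sub0r normrN.
near=> t.
have tr : `|t| < rad by near: t; exact: nr.
have q0 u : `|u| < rad -> 0 < q u by move=> ur; apply: q_gt0; exact: lt_trans rad1.
have dq u : is_derive u (1 : R) q (2 * u - 2 * xi).
  by rewrite /q; apply: is_derive_eq; rewrite /GRing.scale/=; ring.
pose g u := f u * q u `^ nu.
have dg u : `|u| < rad -> is_derive u (1 : R) g 0.
  move=> ur; have d1 := df u ur; have d2 := is_derive1_comp (is_derive1_powR nu (q0 _ ur)) (dq u).
  have d3 : is_derive u (1 : R) (fun u => q u `^ nu) (nu * q u `^ (nu - 1) * (2 * u - 2 * xi)) by exact: d2.
  rewrite /g; apply: is_derive_eq; rewrite /GRing.scale/=.
  have -> : q u `^ nu = q u `^ (nu - 1) * q u.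
    by rewrite -[X in _ * X]powRr1 ?ltW ?q0// -powRD ?subrK//; apply/implyP => _; rewrite gt_eqF// q0.
  transitivity (q u `^ (nu - 1) * (q u * f' u - 2 * nu * (xi - u) * f u)); first by ring.
  by rewrite ode// subrr mulr0.
have gt : g t = g 0.
  pose h (s : R) := g (s * t) - g 0.
  have : `|h 1| <= 0.
    apply: (@bound_primitive _ h (cst 0)).
    - by rewrite /h mul0r subrr.
    - move=> s /andP[s0 s1].
      have st : `|s * t| < rad by rewrite normrM (ger0_norm s0); apply: le_lt_trans tr; rewrite ler_piMl.
      have d4 : is_derive s (1 : R) (fun s => s * t) t.
        by apply: is_derive_eq; rewrite /GRing.scale/=; ring.
      have d5 : is_derive s (1 : R) (fun s => g (s * t)) (0 * t)
        := @is_derive1_comp R g (fun s => s * t) s 0 t (dg _ st) d4.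
      by apply: is_derive_eq; rewrite mul0r subrr.
    - by move=> s _; rewrite normr0.
    - by rewrite ler01 lexx.
  by rewrite normr_le0 /h mul1r subr_eq0 => /eqP.
have f0 : f 0 = 1.
  apply: (@cvg_lim _ (@Rhausdorff R)); apply: cvg_near_cst; near=> N.
  have N0 : (0 < N)%N by near: N; exact: nbhs_infty_gt.
  rewrite /pseries/series/= -(prednK N0) big_nat_recl//= big1 ?addr0; last first.
    by move=> i _; rewrite expr0n/= mulr0.
  by rewrite expr0 mulr1 /c addr0 mulr1 divff// gt_eqF.
have g0 : g 0 = 1 by rewrite /g f0 /q mulr0 mul0r expr0n/= subr0 addr0 powR1 mulr1.
have -> : q t `^ (- nu) = f t.
  have qn : q t `^ nu != 0 by rewrite gt_eqF// powR_gt0 ?q0.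
  rewrite powRN; apply: (mulIf qn); rewrite mulVf//.
  by rewrite -g0 -gt.
exact: cv0 t (ltW tr).
Unshelve. all: by end_near. Qed.

(** [get] returns some sequence with the right sums. Convergence at one nonzero t bounds it
    geometrically, and [series_coef0] identifies it with the sequence [c] obtained from the
    recurrence. *)
Lemma gegenbauer_posE n : (nu + n%:R) * gegenbauer_pos nu xi n = nu * ageg nu xi n.
Proof.
rewrite /gegenbauer_pos.
have cE := gegenbauer_generating.
have := @getPex _ [set c : R^nat | \forall t \near (0 : R), series (fun n => c n * t ^+ n) @ \oo --> q t `^ (- nu)]
  (ex_intro _ c cE).
rewrite /q /=; set g := get _ => gE.
suff E k : g k = c k by rewrite E /c mulrC divfK.
apply/eqP; rewrite -subr_eq0; apply/eqP.
have [t [t0 tg]] : exists t : R, t != 0 /\ cvgn (series (fun n => g n * t ^+ n)).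
  have : \forall t \near (0 : R)^', t != 0 /\ cvgn (series (fun n => g n * t ^+ n)).
    near=> t; split; first by near: t; exact: nbhs_dnbhs_neq.
    have h : series (fun n => g n * t ^+ n) @ \oo --> (1 - 2 * t * xi + t ^+ 2) `^ (- nu).
      by near: t; exact: nbhs_dnbhs gE.
    exact: cvgP h.
  by move=> /filter_ex[t H]; exists t.
have [M [Mr HM]] := cvg_seq_bounded (cvgP _ (cvg_series_cvg_0 tg)).
have gb n' : `|g n'| <= (`|M| + 1) * `|t|^-1 ^+ n'.
  have M1 : M < `|M| + 1 by rewrite (le_lt_trans (ler_norm M))// ltrDl.
  have /= := HM (`|M| + 1) M1 n' I; rewrite normrM normrX => h.
  by rewrite exprVn ler_pdivlMr// exprn_gt0// normr_gt0.
apply: (@series_coef0 _ (fun k => g k - c k) (`|M| + 1 + 1) (`|t|^-1 + K)).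
- by rewrite addr_gt0// invr_gt0 normr_gt0.
- move=> m; apply: le_trans (ler_normB _ _) _; rewrite mulrDl.
  have ti : 0 <= `|t|^-1 by rewrite invr_ge0.
  apply: lerD.
    apply: le_trans (gb m) _; rewrite ler_wpM2l ?addr_ge0// lerXn2r// ?nnegrE ?addr_ge0// ?(ltW K0)//.
    by rewrite lerDl ltW.
  apply: le_trans (c_bound m) _; rewrite !mul1r lerXn2r// ?nnegrE ?addr_ge0// ?(ltW K0)//.
  by rewrite lerDr.
near=> u.
have h1 : series (fun n => g n * u ^+ n) @ \oo --> q u `^ (- nu) by near: u; exact: nbhs_dnbhs gE.
have h2 : series (fun n => c n * u ^+ n) @ \oo --> q u `^ (- nu) by near: u; exact: nbhs_dnbhs cE.
rewrite (_ : series _ = series (fun n => g n * u ^+ n) - series (fun n => c n * u ^+ n)); last first.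
  by apply/funext => N; rewrite /series/= fctE -sumrB; apply: eq_bigr => i _; rewrite mulrBl.
rewrite -[X in _ --> X](subrr (q u `^ (- nu))); exact: cvgB.
Unshelve. all: by end_near. Qed.

End GegenbauerGenerating.

Section GegenbauerZero.
Context (R : realType) (xi : R).

Lemma Gamma_nat (n : nat) : Gamma (n%:R + 1) = n`!%:R :> R.
Proof.
elim: n => [|n IH].
  by rewrite add0r fact0 -[LHS]invrK -/(rGamma 1) rGamma1 invr1.
by rewrite GammaS -natr1 ?IH ?factS ?natrM ?natr1// ltr_pwDr.
Qed.

Let x := 2 * xi.

(** The summands of n C_n^0 in factorial form, continued by 0 for 2m > n. Any sufficiently long
    range then gives the same sum, so that different degrees can be compared over a common range. *)
Let lterm (n m : nat) : R := if (m.*2 <= n)%N then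
  (-1) ^+ m * (n%:R * (n - m).-1`!%:R / (m`!%:R * (n - m.*2)`!%:R)) * x ^+ (n - m.*2) else 0.

Let lterm0 n : lterm n.+2 0 = x * lterm n.+1 0.
Proof.
rewrite /lterm /= !subn0 /= !expr0 !mul1r ?fact0 ?mul1r.
rewrite [n.+2`!]factS [n.+1`!]factS !natrM.
have h k : k.+1%:R != 0 :> R by rewrite pnatr_eq0.
have hf : n`!%:R != 0 :> R by rewrite pnatr_eq0 -lt0n fact_gt0.
rewrite exprS; have := h n.+1; have := h n.
by move: (n.+2%:R : R) (n.+1%:R : R) (n`!%:R : R) hf => a b c c0 b0 a0; field; rewrite a0 b0 c0.
Qed.

(** The Chebyshev recurrence already holds term by term. *)
Let ltermS n m : lterm n.+3 m.+1 = x * lterm n.+2 m.+1 - lterm n.+1 m.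
Proof.
rewrite /lterm doubleS !ltnS.
have [nm|nm] := leqP m.*2 n.+1; last first.
  by rewrite ifF ?mulr0 ?subr0//; apply/negbTE; rewrite -ltnNge ltnW.
have [k nE] : exists k, n.+1 = (m.*2 + k)%N by exists (n.+1 - m.*2)%N; rewrite subnKC.
have f0 (i : nat) : i`!%:R != 0 :> R by rewrite pnatr_eq0 -lt0n fact_gt0.
have i0 (i : nat) : i.+1%:R != 0 :> R by rewrite pnatr_eq0.
case: k => [|k] in nE *.
  (* Boundary case 2m = n+1: x has exponent 0 and the middle term is absent. *)
  rewrite addn0 in nE; rewrite ifF ?mulr0 ?sub0r; last first.
    by apply/negbTE; rewrite -ltnNge -nE.
  case: m => [|m] in nm nE *; first by [].
  have -> : n.+3 = (m.+2).*2 by rewrite doubleS -nE.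
  rewrite nE !subnn !expr0 ?fact0 !mulr1.
  rewrite -!addnn !addnK -!pred_Sn [(m.+2 + _)%:R]natrD [(m.+1 + _)%:R]natrD.
  rewrite [m.+2`!]factS [m.+1`!]factS [(_ * (_ * _))%:R]natrM [(_ * _)%:R]natrM exprS.
  have := i0 m; have := i0 m.+1; have := f0 m.
  by move: (m.+2%:R : R) (m.+1%:R : R) (m`!%:R : R) ((-1) ^+ m.+1 : R) => a b c e c0 a0 b0; field; rewrite a0 b0 c0.
have -> : (m.*2 <= n)%N by rewrite -ltnS nE addnS ltnS leq_addr.
have E1 : (n.+3 - m.+1).-1 = (m + k).+1 by lia.
have E2 : (n.+3 - m.*2.+2)%N = k.+1 by lia.
have E3 : (n.+2 - m.+1).-1 = (m + k)%N by lia.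
have E4 : (n.+2 - m.*2.+2)%N = k by lia.
have E5 : (n.+1 - m).-1 = (m + k)%N by lia.
have E6 : (n.+1 - m.*2)%N = k.+1 by lia.
rewrite ?E1 ?E2 ?E3 ?E4 ?E5 ?E6 [(m + k).+1`!]factS [m.+1`!]factS [k.+1`!]factS !natrM !exprS.
have N1 : n.+1%:R = 2 * m%:R + k%:R + 1 :> R by rewrite nE addnS -natr1 natrD -addnn natrD; ring.
have -> : n.+3%:R = n.+1%:R + 2 :> R by rewrite -natrD addn2.
have -> : n.+2%:R = n.+1%:R + 1 :> R by rewrite natr1.
rewrite N1.
have := i0 m; have := i0 k; have := f0 m; have := f0 k; rewrite -!natr1 natrD.
move: (m%:R : R) (k%:R : R) (m`!%:R : R) (k`!%:R : R) ((m + k)`!%:R : R) ((-1) ^+ m : R) (x ^+ k) => a b c e u v w e0 c0 b0 a0.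
by field; rewrite a0 b0 c0 e0.
Qed.

Let lsum n M := \sum_(m < M) lterm n m.

Let gam0 n : gam (0 : R) n.+1 = 1.
Proof. by rewrite /gam addr0 divff// pnatr_eq0. Qed.

Let ageg0SS n : ageg 0 xi n.+3 = x * ageg 0 xi n.+2 - ageg 0 xi n.+1.
Proof. by rewrite agegSS !gam0 invr1 mul1r /x; ring. Qed.

Let lsumE n M : (n.+1 < M.*2)%N -> lsum n.+1 M = ageg 0 xi n.+1.
Proof.
elim/harmSS_ind: n M => [||n IH0 IH1] [|M]; rewrite ?doubleS// ltnS => nM.
- rewrite /lsum big_ord_recl big1 ?addr0 /lterm//=.
  by rewrite double0 subn0 fact0 expr0 expr1 -[1`!]/1%N !mulr1 divr1 mul1r addr0 mul1r mulr1.
- case: M nM => // M _; rewrite /lsum !big_ord_recl big1; last by [].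
  rewrite agegSS gam0 /gam mul0r /lterm /=.
  rewrite -[2`!]/2%N -[1`!]/1%N -[0`!]/1%N /x; by field.
- case: M nM => [|M]; first by [].
  rewrite doubleS !ltnS => nM.
  rewrite /lsum big_ord_recl lterm0 (eq_bigr (fun i : 'I_M.+1 => x * lterm n.+2 i.+1 - lterm n.+1 i)); last first.
    by move=> i _; rewrite -ltermS.
  rewrite sumrB -mulr_sumr addrA -mulrDr.
  rewrite ageg0SS -(IH0 M.+1) -?(IH1 M.+2) ?doubleS; [|lia|lia].
  by rewrite /lsum [in RHS]big_ord_recl.
Qed.

Lemma gegenbauer_zeroE n : n.+1%:R * gegenbauer_zero n.+1 xi = ageg 0 xi n.+1.
Proof.
rewrite -(@lsumE n (n.+1)./2.+1); last first.
  by rewrite doubleS -{1}(odd_double_half n.+1); case: (odd _); lia.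
rewrite /gegenbauer_zero /= big_mkord mulr_sumr /lsum; apply: eq_bigr => m _.
have mn : (m.*2 <= n.+1)%N.
  have := ltn_ord m; rewrite ltnS => h; rewrite -(odd_double_half n.+1).
  by apply: leq_trans (leq_addl _ _); rewrite leq_double.
rewrite /lterm mn.
have mn1 : (m < n.+1)%N by lia.
have -> : n.+1%:R - m%:R = (n.+1 - m).-1%:R + 1 :> R.
  by rewrite natr1 prednK ?subn_gt0// natrB// ltnW.
have -> : n.+1%:R - 2 * m%:R = (n.+1 - m.*2)%:R :> R.
  by rewrite natrB// -mul2n natrM.
rewrite !Gamma_nat mul2n -/x; ring.
Qed.

End GegenbauerZero.

(** * Uniform convergence of the plane-wave expansion *)

Section PlaneWave.
Context (R : realType) (nu b : R).
Hypotheses (nu0 : 0 <= nu) (b0 : 0 < b).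
Local Notation gam := (gam nu).
Local Notation K := (4 * (1 + nu)).

Let phi (n : nat) (u : R) := u ^+ n * bser (nu + n%:R) (u ^+ 2).

(** [bser_rec] distributes the derivative over the neighbours with the very weights of the
    recurrence [agegSS], so that the sum telescopes. At n = 0 the weight [gam 0] is 0 and hides the
    predecessor. *)
Let is_derive_phi n u : is_derive u (1 : R) (phi n)
  (gam n * phi n.-1 u + (2 - gam n) * phi n.+1 u).
Proof.
have d2 : is_derive u (1 : R) (fun u => u ^+ 2) (2 * u).
  by have := @is_derive_pow R 1 u; rewrite expr1.
have d1 (rho : R) : is_derive u (1 : R) (fun u => bser rho (u ^+ 2)) (bser (rho + 1) (u ^+ 2) * (2 * u)).
  exact: (@is_derive1_comp R (bser rho) (fun u => u ^+ 2) _ _ _ (is_derive_bser rho (u ^+ 2)) d2).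
case: n => [|n].
  rewrite (_ : phi 0 = fun u => bser (nu + 0) (u ^+ 2)); last by apply/funext => ?; rewrite /phi expr0 mul1r.
  apply: is_derive_eq; rewrite /gam mul0r mul0r add0r subr0 /phi expr1 addr0 -[1%:R]/(1 : R); ring.
have d3 := @is_derive_pow R n u.
rewrite /phi; apply: is_derive_eq; rewrite /GRing.scale /= /phi.
have := bser_rec (nu + n.+1%:R) (u ^+ 2).
rewrite (_ : nu + n.+1%:R - 1 = nu + n%:R); last by rewrite -natr1; ring.
rewrite (_ : nu + n.+2%:R = nu + n.+1%:R + 1); last by rewrite -natr1; ring.
move=> ->; rewrite !exprS /gam.
have h : n.+1%:R + nu != 0 by rewrite gt_eqF// ltr_wpDr.
move: (n.+1%:R : R) h (bser _ _) (bser _ _) (u ^+ n) => m h x y z.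
by field.
Qed.

Let S xi N u := \sum_(0 <= n < N.+1) ageg nu xi n * phi n u.

Let rest xi N u := (2 - gam N) * ageg nu xi N * phi N.+1 u - gam N.+1 * ageg nu xi N.+1 * phi N u.

Let telescope_S xi N u :
  \sum_(0 <= n < N.+1) ageg nu xi n * (gam n * phi n.-1 u + (2 - gam n) * phi n.+1 u) =
  2 * xi * S xi N u + rest xi N u.
Proof.
elim: N => [|N IH].
  rewrite /S /rest !big_nat1 /= {1 2 3}/gam mul0r /gam.
  have h : 1%:R + nu != 0 by rewrite gt_eqF// ltr_wpDr.
  by move: (phi _ _) (phi _ _) => x y; field.
have SS : S xi N.+1 u = S xi N u + ageg nu xi N.+1 * phi N.+1 u by rewrite /S big_nat_recr.
have E m f : \sum_(0 <= n < m.+1) f n = \sum_(0 <= n < m) f n + f m :> R by rewrite big_nat_recr.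
rewrite E IH SS /rest -pred_Sn.
have -> : gam N.+2 * ageg nu xi N.+2 = 2 * xi * ageg nu xi N.+1 + (gam N - 2) * ageg nu xi N.
  by rewrite agegSS mulrA divff ?mul1r ?gamS_neq0.
by move: (S _ _ _) (ageg nu xi N.+1) (ageg nu xi N) => w y z; ring.
Qed.

Let phi_bound n u : 0 <= u <= b ->
  `|phi n u| <= rGamma (nu + 1) * expR (b ^+ 2) * (b ^+ n / n`!%:R).
Proof.
move=> /andP[u0 ub]; have n0 : 0 <= nu + n%:R by rewrite addr_ge0.
have u20 : 0 <= u ^+ 2 by rewrite sqr_ge0.
rewrite normrM normrX (ger0_norm u0) ger0_norm; last first.
  by rewrite ltW// bser_gt0//; apply: lt_le_trans n0; rewrite ltrN10.
have g : rGamma (nu + n%:R + 1) <= rGamma (nu + 1) / n`!%:R.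
  elim: (n) => [|k IH]; first by rewrite addr0 fact0 divr1.
  have k0 : 0 < nu + k%:R + 1 by rewrite ltr_wpDl// addr_ge0.
  move: IH; rewrite rGamma_rec factS natrM invfM mulrCA -[k.+1%:R]natr1 [nu + (_ + _)]addrA => IH.
  rewrite -(ler_pM2l k0); apply: le_trans IH _.
  rewrite [leRHS]mulrA; apply: ler_peMl; first by rewrite divr_ge0// ltW// rGamma_gt0// ltr_wpDl.
  by rewrite ler_pdivlMr ?mul1r ?lerD2r ?lerDr// ltr_wpDl.
have r0 : 0 < rGamma (nu + n%:R + 1) by rewrite rGamma_gt0// ltr_wpDl.
apply: (@le_trans _ _ (b ^+ n * (rGamma (nu + 1) / n`!%:R * expR (b ^+ 2)))).
  rewrite ler_pM ?exprn_ge0//.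
  - by rewrite ltW// bser_gt0//; apply: lt_le_trans n0; rewrite ltrN10.
  - by rewrite lerXn2r// ?nnegrE// ltW.
  - apply: le_trans (bser_le n0 u20) _; rewrite ler_pM ?expR_ge0 ?(ltW r0)//.
    by rewrite ler_expR lerXn2r// ?nnegrE// ltW.
by rewrite le_eqVlt; apply/orP; left; apply/eqP; ring.
Qed.

(** The error bound must not depend on [xi], which will be the random cosine at the hitting point; a
    uniform bound makes any further interchange of sum and expectation trivial. *)
Lemma plane_wave : exists eps : R^nat, eps @ \oo --> (0 : R) /\
  forall N xi, `|xi| <= 1 ->
  `|\sum_(0 <= n < N) ageg nu xi n * (b ^+ n * bser (nu + n%:R) (b ^+ 2))
    - rGamma (nu + 1) * expR (2 * b * xi)| <= eps N.
Proof.
pose C := rGamma (nu + 1) * expR (b ^+ 2).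
have C0 : 0 < C by rewrite mulr_gt0 ?expR_gt0// rGamma_gt0// ltr_wpDl.
have K0 : 0 <= K by rewrite mulr_ge0// addr_ge0.
(* [ageg] contributes K^N and [phi_bound] b^N / N!: together a term of the exponential series, hence
   tending to 0. *)
pose rho N := (K + 2 * b) * C * exp_coeff (K * b) N.
suff H : exists eps : R^nat, eps @ \oo --> (0 : R) /\
  forall N xi, `|xi| <= 1 -> `|S xi N b - rGamma (nu + 1) * expR (2 * b * xi)| <= eps N.
  have [eps [e0 He]] := H.
  exists (fun N => if N is N'.+1 then eps N' else rGamma (nu + 1) * expR (2 * b)); split.
    by rewrite -cvg_shiftS.
  case=> [|N] xi x1; last exact: He.
  rewrite big_nil sub0r normrN ger0_norm; last first.
    by rewrite mulr_ge0 ?expR_ge0// ltW// rGamma_gt0// ltr_wpDl.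
  rewrite ler_wpM2l//; first by rewrite ltW// rGamma_gt0// ltr_wpDl.
  by rewrite ler_expR ler_piMr ?mulr_ge0 ?(ltW b0)// (le_trans (ler_norm _)).
exists (fun N => expR (2 * b) * (b * expR (2 * b) * rho N)); split.
  rewrite -(mulr0 (expR (2 * b))); apply: cvgM; first exact: cvg_cst.
  rewrite -(mulr0 (b * expR (2 * b))); apply: cvgM; first exact: cvg_cst.
  rewrite -(mulr0 ((K + 2 * b) * C)); apply: cvgM; first exact: cvg_cst.
  exact: cvg_series_cvg_0 (is_cvg_series_exp_coeff _).
move=> N xi x1.
have xb c : 0 <= c -> `|c * xi| <= c by move=> c0; rewrite normrM (ger0_norm c0) ler_piMr.
have rest_le u : 0 <= u <= b -> `|rest xi N u| <= rho N.
  move=> ub; rewrite /rest; apply: le_trans (ler_normB _ _) _.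
  have p1 := phi_bound N ub; have p2 := phi_bound N.+1 ub.
  rewrite -/C in p1 p2.
  have a1 := ageg_bound nu0 N x1; have a2 := ageg_bound nu0 N.+1 x1.
  have g1 := gam_ge0 nu0 N; have g2 := gam_le1 nu0 N.
  have h1 := gam_ge0 nu0 N.+1; have h2 := gam_le1 nu0 N.+1.
  apply: (@le_trans _ _ (2 * K ^+ N * (C * (b ^+ N.+1 / N.+1`!%:R)) + 1 * K ^+ N.+1 * (C * (b ^+ N / N`!%:R)))).
    have m1 : `|(2 - gam N) * ageg nu xi N| <= 2 * K ^+ N.
      by rewrite normrM ler_pM// ger0_norm; lra.
    have m2 : `|gam N.+1 * ageg nu xi N.+1| <= 1 * K ^+ N.+1.
      by rewrite normrM ler_pM// ger0_norm.
    by apply: lerD; rewrite normrM ler_pM.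
  rewrite /rho /exp_coeff/= [(K * b) ^+ N]exprMn mul1r.
  have f : (N.+1`!%:R)^-1 <= (N`!%:R)^-1 :> R.
    rewrite lef_pV2 ?posrE ?ltr0n ?fact_gt0// ler_nat factS; exact: leq_pmull.
  have p : 0 <= 2 * K ^+ N * C * b ^+ N.+1.
    by rewrite mulr_ge0 ?exprn_ge0 ?(ltW b0)// mulr_ge0 ?(ltW C0)// mulr_ge0// exprn_ge0.
  have := ler_wpM2l p f; rewrite !exprS.
  by move: (_^-1) (_^-1) (K ^+ N) (b ^+ N) => y z s t; lra.
(* With the integrating factor only [rest] is left in the derivative. The variable s rescales the
   segment [0, b] to [0, 1], as [bound_primitive] expects. *)
pose e (s : R) := expR (- (2 * b * xi) * s) * S xi N (s * b) - rGamma (nu + 1).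
have D (s : R) : 0 <= s <= 1 -> is_derive s (1 : R) e (b * expR (- (2 * b * xi) * s) * rest xi N (s * b)).
  move=> _.
  have dS : is_derive (s * b) (1 : R) (S xi N) (2 * xi * S xi N (s * b) + rest xi N (s * b)).
    rewrite -telescope_S /S.
    apply: (@is_derive_sumr _ _ _ (fun (n : nat) u => ageg nu xi n * phi n u)) => n.
    have dn := is_derive_phi n (s * b).
    by apply: is_derive_eq; rewrite /GRing.scale/=; ring.
  have db : is_derive s (1 : R) (fun s => s * b) b by apply: is_derive_eq; rewrite /GRing.scale/=; ring.
  have dSb := @is_derive1_comp R (S xi N) (fun s => s * b) _ _ _ dS db.
  have dSb' : is_derive s (1 : R) (fun s => S xi N (s * b)) ((2 * xi * S xi N (s * b) + rest xi N (s * b)) * b) := dSb.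
  have dl : is_derive s (1 : R) (fun s => - (2 * b * xi) * s) (- (2 * b * xi)).
    by apply: is_derive_eq; rewrite /GRing.scale/=; ring.
  have dE := @is_derive1_comp R expR (fun s => - (2 * b * xi) * s) _ _ _ (is_derive_expR _) dl.
  have dE' : is_derive s (1 : R) (fun s => expR (- (2 * b * xi) * s)) (expR (- (2 * b * xi) * s) * - (2 * b * xi)) := dE.
  rewrite /e; apply: is_derive_eq; rewrite /GRing.scale/=; ring.
have e0 : e 0 = 0.
  rewrite /e mulr0 expR0 mul1r mul0r /S big_nat_recl// big1 ?addr0; last first.
    by move=> i _; rewrite /phi exprS !mul0r mulr0.
  by rewrite /phi expr0 expr0n /= bser0 addr0 !mul1r subrr.
have e1 : `|e 1| <= b * expR (2 * b) * rho N.
  apply: (@bound_primitive _ e _ _ e0 D); last by rewrite ler01 lexx.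
  move=> s s01; have /andP[s0 s1] := s01.
  have sb : 0 <= s * b <= b by rewrite mulr_ge0 ?ler_piMl// ltW.
  rewrite normrM ler_pM//; last exact: rest_le.
  rewrite normrM (gtr0_norm b0) gtr0_norm ?expR_gt0// ler_wpM2l ?(ltW b0)// ler_expR.
  rewrite mulNr mulrAC -mulNr.
  have b2 : 0 <= 2 * b * s by rewrite !mulr_ge0// ltW.
  have := xb _ b2; rewrite ler_norml => /andP[h _]; rewrite mulNr.
  rewrite lerNl; apply: le_trans h; rewrite lerN2 ler_piMr//.
  by apply: mulr_ge0 => //; exact: ltW.
have -> : S xi N b - rGamma (nu + 1) * expR (2 * b * xi) = expR (2 * b * xi) * e 1.
  by rewrite /e mulr1 mul1r mulrBr mulrA -expRD subrr expR0 mul1r [_ * rGamma _]mulrC.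
rewrite normrM gtr0_norm ?expR_gt0// ler_pM ?expR_ge0//.
rewrite ler_expR; have b2 : 0 <= 2 * b by rewrite mulr_ge0// ltW.
exact: le_trans (ler_norm _) (xb _ b2).
Qed.

End PlaneWave.

(** * Stopped Brownian motion *)

Section LowerIntegral.
Local Open Scope ereal_scope.
Context d (T : measurableType d) (R : realType) (mu : {measure set T -> \bar R}).

(* The integral of a nonnegative function is a supremum over simple functions
   below it, so that measurability is not needed here. *)
Lemma ge0_le_lower_integral (f g : T -> \bar R) : (forall w, 0 <= f w) ->
  (forall w, f w <= g w) -> \int[mu]_w f w <= \int[mu]_w g w.
Proof.
move=> f0 fg; have g0 w : 0 <= g w by exact: le_trans (fg w).
rewrite !ge0_integralTE//; apply: ereal_sup_le => _ [h hf <-].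
by exists h => // w; apply: le_trans (fg w); exact: hf.
Qed.

(** The integral is squeezed between that of [f] cut to 0 off [G] and that of a measurable majorant,
    infinite off [G]; both equal the integral over [G]. *)
Lemma ge0_integral_conull (f : T -> \bar R) (G : set T) : measurable G -> mu (~` G) = 0 ->
  (forall w, 0 <= f w) -> measurable_fun G f -> \int[mu]_w f w = \int[mu]_(w in G) f w.
Proof.
move=> mG G0 f0 mf; pose g w := if w \in G then f w else +oo.
have gG : {in G, g =1 f} by move=> w wG; rewrite /g wG.
have mg : measurable_fun setT g.
  rewrite -(setUv G); apply/measurable_funU => //; first exact: measurableC.
  split; first by apply: (eq_measurable_fun f) => // w wG; rewrite gG.
  apply: (eq_measurable_fun (cst +oo)); last exact: measurable_cst.
  by move=> w; rewrite in_setC /g => /negPf ->.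
have g0 w : 0 <= g w by rewrite /g; case: ifP.
apply/eqP; rewrite eq_le; apply/andP; split; last first.
  rewrite integral_mkcond; apply: ge0_le_lower_integral => w; rewrite patchE; case: ifP => //.
apply: (@le_trans _ _ (\int[mu]_w g w)).
  by apply: ge0_le_lower_integral => // w; rewrite /g; case: ifP => // _; rewrite leey.
rewrite (@ge0_negligible_integral _ _ _ mu setT (~` G))//; last exact: measurableC.
by rewrite setTD setCK (eq_integral f).
Qed.

End LowerIntegral.

Section EuclideanNorm.
Context (R : realType) (d : nat).
Implicit Types (a y z : 'rV[R]_d).

Lemma dotvC a y : dotv a y = dotv y a.
Proof. by apply: eq_bigr => i _; rewrite mulrC. Qed.

Lemma dotvDr a y z : dotv a (y + z) = dotv a y + dotv a z.
Proof. by rewrite -big_split; apply: eq_bigr => i _; rewrite mxE mulrDr. Qed.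

Lemma dotvZr c a y : dotv a (c *: y) = c * dotv a y.
Proof. by rewrite mulr_sumr; apply: eq_bigr => i _; rewrite mxE mulrCA. Qed.

Lemma dotvZl c a y : dotv (c *: a) y = c * dotv a y.
Proof. by rewrite dotvC dotvZr dotvC. Qed.

Lemma enorm_sqr y : enorm y ^+ 2 = dotv y y.
Proof. by rewrite sqr_sqrtr// dotv_ge0. Qed.

Lemma enorm_ge0 y : 0 <= enorm y.
Proof. exact: sqrtr_ge0. Qed.

Lemma enorm_gt0 y : y != 0 -> 0 < enorm y.
Proof.
move=> y0; rewrite lt_neqAle enorm_ge0 andbT eq_sym sqrtr_eq0 -ltNge.
have [i yi] : exists i, y 0 i != 0.
  apply: contrapT => H; move/eqP: y0; apply; apply/rowP => i; rewrite mxE.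
  by apply/eqP/negPn/negP => yi; apply: H; exists i.
rewrite /dotv (bigD1 i)//= ltr_pwDl// -?expr2 ?exprn_even_gt0//.
by apply: sumr_ge0 => j _; rewrite -expr2 sqr_ge0.
Qed.

(** Cauchy-Schwarz, from the nonnegativity of the squared norm of y - <a,y> a. *)
Lemma norm_dotv a y : dotv a a = 1 -> `|dotv a y| <= enorm y.
Proof.
move=> a1; rewrite -(ler_pXn2r (ltn0Sn 1)) ?nnegrE ?enorm_ge0// enorm_sqr real_normK ?num_real//.
have := dotv_ge0 (y + (- dotv a y) *: a).
rewrite dotvDr [dotv (_ + _) y]dotvC [dotv (_ + _) (_ *: a)]dotvC.
by rewrite !dotvDr !dotvZr !dotvZl a1 [dotv y a]dotvC; lra.
Qed.

Lemma norm_coord y i : `|y 0 i| <= enorm y.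
Proof.
rewrite -(ler_pXn2r (ltn0Sn 1)) ?nnegrE ?enorm_ge0// enorm_sqr real_normK ?num_real//.
exact: coord_sq_le.
Qed.

Lemma norm_dotv_sum y z : `|dotv y z| <= enorm y * \sum_(i < d) `|z 0 i|.
Proof.
rewrite mulr_sumr; apply: le_trans (ler_norm_sum _ _ _) _.
by apply: ler_sum => i _; rewrite normrM ler_wpM2r// norm_coord.
Qed.

Lemma enorm_le_sum z : enorm z <= \sum_(i < d) `|z 0 i|.
Proof.
have s0 : 0 <= \sum_(i < d) `|z 0 i| by exact: sumr_ge0.
have [e0|e0] := leP (enorm z) 0; first exact: le_trans s0.
rewrite -(ler_pM2l e0) -expr2 enorm_sqr; apply: le_trans (norm_dotv_sum z z).
exact: ler_norm.
Qed.

End EuclideanNorm.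

Lemma continuous_maxl (R : realType) (c : R) : continuous (fun q : R => Num.max c q).
Proof. by move=> y; apply: continuous_max => //; exact: cvg_cst. Qed.

(** * The inner and outer radial solutions, and the Gegenbauer coefficients at the hitting time *)

Section StoppedGegenbauer.
Context (disp : measure_display) (T : measurableType disp) (R : realType).
Context (P : probability T R) (d : nat) (x : 'rV[R]_d) (B : R -> T -> 'rV[R]_d).
Hypothesis hB : brownian_motion P x B.
Context (r lambda : R).
Hypotheses (r0 : 0 < r) (lambda0 : 0 < lambda).
Context (G : set T).
Hypotheses (mG : measurable G) (PG : P G = 1%E).
Hypothesis G0 : forall w, G w -> B 0 w = x.
Hypothesis Gc : forall w, G w -> {within `[0, +oo[, continuous (B ^~ w)}.
Context (nu : R) (a : 'rV[R]_d).
Hypotheses (nuE : nu = (d%:R - 2) / 2) (nu0 : 0 <= nu) (a1 : dotv a a = 1).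
Hypotheses (x0 : 0 < enorm x) (xr : enorm x != r).
Context (n : nat).
Let rho := nu + n%:R.
Let c := lambda / 2.

Let c0 : 0 < c. Proof. by rewrite divr_gt0. Qed.
Let rho0 : 0 <= rho. Proof. by rewrite addr_ge0. Qed.

Definition phi_in (k : nat) (q : R) := c ^+ k * bser (rho + k%:R) (c * q).

(** The k-th derivative of q -> [bint (- rho) (c * q)]. Order -rho is chosen since w^(-rho/2) K_rho
    is the counterpart of [bser rho], and differentiation lowers the order of [bint]. *)
Definition phi_out (k : nat) (q : R) := (- c) ^+ k * bint (- (rho + k%:R)) (c * q).

Let dmul q : is_derive q (1 : R) (fun q => c * q) c.
Proof. by apply: is_derive_eq; rewrite /GRing.scale/=; ring. Qed.

Lemma is_derive_phi_in k q : is_derive q (1 : R) (phi_in k) (phi_in k.+1 q).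
Proof.
have d1 := @is_derive1_comp R (bser (rho + k%:R)) (fun q => c * q) _ _ _ (is_derive_bser _ (c * q)) (dmul q).
have d2 : is_derive q (1 : R) (fun q => bser (rho + k%:R) (c * q)) (bser (rho + k%:R + 1) (c * q) * c) := d1.
rewrite /phi_in; apply: is_derive_eq; rewrite /GRing.scale/= exprS -natr1 addrA; ring.
Qed.

Lemma is_derive_phi_out k (q : R) : 0 < q -> is_derive q (1 : R) (phi_out k) (phi_out k.+1 q).
Proof.
move=> q0; have cq : 0 < c * q by rewrite mulr_gt0.
have d1 := @is_derive1_comp R (bint (- (rho + k%:R))) (fun q => c * q) _ _ _ (is_derive_bint _ cq) (dmul q).
have d2 : is_derive q (1 : R) (fun q => bint (- (rho + k%:R)) (c * q))
  (- bint (- (rho + k%:R) - 1) (c * q) * c) := d1.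
rewrite /phi_out; apply: is_derive_eq; rewrite /GRing.scale/= exprS -natr1 addrA [in RHS]opprD; ring.
Qed.

Lemma continuous_phi_out_max k (q0 : R) : 0 < q0 ->
  continuous (fun q : R => phi_out k (Num.max q0 q)).
Proof.
move=> q00 q; have qm : 0 < Num.max q0 q by rewrite lt_max q00.
have [dk _] := is_derive_phi_out k qm.
have ck : {for Num.max q0 q, continuous (phi_out k)}.
  by apply: differentiable_continuous; apply/derivable1_diffP.
apply: (@cvg_comp _ _ _ (fun q : R => Num.max q0 q) (phi_out k) _ (nbhs (Num.max q0 q : R))).
  exact: continuous_maxl.
exact: ck.
Qed.

Lemma ode_in q : 2 * q * phi_in 2 q + (d%:R + 2 * n%:R) * phi_in 1 q = lambda * phi_in 0 q.
Proof.
have rec := bser_rec (rho + 1) (c * q); rewrite addrK in rec.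
rewrite /phi_in addr0 rec -[1%:R]/(1 : R) (_ : rho + 2%:R = rho + 1 + 1); last by ring.
have -> : d%:R = 2 * nu + 2 by rewrite nuE; field.
by rewrite /rho /c; field.
Qed.

Lemma ode_out q : 0 < q ->
  2 * q * phi_out 2 q + (d%:R + 2 * n%:R) * phi_out 1 q = lambda * phi_out 0 q.
Proof.
move=> q0; have cq : 0 < c * q by rewrite mulr_gt0.
have rec := bint_rec (- (rho + 1)) cq.
rewrite /phi_out addr0 -[1%:R]/(1 : R).
rewrite (_ : - (rho + 2%:R) = - (rho + 1) - 1); last by ring.
rewrite (_ : - (rho + 1) + 1 = - rho) in rec; last by ring.
move/eqP: rec; rewrite addrAC subr_eq0 => /eqP <-.
have -> : d%:R = 2 * nu + 2 by rewrite nuE; field.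
by rewrite /rho /c; field.
Qed.

Lemma stopped_ageg_radial (phi : nat -> R -> R) : phi 0%N (r ^+ 2) != 0 ->
  measurable_fun G (stopped_harm B r lambda nu a phi n) ->
  (\int[P]_(w in G) stopped_harm B r lambda nu a phi n w)%R =
    ev phi (harm nu a n) x * (phi 0%N (dotv x x) / phi 0%N (r ^+ 2)) ->
  phi 0%N (dotv x x) / phi 0%N (r ^+ 2) = r `^ rho / enorm x `^ rho * Zratio rho lambda (enorm x) r ->
  measurable_fun G (stopped B r lambda (fun y => ageg nu (dotv a y / r) n)) /\
  (\int[P]_(w in G) stopped B r lambda (fun y => ageg nu (dotv a y / r) n) w)%R =
    r `^ nu / enorm x `^ nu * ageg nu (dotv a x / enorm x) n * Zratio rho lambda (enorm x) r.
Proof.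
move=> phir ms es ez.
have E w : G w -> stopped B r lambda (fun y => ageg nu (dotv a y / r) n) w =
    r ^- n * stopped_harm B r lambda nu a phi n w.
  move=> Gw; rewrite /stopped_harm /stopped.
  have [[-> _]|[s [-> s0 bs _]]] := hitting_timeP r0 Gc Gw; first by rewrite mulr0.
  rewrite ev_harm// bs// mulrCA [r ^- n * _]mulrA mulVf ?mul1r// gt_eqF// exprn_gt0//.
split.
  apply: (eq_measurable_fun (fun w => r ^- n * stopped_harm B r lambda nu a phi n w)).
    by move=> w /set_mem Gw; rewrite E.
  by apply: measurable_funM => //; exact: measurable_cst.
transitivity (\int[P]_(w in G) (r ^- n * stopped_harm B r lambda nu a phi n w))%R.
  by apply: eq_Rintegral => w /set_mem Gw; rewrite E.
rewrite RintegralZl//; last first.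
  apply: measurable_bounded_integrable => //.
    by rewrite (le_lt_trans (probability_le1 _ mG))// ltry.
  exists (r ^+ n * (4 * (1 + nu)) ^+ n); split; first exact: num_real.
  have K0 : 0 <= r ^+ n * (4 * (1 + nu)) ^+ n.
    by rewrite mulr_ge0// ?exprn_ge0 ?(ltW r0)// mulr_ge0// addr_ge0.
  move=> N CN w Gw; rewrite /stopped_harm /stopped /=.
  have [[-> _]|[s [-> s0 bs _]]] := hitting_timeP r0 Gc Gw.
    by rewrite normr0 (le_trans K0)// ltW.
  rewrite normrM ger0_norm ?expR_ge0// (le_trans _ (ltW CN))//.
  rewrite -[leRHS]mul1r ler_pM ?expR_ge0//.
    by rewrite -expR0 ler_expR mulNr oppr_le0 mulr_ge0// ltW.
  rewrite ev_harm ?bs// normrM normrX (gtr0_norm r0) ler_wpM2l ?exprn_ge0 ?(ltW r0)//.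
  by apply: ageg_bound => //; rewrite normrM normfV (gtr0_norm r0) ler_pdivrMr// mul1r -bs norm_dotv.
rewrite es ez ev_harm// /rho !powRD; try by apply/implyP => _; rewrite gt_eqF.
rewrite !powR_mulrn ?ltW//.
have h1 : r ^+ n != 0 by rewrite gt_eqF// exprn_gt0.
have h2 : enorm x ^+ n != 0 by rewrite gt_eqF// exprn_gt0.
have h3 : enorm x `^ nu != 0 by rewrite gt_eqF// powR_gt0.
by field; rewrite h1 h2 h3.
Qed.

(** [F] is I or K. At t sqrt(2 lambda) the squared half-argument is c t^2, and the constant and the
    power of sqrt(2 lambda)/2 cancel in the quotient. *)
Lemma bessel_ratio (F g : R -> R) (k : R) : k != 0 -> g (c * r ^+ 2) != 0 ->
  (forall z, 0 < z -> F z = k * ((z / 2) `^ rho * g ((z / 2) ^+ 2))) ->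
  g (c * dotv x x) / g (c * r ^+ 2) = r `^ rho / enorm x `^ rho *
    (F (enorm x * Num.sqrt (2 * lambda)) / F (r * Num.sqrt (2 * lambda))).
Proof.
move=> k0 g0 FE; have l2 : 0 < 2 * lambda by rewrite mulr_gt0.
have s0 : 0 < Num.sqrt (2 * lambda) by rewrite sqrtr_gt0.
have FtE t : 0 < t -> F (t * Num.sqrt (2 * lambda)) =
    k * (t `^ rho * (Num.sqrt (2 * lambda) / 2) `^ rho * g (c * t ^+ 2)).
  move=> t0; rewrite FE ?mulr_gt0//.
  rewrite -[t * _ / 2]mulrA powRM ?(ltW t0) ?divr_ge0 ?(ltW s0)//; congr (_ * (_ * g _)).
  by rewrite exprMn exprMn sqr_sqrtr ?(ltW l2)// /c; field.
rewrite !FtE// enorm_sqr.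
have h1 : r `^ rho != 0 by rewrite gt_eqF// powR_gt0.
have h2 : enorm x `^ rho != 0 by rewrite gt_eqF// powR_gt0.
have h3 : (Num.sqrt (2 * lambda) / 2) `^ rho != 0 by rewrite gt_eqF// powR_gt0// divr_gt0.
move: (r `^ rho) (enorm x `^ rho) (_ `^ rho) h1 h2 h3 => p q s h1 h2 h3.
by field; rewrite h1 h2 h3 k0 g0.
Qed.

Lemma Zratio_in : enorm x < r ->
  phi_in 0 (dotv x x) / phi_in 0 (r ^+ 2) = r `^ rho / enorm x `^ rho * Zratio rho lambda (enorm x) r.
Proof.
move=> lt; rewrite /phi_in /Zratio ltNge (ltW lt)/= expr0 !mul1r addr0.
apply: (@bessel_ratio (besselI rho) (bser rho) 1) => //.
  rewrite gt_eqF// bser_gt0//; first by apply: lt_le_trans rho0; rewrite ltrN10.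
  by rewrite mulr_ge0 ?sqr_ge0// ltW.
by move=> z z0; rewrite besselI_bser// mul1r.
Qed.

Lemma Zratio_out : r < enorm x ->
  phi_out 0 (dotv x x) / phi_out 0 (r ^+ 2) = r `^ rho / enorm x `^ rho * Zratio rho lambda (enorm x) r.
Proof.
move=> lt; rewrite /phi_out /Zratio lt expr0 !mul1r addr0.
have [k k0 kE] := besselKE rho0.
apply: (@bessel_ratio (besselK rho) (bint (- rho)) k) => //.
have cr : 0 < c * r ^+ 2 by rewrite mulr_gt0// exprn_gt0.
by rewrite gt_eqF// bint_gt0// ?cr ?orbT// ltW.
Qed.

Lemma stopped_ageg_in : enorm x < r ->
  measurable_fun G (stopped B r lambda (fun y => ageg nu (dotv a y / r) n)) /\
  (\int[P]_(w in G) stopped B r lambda (fun y => ageg nu (dotv a y / r) n) w)%R =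
    r `^ nu / enorm x `^ nu * ageg nu (dotv a x / enorm x) n * Zratio rho lambda (enorm x) r.
Proof.
move=> lt.
have r2 : 0 < r ^+ 2 by rewrite exprn_gt0.
have pr : phi_in 0 (r ^+ 2) != 0.
  rewrite /phi_in expr0 mul1r addr0 gt_eqF// bser_gt0//; last by rewrite mulr_ge0// ltW.
  by apply: lt_le_trans rho0; rewrite ltrN10.
have [ms es] : measurable_fun G (stopped_harm B r lambda nu a phi_in n) /\
  (\int[P]_(w in G) stopped_harm B r lambda nu a phi_in n w)%R =
    ev phi_in (harm nu a n) x * (phi_in 0 (dotv x x) / phi_in 0 (r ^+ 2)).
  (* From |y| < r, a step of size at most r ends within 2r of the origin: hence the margin 4 r^2 for
     the squared norm. *)
  apply: (@stopped_harm_expectation _ _ _ _ _ _ _ hB r lambda r0 lambda0 G mG PG G0 Gc nu a nuE nu0 a1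
    phi_in `]-oo, 4 * r ^+ 2]%classic [set q | q < r ^+ 2] r).
  - by move=> k q _; exact: is_derive_phi_in.
  - move=> k m; exists ((1 + 4 * r ^+ 2) ^+ m * (c ^+ k * (rGamma (rho + k%:R + 1) * expR (c * (4 * r ^+ 2))))).
    move=> q q0; rewrite /= in_itv/= => q4.
    have rk : 0 <= rho + k%:R by rewrite addr_ge0.
    have cq : 0 <= c * q by rewrite mulr_ge0// ltW.
    have b0 : 0 < bser (rho + k%:R) (c * q).
      by rewrite bser_gt0//; apply: lt_le_trans rk; rewrite ltrN10.
    rewrite /phi_in ger0_norm; last by rewrite mulr_ge0 ?exprn_ge0// ltW.
    rewrite ler_pM ?exprn_ge0 ?mulr_ge0 ?exprn_ge0 ?addr_ge0 ?(ltW b0) ?(ltW c0)//.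
      by rewrite lerXn2r ?nnegrE ?addr_ge0 ?lerD2l// mulr_ge0// ltW.
    rewrite ler_wpM2l ?exprn_ge0 ?(ltW c0)//; apply: le_trans (bser_le rk cq) _.
    have gp : 0 <= rGamma (rho + k%:R + 1) by rewrite ltW// rGamma_gt0// ltr_wpDl.
    by rewrite ler_wpM2l// ler_expR ler_wpM2l// ltW.
  - exact: measurable_itv.
  - move=> k; apply: measurable_funM; first exact: measurable_indic.
    apply: continuous_measurable_fun => q.
    have [dk _] := is_derive_phi_in k q.
    have ck : {for q, continuous (phi_in k)} by apply: differentiable_continuous; apply/derivable1_diffP.
    exact: ck.
  - rewrite (_ : [set q | q < r ^+ 2] = `]-oo, r ^+ 2[%classic); first exact: measurable_itv.
    by apply/seteqP; split => q /=; rewrite in_itv.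
  - exact: r0.
  - move=> y h t /= yr hr /andP[t0 t1]; rewrite in_itv/=.
    have yl : enorm y <= r by rewrite -(ler_pXn2r (ltn0Sn 1)) ?nnegrE ?enorm_ge0 ?(ltW r0)// enorm_sqr ltW.
    have hl : enorm h <= r by exact: le_trans (enorm_le_sum h) hr.
    have yh : dotv y h <= r * r.
      apply: le_trans (ler_norm _) _; apply: le_trans (norm_dotv_sum y h) _.
      by rewrite ler_pM ?enorm_ge0 ?sumr_ge0.
    have hh : dotv h h <= r * r by rewrite -enorm_sqr expr2 ler_pM ?enorm_ge0.
    have hh0 := dotv_ge0 h.
    rewrite dotvDr [dotv _ y]dotvC [dotv _ (t *: h)]dotvC !dotvDr !dotvZr !dotvZl [dotv h y]dotvC.
    move: yr; rewrite expr2 => yr.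
    have tt : t * t <= 1 by rewrite -[leRHS]mul1r ler_pM.
    have e1 : t * dotv y h <= r * r.
      apply: (@le_trans _ _ (t * (r * r))); first by rewrite ler_wpM2l.
      by rewrite ler_piMl// mulr_ge0// ltW.
    have e2 : t * (t * dotv h h) <= r * r.
      by rewrite mulrA; apply: le_trans hh; rewrite ler_piMl.
    lra.
  - by near=> q; rewrite /= in_itv/=; apply: ltW; near: q; apply: lt_nbhsl; lra.
  - by left; split => //; rewrite -enorm_sqr ltr_pXn2r// nnegrE ?enorm_ge0// ltW.
  - by move=> q _; exact: ode_in.
  - exact: pr.
by apply: stopped_ageg_radial ms es _ => //; exact: Zratio_in.
Unshelve. all: by end_near. Qed.

Lemma stopped_ageg_out : r < enorm x ->
  measurable_fun G (stopped B r lambda (fun y => ageg nu (dotv a y / r) n)) /\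
  (\int[P]_(w in G) stopped B r lambda (fun y => ageg nu (dotv a y / r) n) w)%R =
    r `^ nu / enorm x `^ nu * ageg nu (dotv a x / enorm x) n * Zratio rho lambda (enorm x) r.
Proof.
move=> lt.
have r2 : 0 < r ^+ 2 by rewrite exprn_gt0.
pose q0 := r ^+ 2 / 2; have q00 : 0 < q0 by rewrite divr_gt0.
have cq00 : 0 < c * q0 by rewrite mulr_gt0.
have pr : phi_out 0 (r ^+ 2) != 0.
  have cr : 0 < c * r ^+ 2 by rewrite mulr_gt0.
  by rewrite /phi_out expr0 mul1r addr0 gt_eqF// bint_gt0 ?cr ?orbT// ltW.
have [ms es] : measurable_fun G (stopped_harm B r lambda nu a phi_out n) /\
  (\int[P]_(w in G) stopped_harm B r lambda nu a phi_out n w)%R =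
    ev phi_out (harm nu a n) x * (phi_out 0 (dotv x x) / phi_out 0 (r ^+ 2)).
  (* From |y| > r, a step of size at most r/4 leaves a squared norm of at least |y|^2 - |y| r/2 >
     r^2/2, away from the singularity at 0. *)
  apply: (@stopped_harm_expectation _ _ _ _ _ _ _ hB r lambda r0 lambda0 G mG PG G0 Gc nu a nuE nu0 a1
    phi_out `[q0, +oo[%classic [set q | r ^+ 2 < q] (r / 4)).
  - by move=> k q; rewrite /= in_itv/= andbT => /(lt_le_trans q00); exact: is_derive_phi_out.
  - move=> k m; have [C HC] := bint_decay (- (rho + k%:R)) m cq00.
    (* Chosen so that 1 + q <= A c q for q >= q0, which reduces the weight to that of
       [bint_decay]. *)
    pose A := (1 / q0 + 1) / c; have A0 : 0 < A.
      by rewrite divr_gt0// addr_gt0// divr_gt0.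
    exists (A ^+ m * (c ^+ k * C)) => q qp; rewrite /= in_itv/= andbT => q0q.
    have cq : c * q0 <= c * q by rewrite ler_wpM2l// ltW.
    have cqp : 0 < c * q by exact: lt_le_trans cq.
    have b0 : 0 < bint (- (rho + k%:R)) (c * q) by rewrite bint_gt0 ?cqp ?orbT// ltW.
    have qA : 1 + q <= A * (c * q).
      have -> : A * (c * q) = q / q0 + q.
        by rewrite /A; move: (c) (q0) c0 q00 => u v u0 v0; field; rewrite !gt_eqF.
      by rewrite lerD2r ler_pdivlMr// mul1r.
    rewrite /phi_out normrM normrX normrN (gtr0_norm c0) (gtr0_norm b0).
    apply: (@le_trans _ _ ((A * (c * q)) ^+ m * (c ^+ k * bint (- (rho + k%:R)) (c * q)))).
      rewrite ler_wpM2r ?mulr_ge0 ?exprn_ge0 ?(ltW b0) ?(ltW c0)//.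
      by rewrite lerXn2r ?nnegrE ?addr_ge0// (le_trans _ qA)// addr_ge0.
    rewrite exprMn -mulrA ler_wpM2l ?exprn_ge0 ?(ltW A0)// mulrCA.
    by rewrite ler_wpM2l ?exprn_ge0 ?(ltW c0)// HC.
  - exact: measurable_itv.
  - move=> k; rewrite (_ : (fun q => _) = fun q => \1_`[q0, +oo[ q * phi_out k (Num.max q0 q)); last first.
      apply/funext => q; rewrite indicE; case: (boolP (q \in _)); last by rewrite !mul0r.
      by rewrite inE/= in_itv/= andbT => h; rewrite max_r.
    apply: measurable_funM; first exact: measurable_indic.
    by apply: continuous_measurable_fun => q; exact: continuous_phi_out_max.
  - rewrite (_ : [set q | r ^+ 2 < q] = `]r ^+ 2, +oo[%classic); first exact: measurable_itv.
    by apply/seteqP; split => q /=; rewrite in_itv/= andbT.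
  - by rewrite divr_gt0.
  - move=> y h t /= yr hr /andP[t0 t1]; rewrite in_itv/= andbT.
    have yl : r < enorm y by rewrite -(ltr_pXn2r (ltn0Sn 1)) ?nnegrE ?enorm_ge0 ?(ltW r0)// enorm_sqr.
    have yh : `|dotv y h| <= enorm y * (r / 4).
      by apply: le_trans (norm_dotv_sum y h) _; rewrite ler_wpM2l ?enorm_ge0.
    have hh0 := dotv_ge0 h.
    rewrite dotvDr [dotv _ y]dotvC [dotv _ (t *: h)]dotvC !dotvDr !dotvZr !dotvZl [dotv h y]dotvC.
    have e1 : `|t * dotv y h| <= enorm y * (r / 4).
      by rewrite normrM (ger0_norm t0); apply: le_trans yh; rewrite ler_piMl.
    have e2 : 0 <= t * (t * dotv h h) by rewrite !mulr_ge0.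
    move: e1; rewrite ler_norml => /andP[e1 _].
    rewrite -[dotv y y]enorm_sqr /q0; move: yl e1 e2.
    move: (enorm y) (t * dotv y h) (t * (t * dotv h h)) => Y u w Yr e1 e2.
    have rr := r0; nra.
  - by near=> q; rewrite /= in_itv/= andbT; apply: ltW; near: q; apply: lt_nbhsr; rewrite /q0; lra.
  - by right; split => //; rewrite -enorm_sqr ltr_pXn2r// nnegrE ?enorm_ge0// ltW.
  - by move=> q; rewrite /= in_itv/= andbT => /(lt_le_trans q00); exact: ode_out.
  - exact: pr.
by apply: stopped_ageg_radial ms es _ => //; exact: Zratio_out.
Unshelve. all: by end_near. Qed.

Lemma stopped_ageg :
  measurable_fun G (stopped B r lambda (fun y => ageg nu (dotv a y / r) n)) /\
  (\int[P]_(w in G) stopped B r lambda (fun y => ageg nu (dotv a y / r) n) w)%R =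
    r `^ nu / enorm x `^ nu * ageg nu (dotv a x / enorm x) n * Zratio rho lambda (enorm x) r.
Proof.
have [lt|lt|e] := ltgtP (enorm x) r; [exact: stopped_ageg_in|exact: stopped_ageg_out|].
by move/eqP: xr; rewrite e.
Qed.

End StoppedGegenbauer.

Section StoppedExponential.
Context (disp : measure_display) (T : measurableType disp) (R : realType).
Context (P : probability T R) (d : nat) (x v : 'rV[R]_d) (B : R -> T -> 'rV[R]_d).
Hypothesis hB : brownian_motion P x B.
Context (r lambda : R).
Hypotheses (r0 : 0 < r) (lambda0 : 0 < lambda).
Context (G : set T).
Hypotheses (mG : measurable G) (PG : P G = 1%E).
Hypothesis G0 : forall w, G w -> B 0 w = x.
Hypothesis Gc : forall w, G w -> {within `[0, +oo[, continuous (B ^~ w)}.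
Context (nu : R).
Hypotheses (nuE : nu = (d%:R - 2) / 2) (nu0 : 0 <= nu).
Hypotheses (x0 : 0 < enorm x) (xr : enorm x != r) (v0 : 0 < enorm v).

Let a := (enorm v)^-1 *: v.
Let b := enorm v * r / 2.
Let alpha := dotv v x / (enorm v * enorm x).
Let coef n := b ^+ n * bser (nu + n%:R) (b ^+ 2).
Let term n := r `^ nu / enorm x `^ nu * ageg nu alpha n * Zratio (nu + n%:R) lambda (enorm x) r.

Let a1 : dotv a a = 1.
Proof. by rewrite dotvZl dotvZr -enorm_sqr expr2; field; rewrite gt_eqF. Qed.

Let b0 : 0 < b.
Proof. by rewrite divr_gt0// mulr_gt0. Qed.

Let stopped_n n w := stopped B r lambda (fun y => ageg nu (dotv a y / r) n) w.

Let stopped_n_expectation n : measurable_fun G (stopped_n n) /\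
  (\int[P]_(w in G) stopped_n n w)%R = term n.
Proof.
have [mu_ eu] := stopped_ageg hB r0 lambda0 mG PG G0 Gc nuE nu0 a1 x0 xr n.
split; first exact: mu_.
rewrite /stopped_n eu /term; congr (_ * _ * _); congr ageg.
by rewrite /alpha dotvZl invfM mulrA [_^-1 * _]mulrC.
Qed.

Let bounded_integrable (f : T -> R) C : measurable_fun G f ->
  (forall w, G w -> `|f w| <= C) -> P.-integrable G (EFin \o f).
Proof.
move=> mf fC; apply: measurable_bounded_integrable => //.
  by rewrite (le_lt_trans (probability_le1 _ mG))// ltry.
exists C; split; first exact: num_real.
by move=> N CN w Gw; exact: le_trans (fC w Gw) (ltW CN).
Qed.

Let exp_le1 s : 0 <= s -> expR (- lambda * s) <= 1.
Proof. by move=> s0; rewrite -expR0 ler_expR mulNr oppr_le0 mulr_ge0// ltW. Qed.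

Let cosine y : enorm y = r -> `|dotv a y / r| <= 1.
Proof.
move=> yr; rewrite normrM normfV (gtr0_norm r0) ler_pdivrMr// mul1r -yr.
exact: norm_dotv.
Qed.

Let stopped_n_integrable n : P.-integrable G (EFin \o stopped_n n).
Proof.
apply: (@bounded_integrable _ ((4 * (1 + nu)) ^+ n)); first by have [] := stopped_n_expectation n.
have K0 : 0 <= (4 * (1 + nu)) ^+ n by rewrite exprn_ge0// mulr_ge0// addr_ge0.
move=> w Gw; rewrite /stopped_n /stopped.
have [[-> _]|[s [-> s0 bs _]]] := hitting_timeP r0 Gc Gw; first by rewrite normr0.
rewrite normrM ger0_norm ?expR_ge0// -[leRHS]mul1r ler_pM ?expR_ge0 ?exp_le1//.
by apply: ageg_bound => //; exact: cosine.
Qed.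

Let partial N w := \sum_(0 <= n < N) coef n * stopped_n n w.

Let partial_integrable N : P.-integrable G (EFin \o partial N) /\
  (\int[P]_(w in G) partial N w)%R = \sum_(0 <= n < N) coef n * term n.
Proof.
have E k w : partial k.+1 w = partial k w + coef k * stopped_n k w.
  by rewrite /partial big_nat_recr.
have Z k : P.-integrable G (EFin \o (fun w => coef k * stopped_n k w)).
  by have := integrableZl mG (coef k) (stopped_n_integrable k); exact.
elim: N => [|N [IH1 IH2]].
  have -> : partial 0 = cst 0 by apply/funext => w; rewrite /partial big_nil.
  by split; [exact: integrable0|rewrite big_nil Rintegral_cst// mul0r].
have -> : partial N.+1 = fun w => partial N w + coef N * stopped_n N w by exact/funext.
split; first by have := integrableD mG IH1 (Z N); exact.
have [_ eN] := stopped_n_expectation N.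
have EN : (\int[P]_(w in G) (coef N * stopped_n N w))%R = coef N * term N.
  by rewrite -eN; apply: RintegralZl => //; exact: stopped_n_integrable.
by rewrite (RintegralD mG IH1 (Z N)) EN IH2 big_nat_recr.
Qed.

Let f w := stopped_exponential v lambda r B w.

Lemma stopped_exponential_expectation : exists2 m : R,
  ('E_P[stopped_exponential v lambda r B])%E = m%:E &
  (\sum_(0 <= n < N) coef n * term n) @[N --> \oo] --> rGamma (nu + 1) * m.
Proof.
have [eps [eps0 epsE]] := plane_wave nu0 b0.
have g0 : 0 < rGamma (nu + 1) by rewrite rGamma_gt0// ltr_wpDl.
have approx N w : G w -> `|partial N w - rGamma (nu + 1) * f w| <= eps N.
  move=> Gw; have e0 : 0 <= eps N.
    have z1 : `|0 : R| <= 1 by rewrite normr0.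
    exact: le_trans (normr_ge0 _) (epsE N 0 z1).
  rewrite /partial /f /stopped_exponential /stopped_n /stopped.
  have [[-> _]|[s [-> s0 bs _]]] := hitting_timeP r0 Gc Gw.
    by rewrite mulr0 subr0 big1 ?normr0// => n _; rewrite mulr0.
  have -> : dotv v (B s w) - lambda * s = - lambda * s + 2 * b * (dotv a (B s w) / r).
    by rewrite /b /a dotvZl; field; rewrite !gt_eqF.
  rewrite expRD.
  rewrite (_ : _ - _ = expR (- lambda * s) *
    (\sum_(0 <= n < N) ageg nu (dotv a (B s w) / r) n * coef n
       - rGamma (nu + 1) * expR (2 * b * (dotv a (B s w) / r)))); last first.
    rewrite mulrBr mulr_sumr [X in _ = _ - X]mulrCA; congr (_ - _).
    by apply: eq_bigr => n _; rewrite mulrCA [coef n * _]mulrC.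
  rewrite normrM ger0_norm ?expR_ge0// -[leRHS]mul1r ler_pM ?expR_ge0 ?exp_le1//.
  by apply: epsE; exact: cosine.
have mf : measurable_fun G f.
  apply: (@measurable_fun_cvg _ _ _ G (fun N w => (rGamma (nu + 1))^-1 * partial N w)).
    move=> N; apply: measurable_funM; first exact: measurable_cst.
    have [i _] := partial_integrable N.
    by apply/measurable_EFinP; exact: measurable_int i.
  move=> w Gw /=.
  have c : partial N w - rGamma (nu + 1) * f w @[N --> \oo] --> 0.
    apply/cvgr0Pnorm_le => e e0; near=> N; apply: le_trans (approx N w Gw) _.
    apply: le_trans (ler_norm _) _; near: N.
    by move/cvgr0Pnorm_le: eps0; exact.
  have -> : f w = (rGamma (nu + 1))^-1 * (0 + rGamma (nu + 1) * f w).
    by rewrite add0r mulrA mulVf ?mul1r// gt_eqF.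
  apply: cvgM; first exact: cvg_cst.
  rewrite (_ : partial ^~ w = fun N => (partial N w - rGamma (nu + 1) * f w) + rGamma (nu + 1) * f w).
    by apply: cvgD; [exact: c|exact: cvg_cst].
  by apply/funext => N; rewrite subrK.
have f0 w : 0 <= f w by rewrite /f /stopped_exponential; case: hitting_time => // s; exact: expR_ge0.
have fi : P.-integrable G (EFin \o f).
  apply: (@bounded_integrable _ (expR (2 * b))) => // w Gw; rewrite ger0_norm// /f /stopped_exponential.
  have [[-> _]|[s [-> s0 bs _]]] := hitting_timeP r0 Gc Gw; first exact: expR_ge0.
  rewrite ler_expR.
  have -> : dotv v (B s w) = 2 * b * (dotv a (B s w) / r).
    by rewrite /b /a dotvZl; field; rewrite !gt_eqF.
  have := cosine bs; rewrite ler_norml => /andP[_ h].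
  have b2 : 0 <= 2 * b by rewrite mulr_ge0// ltW.
  have := ler_wpM2l b2 h; have : 0 <= lambda * s by rewrite mulr_ge0// ltW.
  lra.
exists (\int[P]_(w in G) f w)%R.
  rewrite unlock (@ge0_integral_conull _ _ _ P _ G)//.
  - by rewrite /Rintegral fineK//; exact: integrable_fin_num.
  - by have := @probability_setC _ _ _ P G mG; rewrite PG subee.
  - exact/measurable_EFinP.
have gi : P.-integrable G (EFin \o (fun w => rGamma (nu + 1) * f w)).
  by have := integrableZl mG (rGamma (nu + 1)) fi; exact.
apply/cvgrPdistC_le => e e0; near=> N.
have [i <-] := partial_integrable N.
have j : P.-integrable G (EFin \o (fun w => partial N w - rGamma (nu + 1) * f w)).
  by have := integrableB mG i gi; exact.
rewrite -RintegralZl// -RintegralB//.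
apply: le_trans (le_normr_Rintegral mG j) _.
apply: (@le_trans _ _ (\int[P]_(w in G) `|eps N|)%R).
  apply: le_Rintegral => //.
  - by have := integrable_norm j; exact.
  - by apply: (@bounded_integrable _ `|eps N|) => // w _; rewrite normr_id.
  - by move=> w Gw; exact: le_trans (approx N w Gw) (ler_norm _).
rewrite Rintegral_cst// [X in _ * fine X]PG /= mulr1; near: N.
by move/cvgr0Pnorm_le: eps0; exact.
Unshelve. all: by end_near. Qed.

End StoppedExponential.

Lemma brownian_good_paths (disp : measure_display) (T : measurableType disp) (R : realType)
    (P : probability T R) (d : nat) (x : 'rV[R]_d) (B : R -> T -> 'rV[R]_d) :
  brownian_motion P x B -> exists G : set T, [/\ measurable G, P G = 1%E,
    forall w, G w -> B 0 w = x &
    forall w, G w -> {within `[0, +oo[, continuous (B ^~ w)}].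
Proof.
move=> hB.
have [N1 [mN1 PN1 HN1]] := brownian_start hB.
have [N2 [mN2 PN2 HN2]] := brownian_continuous hB.
have mN : measurable (N1 `|` N2) by exact: measurableU.
have PN : P (N1 `|` N2) = 0%E.
  by rewrite -PN1; exact: measureU0.
exists (~` (N1 `|` N2)); split.
- exact: measurableC.
- by rewrite probability_setC// PN sube0.
- by move=> w Nw; apply: contrapT => h; apply: Nw; left; exact: HN1.
- by move=> w Nw; apply: contrapT => h; apply: Nw; right; exact: HN2.
Qed.

Theorem proposition3p2 (R : realType) (disp : measure_display)
    (T : measurableType disp) (P : probability T R)
    (d : nat) (r lambda : R) (x v : 'rV[R]_d) (B : R -> T -> 'rV[R]_d) :
  (2 <= d)%N -> 0 < r -> x != 0 -> enorm x != r -> v != 0 -> 0 < lambda ->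
  brownian_motion P x B ->
  let nu : R := (d%:R - 2) / 2 in
  let alpha : R := dotv v x / (enorm v * enorm x) in
  let term2 (n : nat) : R :=
    n%:R * gegenbauer 0 n alpha * besselI n%:R (enorm v * r)
      * Zratio n%:R lambda (enorm x) r in
  let term3 (n : nat) : R :=
    (nu + n%:R) * gegenbauer nu n alpha
      * (besselI (nu + n%:R) (enorm v * r) / (enorm v * enorm x) `^ nu)
      * Zratio (nu + n%:R) lambda (enorm x) r in
  (d = 2%N ->
     cvgn (fun N : nat => \sum_(1 <= n < N) term2 n) /\
     ('E_P[stopped_exponential v lambda r B])%E =
       (besselI 0 (enorm v * r) * Zratio 0 lambda (enorm x) r
         + limn (fun N : nat => \sum_(1 <= n < N) term2 n))%:E) /\
  ((3 <= d)%N ->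
     cvgn (fun N : nat => \sum_(0 <= n < N) term3 n) /\
     ('E_P[stopped_exponential v lambda r B])%E =
       (2 `^ nu * Gamma nu
         * limn (fun N : nat => \sum_(0 <= n < N) term3 n))%:E).
Proof.
move=> d2 r0 /enorm_gt0 x0 xr /enorm_gt0 v0 lambda0 hB nu alpha term2 term3.
have [G [mG PG G0 Gc]] := brownian_good_paths hB.
have nu0 : 0 <= nu by rewrite divr_ge0// subr_ge0 ler_nat.
have [m -> lim_m] :=
  stopped_exponential_expectation hB r0 lambda0 mG PG G0 Gc (erefl nu) nu0 x0 xr v0.
have alpha1 : `|alpha| <= 1.
  have vx : 0 < enorm v * enorm x by rewrite mulr_gt0.
  rewrite normrM normfV (gtr0_norm vx) ler_pdivrMr// mul1r.
  have a1 : dotv ((enorm v)^-1 *: v) ((enorm v)^-1 *: v) = 1.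
    by rewrite dotvZl dotvZr -enorm_sqr expr2; field; rewrite gt_eqF.
  have := norm_dotv x a1; rewrite dotvZl normrM normfV (gtr0_norm v0).
  by rewrite mulrC ler_pdivrMr// mulrC.
set b := enorm v * r / 2 in lim_m; rewrite -/alpha in lim_m.
have b0 : 0 < b by rewrite divr_gt0// mulr_gt0.
have bI n : besselI (nu + n%:R) (enorm v * r) = b `^ nu * (b ^+ n * bser (nu + n%:R) (b ^+ 2)).
  rewrite besselI_bser ?mulr_gt0// -/b mulrA powRD; last by apply/implyP => _; rewrite gt_eqF.
  by rewrite powR_mulrn// ltW.
set t := fun n : nat => b ^+ n * bser (nu + n%:R) (b ^+ 2) *
  (r `^ nu / enorm x `^ nu * ageg nu alpha n * Zratio (nu + n%:R) lambda (enorm x) r) in lim_m.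
split=> [dE|d3].
- have nuE : nu = 0 by rewrite /nu dE subrr mul0r.
  (* For nu = 0 the factor n kills the term of index 0 in [term2], whereas [ageg] starts with 1:
     this term is peeled off. *)
  have t0 : t 0%N = besselI 0 (enorm v * r) * Zratio 0 lambda (enorm x) r.
    have := bI 0%N; rewrite /t nuE !powRr0 -[0%:R]/(0 : R) !addr0 divr1 mul1r => <-.
    by rewrite /= !mul1r.
  have tS n : t n.+1 = term2 n.+1.
    have := bI n.+1; rewrite /t /term2 nuE !powRr0 !add0r divr1 !mul1r => ->.
    by rewrite /gegenbauer eqxx gegenbauer_zeroE; ring.
  have E : (fun N => \sum_(1 <= n < N.+1) term2 n) = fun N => \sum_(0 <= n < N.+1) t n - t 0%N.
    apply/funext => N; rewrite [X in _ = X - _]big_nat_recl// addrAC subrr add0r big_add1 /=.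
    by apply: eq_bigr => n _; rewrite tS.
  have c : (fun N => \sum_(1 <= n < N) term2 n) @ \oo --> m - t 0%N.
    rewrite -cvg_shiftS /= E; apply: cvgB; last exact: cvg_cst.
    rewrite [in X in rGamma X]nuE add0r rGamma1 mul1r in lim_m.
    by move: lim_m; rewrite -cvg_shiftS => h; exact: h.
  split; first exact: cvgP c.
  by rewrite (cvg_lim (@Rhausdorff R) c) t0 addrC subrK.
- have nup : 0 < nu by rewrite divr_gt0// subr_gt0 ltr_nat.
  (* The factor nu is the normalization in [gegenbauer_posE], and 2^nu stems from b = |v| r / 2 in
     the power of b in front of I; the power of |v| cancels. *)
  have E n : term3 n = nu / 2 `^ nu * t n.
    rewrite /term3 bI /gegenbauer gt_eqF// gegenbauer_posE// /t.
    rewrite (_ : b `^ nu = enorm v `^ nu * r `^ nu / 2 `^ nu); last first.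
      have e : enorm v * r = b * 2 by rewrite divfK.
      rewrite -powRM ?ltW// e powRM ?(ltW b0)//.
      by rewrite mulfK// gt_eqF// powR_gt0.
    rewrite powRM ?ltW//.
    have h1 : enorm v `^ nu != 0 by rewrite gt_eqF// powR_gt0.
    have h2 : enorm x `^ nu != 0 by rewrite gt_eqF// powR_gt0.
    have h3 : 2 `^ nu != 0 :> R by rewrite gt_eqF// powR_gt0.
    move: (enorm v `^ nu) (enorm x `^ nu) (2 `^ nu) h1 h2 h3 => p q s h1 h2 h3.
    by field; rewrite h1 h2 h3.
  have c : (fun N => \sum_(0 <= n < N) term3 n) @ \oo --> nu / 2 `^ nu * (rGamma (nu + 1) * m).
    rewrite (_ : (fun N => _) = fun N => nu / 2 `^ nu * \sum_(0 <= n < N) t n); last first.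
      by apply/funext => N; rewrite mulr_sumr; apply: eq_bigr => n _; rewrite E.
    by apply: cvgM; [exact: cvg_cst|exact: lim_m].
  split; first exact: cvgP c.
  (* Since Gamma(nu + 1) = nu Gamma(nu), the prefactor of the statement inverts nu / 2^nu times
     [rGamma (nu + 1)]. *)
  rewrite (cvg_lim (@Rhausdorff R) c) /rGamma GammaS//; congr EFin.
  have h3 : 2 `^ nu != 0 :> R by rewrite gt_eqF// powR_gt0.
  have h4 : Gamma nu != 0 by rewrite gt_eqF// Gamma_gt0.
  have h5 : nu != 0 by rewrite gt_eqF.
  by move: (2 `^ nu) (Gamma nu) h3 h4 => p q h3 h4; field; rewrite h3 h4 h5.
Qed.
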